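(* Consider a discrete memoryless MARC or MABRC with channel law $p(y_3,y|x_1,x_2,x_3)$, correlated sources $(S_1,S_2)$, relay side information $W_3$ and receiver side information $W$ with joint law $p(s_1,s_2,w_3,w)$, and let the source pair $(S_1,S_2)$ have common part $T\triangleq h_1(S_1)=h_2(S_2)$. The source-channel rate $\kappa=1$ is achievable (for the MARC, and also for the MABRC) if $$\begin{aligned} H(S_1|S_2,W_3) &< I(X_1;Y_3|S_1,X_2,X_3,Q),\\ H(S_2|S_1,W_3) &< I(X_2;Y_3|S_2,X_1,X_3,Q),\\ H(S_1,S_2|W_3) &< I(X_1,X_2;Y_3|S_1,S_2,X_3,Q),\\ H(S_1|S_2,W) &< I(X_1,X_3;Y|S_2,X_2,W,Q),\\ H(S_2|S_1,W) &< I(X_2,X_3;Y|S_1,X_1,W,Q),\\ H(S_1,S_2|W,T) &< I(X_1,X_2,X_3;Y|W,T,Q),\\ H(S_1,S_2|W) &< I(X_1,X_2,X_3;Y|W), \end{aligned}$$ for some joint distribution (with auxiliary random variable $Q$ on a finite alphabet) that factorizes as $$p(s_1,s_2,w_3,w)\,p(q)\,p(x_1|s_1,q)\,p(x_2|s_2,q)\,p(x_3|s_1,s_2,q)\,p(y_3,y|x_1,x_2,x_3).$$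
   Context: Sources and side information. $\{(S_{1,k},S_{2,k},W_k,W_{3,k})\}_{k\ge 1}$ are i.i.d. across $k$ with joint law $p(s_1,s_2,w,w_3)$ on a finite alphabet $\mathcal S_1\times\mathcal S_2\times\mathcal W\times\mathcal W_3$, known to all nodes. Transmitter $i$ ($i=1,2$) observes $S_i^m$, the relay observes side information $W_3^m$, the receiver (destination) observes side information $W^m$. The common part $T$ of $(S_1,S_2)$ is the common information in the sense of G\'acs, K\''orner and Witsenhausen: $T=h_1(S_1)=h_2(S_2)$, where $h_1,h_2$ are deterministic functions. Channel. The discrete memoryless multiple-access relay channel (MARC) has finite input alphabets $\mathcal X_1,\mathcal X_2,\mathcal X_3$ (transmitter 1, transmitter 2, relay), finite output alphabets $\mathcal Y$ (receiver), $\mathcal Y_3$ (relay), and is memoryless: for each $k=1,\dots,n$, the conditional law of $(Y_k,Y_{3,k})$ given all sources, side informations, inputs up to time $k$ and outputs up to time $k-1$ equals $p(y_k,y_{3,k}|x_{1,k},x_{2,k},x_{3,k})$. Codes. An $(m,n)$ source-channel code for the multiple-access broadcast relay channel (MABRC) consists of encoders $f_i^{(m,n)}:\mathcal S_i^m\to\mathcal X_i^n$, $i=1,2$; causal relay encoders with $x_{3,k}=f_{3,k}^{(m,n)}(y_{3,1}^{k-1},w_3^m)$, $1\le k\le n$; a receiver decoder $g^{(m,n)}:\mathcal Y^n\times\mathcal W^m\to\mathcal S_1^m\times\mathcal S_2^m$ with output $(\hat S_1^m,\hat S_2^m)$; and a relay decoder $g_3^{(m,n)}:\mathcal Y_3^n\times\mathcal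 W_3^m\to\mathcal S_1^m\times\mathcal S_2^m$ with output $(\tilde S_1^m,\tilde S_2^m)$. A code for the MARC is the same without the relay decoder $g_3^{(m,n)}$. Error probability. MABRC: $P_e^{(m,n)}=\Pr\big\{\{(\hat S_1^m,\hat S_2^m)\ne(S_1^m,S_2^m)\}\cup\{(\tilde S_1^m,\tilde S_2^m)\neq(S_1^m,S_2^m)\}\big\}$. MARC: $P_e^{(m,n)}=\Pr\{(\hat S_1^m,\hat S_2^m)\ne(S_1^m,S_2^m)\}$. Achievability. A source-channel rate $\kappa$ is achievable if for every $\epsilon>0$ there is $m_0$ such that for all $m>m_0$, with $n=\lfloor\kappa m\rfloor$, there exists an $(m,n)$ code with $P_e^{(m,n)}<\epsilon$. *)

(* Defs.v *)
From mathcomp Require Import all_boot all_order all_algebra.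
From mathcomp Require Import reals exp.

Set Implicit Arguments.
Unset Strict Implicit.
Unset Printing Implicit Defensive.

Import Order.TTheory GRing.Theory Num.Theory.
Local Open Scope ring_scope.

Definition is_pmf (R : realType) (A : finType) (p : A -> R) : Prop :=
  (forall a, 0 <= p a) /\ \sum_a p a = 1.

(* A random variable on a finite probability space (Omega, P) is any function
   on Omega; [%X, .., Z] is the vector of several random variables. *)
Definition pairRV (Omega A B : Type) (X : Omega -> A) (Y : Omega -> B) :
  Omega -> A * B := fun o => (X o, Y o).

Notation "[% X , Y , .. , Z ]" := (pairRV .. (pairRV X Y) .. Z)
  (at level 0, format "[%  X ,  Y ,  .. ,  Z ]").

Definition law (R : realType) (Omega A : finType) (P : Omega -> R)
    (X : Omega -> A) (a : A) : R :=
  \sum_(o | X o == a) P o.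

(* Entropies are in nats; the base of the logarithm is immaterial for the
   comparison of information quantities.  The convention 0 log 0 = 0 holds
   because the factor in front of [ln] vanishes. *)
Definition entropy (R : realType) (Omega A : finType) (P : Omega -> R)
    (X : Omega -> A) : R :=
  - \sum_a law P X a * ln (law P X a).

Definition cond_entropy (R : realType) (Omega A B : finType) (P : Omega -> R)
    (X : Omega -> A) (Y : Omega -> B) : R :=
  - \sum_a \sum_b
      law P [% X, Y] (a, b) * ln (law P [% X, Y] (a, b) / law P Y b).

Definition cond_mutual_info (R : realType) (Omega A B C : finType)
    (P : Omega -> R) (X : Omega -> A) (Y : Omega -> B) (Z : Omega -> C) : R :=
  cond_entropy P X Z - cond_entropy P X [% Y, Z].

Notation "'`H[' P ]( X | Y )" := (cond_entropy P X Y)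
  (at level 0, P, X, Y at level 99, format "'`H[' P ]( X  |  Y )").
Notation "'`I[' P ]( X ; Y | Z )" := (cond_mutual_info P X Y Z)
  (at level 0, P, X, Y, Z at level 99, format "'`I[' P ]( X ;  Y  |  Z )").

Definition common_function (R : realType) (Omega A B T : finType)
    (P : Omega -> R) (X : Omega -> A) (Y : Omega -> B)
    (h1 : A -> T) (h2 : B -> T) : Prop :=
  forall o, P o != 0 -> h1 (X o) = h2 (Y o).

(* Gacs-Korner-Witsenhausen: T = h1(X) = h2(Y) almost surely, and T has the
   largest entropy among all such common functions of X and Y. *)
Definition GKW_common_part (R : realType) (Omega A B T : finType)
    (P : Omega -> R) (X : Omega -> A) (Y : Omega -> B)
    (h1 : A -> T) (h2 : B -> T) : Prop :=
  common_function P X Y h1 h2 /\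
  (forall (T' : finType) (h1' : A -> T') (h2' : B -> T'),
     common_function P X Y h1' h2' ->
     entropy P (h1' \o X) <= entropy P (h1 \o X)).

(* One source symbol is a quadruple (s1, s2, w3, w). *)
Definition src_S1 (S1 S2 W3 W : Type) (z : S1 * S2 * W3 * W) : S1 := z.1.1.1.
Definition src_S2 (S1 S2 W3 W : Type) (z : S1 * S2 * W3 * W) : S2 := z.1.1.2.
Definition src_W3 (S1 S2 W3 W : Type) (z : S1 * S2 * W3 * W) : W3 := z.1.2.
Definition src_W (S1 S2 W3 W : Type) (z : S1 * S2 * W3 * W) : W := z.2.

Arguments src_S1 {S1 S2 W3 W} z.
Arguments src_S2 {S1 S2 W3 W} z.
Arguments src_W3 {S1 S2 W3 W} z.
Arguments src_W {S1 S2 W3 W} z.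

Definition is_channel (R : realType) (X1 X2 X3 Y3 Y : finType)
    (ch : X1 -> X2 -> X3 -> Y3 * Y -> R) : Prop :=
  forall x1 x2 x3, is_pmf (ch x1 x2 x3).

Section Codes.
Context (S1 S2 W3 W X1 X2 X3 Y3 Y : finType).

(* Channel uses are numbered from 0, so the relay input at time [k] depends on
   the first [k] relay outputs: [relay_enc k] is only ever applied to a history
   of length [k]. *)
Record marc_code (m n : nat) := MarcCode {
  enc1 : m.-tuple S1 -> n.-tuple X1;
  enc2 : m.-tuple S2 -> n.-tuple X2;
  relay_enc : 'I_n -> seq Y3 -> m.-tuple W3 -> X3;
  dec : n.-tuple Y -> m.-tuple W -> m.-tuple S1 * m.-tuple S2 }.

Record mabrc_code (m n : nat) := MabrcCode {
  base_code : marc_code m n;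
  relay_dec : n.-tuple Y3 -> m.-tuple W3 -> m.-tuple S1 * m.-tuple S2 }.

Context (R : realType).
Variables (pS : S1 * S2 * W3 * W -> R) (ch : X1 -> X2 -> X3 -> Y3 * Y -> R).

(* Joint law of the m source quadruples and the n output pairs (y3, y) induced
   by the code, the i.i.d. sources and the memoryless channel. *)
Definition code_pmf (m n : nat) (c : marc_code m n)
    (o : m.-tuple (S1 * S2 * W3 * W) * n.-tuple (Y3 * Y)) : R :=
  let s1 := map_tuple src_S1 o.1 in
  let s2 := map_tuple src_S2 o.1 in
  let w3 := map_tuple src_W3 o.1 in
  let y3 := map_tuple fst o.2 in
  (\prod_(j < m) pS (tnth o.1 j)) *
  \prod_(k < n) ch (tnth (enc1 c s1) k) (tnth (enc2 c s2) k)
                   (relay_enc c k (take k y3) w3) (tnth o.2 k).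

Definition dec_error (m n : nat) (c : marc_code m n)
    (o : m.-tuple (S1 * S2 * W3 * W) * n.-tuple (Y3 * Y)) : bool :=
  dec c (map_tuple snd o.2) (map_tuple src_W o.1)
  != (map_tuple src_S1 o.1, map_tuple src_S2 o.1).

Definition relay_dec_error (m n : nat) (c : mabrc_code m n)
    (o : m.-tuple (S1 * S2 * W3 * W) * n.-tuple (Y3 * Y)) : bool :=
  relay_dec c (map_tuple fst o.2) (map_tuple src_W3 o.1)
  != (map_tuple src_S1 o.1, map_tuple src_S2 o.1).

Definition Pe_marc (m n : nat) (c : marc_code m n) : R :=
  \sum_(o | dec_error c o) code_pmf c o.

Definition Pe_mabrc (m n : nat) (c : mabrc_code m n) : R :=
  \sum_(o | dec_error (base_code c) o || relay_dec_error c o)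
     code_pmf (base_code c) o.

Definition achievable_marc (kappa : R) : Prop :=
  forall eps : R, 0 < eps -> exists m0 : nat, forall m : nat, (m0 < m)%N ->
    exists c : marc_code m (Num.truncn (kappa * m%:R)), Pe_marc c < eps.

Definition achievable_mabrc (kappa : R) : Prop :=
  forall eps : R, 0 < eps -> exists m0 : nat, forall m : nat, (m0 < m)%N ->
    exists c : mabrc_code m (Num.truncn (kappa * m%:R)), Pe_mabrc c < eps.

End Codes.

Section SingleLetter.
Context (S1 S2 W3 W Q X1 X2 X3 Y3 Y : finType).

(* Sample space of the single-letter random variables
   (S1, S2, W3, W), Q, X1, X2, X3, (Y3, Y). *)
Definition letters : finType :=
  ((S1 * S2 * W3 * W) * Q * X1 * X2 * X3 * (Y3 * Y))%type.

Definition rvS1 (o : letters) : S1 := let: (z, _, _, _, _, _) := o in src_S1 z.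
Definition rvS2 (o : letters) : S2 := let: (z, _, _, _, _, _) := o in src_S2 z.
Definition rvW3 (o : letters) : W3 := let: (z, _, _, _, _, _) := o in src_W3 z.
Definition rvW (o : letters) : W := let: (z, _, _, _, _, _) := o in src_W z.
Definition rvQ (o : letters) : Q := let: (_, q, _, _, _, _) := o in q.
Definition rvX1 (o : letters) : X1 := let: (_, _, x1, _, _, _) := o in x1.
Definition rvX2 (o : letters) : X2 := let: (_, _, _, x2, _, _) := o in x2.
Definition rvX3 (o : letters) : X3 := let: (_, _, _, _, x3, _) := o in x3.
Definition rvY3 (o : letters) : Y3 := let: (_, _, _, _, _, (y3, _)) := o in y3.
Definition rvY (o : letters) : Y := let: (_, _, _, _, _, (_, y)) := o in y.

Definition joint_pmf (R : realType) (pS : S1 * S2 * W3 * W -> R) (pQ : Q -> R)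
    (pX1 : S1 -> Q -> X1 -> R) (pX2 : S2 -> Q -> X2 -> R)
    (pX3 : S1 -> S2 -> Q -> X3 -> R) (ch : X1 -> X2 -> X3 -> Y3 * Y -> R)
    (o : letters) : R :=
  let: (z, q, x1, x2, x3, y3y) := o in
  pS z * pQ q * pX1 (src_S1 z) q x1 * pX2 (src_S2 z) q x2 *
  pX3 (src_S1 z) (src_S2 z) q x3 * ch x1 x2 x3 y3y.

End SingleLetter.

Arguments rvS1 {S1 S2 W3 W Q X1 X2 X3 Y3 Y} o.
Arguments rvS2 {S1 S2 W3 W Q X1 X2 X3 Y3 Y} o.
Arguments rvW3 {S1 S2 W3 W Q X1 X2 X3 Y3 Y} o.
Arguments rvW {S1 S2 W3 W Q X1 X2 X3 Y3 Y} o.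
Arguments rvQ {S1 S2 W3 W Q X1 X2 X3 Y3 Y} o.
Arguments rvX1 {S1 S2 W3 W Q X1 X2 X3 Y3 Y} o.
Arguments rvX2 {S1 S2 W3 W Q X1 X2 X3 Y3 Y} o.
Arguments rvX3 {S1 S2 W3 W Q X1 X2 X3 Y3 Y} o.
Arguments rvY3 {S1 S2 W3 W Q X1 X2 X3 Y3 Y} o.
Arguments rvY {S1 S2 W3 W Q X1 X2 X3 Y3 Y} o.

(* Main.v *)
Require Import Defs.
From mathcomp Require Import all_boot all_order all_algebra.
From mathcomp Require Import reals sequences exp.
From mathcomp Require Import ring lra.

(* Block-Markov coding.  The m source symbols are cut into B blocks and the m
   channel uses into B+1 slightly shorter blocks; in channel block b transmitter
   i sends a random word indexed by its source blocks b+1 and b, drawn letter by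
   letter from p(x_i|s_i,q) given block b, where the word q is itself indexed by
   the common part of block b, and the relay, which already knows block b, sends
   a word drawn from p(x_3|s_1,s_2,q).  The relay decodes block b+1 forward; the
   destination decodes block b backward, knowing block b+1.  Source blocks are
   longer than channel blocks by a factor (B+1)/B, which the strictness of the
   inequalities absorbs.

   Both decoders accept a candidate when products of the form p(s|w) p(y|x)/p(y)
   exceed thresholds: by Markov's inequality the expected number of wrong
   candidates passing such a test is at most 1/threshold, without any counting
   of typical sequences, while the right candidate passes by Chernoff's bound. *)

Set Implicit Arguments.
Unset Strict Implicit.
Unset Printing Implicit Defensive.

Import Order.TTheory GRing.Theory Num.Theory.
Local Open Scope ring_scope.

(** * Expectations over finite product laws *)

(** A wrong candidate is classed by the codewords it shares with the truth: these are frozen, and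
    the others are independent of the output. This yields one class per inequality. A destination
    candidate with another common part also uses another word q, so its class averages over Q and
    gives a mutual information not conditioned on Q. A codeword is indexed by two source blocks but
    its law depends on the older one only. A wrong new block thus means a fresh word of the same
    law, and the relay's source and channel scores separate. A wrong old block changes the law too,
    so at the destination the two scores are averaged together, letter by letter, as a mixture. The
    obstacle is the relay: its inputs depend on past outputs through its estimates, so the output
    letters are not independent given the sources. It is replaced by a genie relay that knows the
    true blocks. Both laws agree on outcomes without block error and have mass one, hence give the
    same mass to block errors. To make the source blocks exactly i.i.d., the padding is also drawn
    from the source law, and is fixed last. *)

Section Expectation.
Variable R : realType.
Implicit Types V U : finType.

Definition expect V (w F : V -> R) : R := \sum_v w v * F v.

Lemma eq_expect V (w F G : V -> R) : F =1 G -> expect w F = expect w G.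
Proof. by move=> FG; apply: eq_bigr => v _; rewrite FG. Qed.

Lemma eq_expect2 V (w u F G : V -> R) :
  w =1 u -> F =1 G -> expect w F = expect u G.
Proof. by move=> wu FG; apply: eq_bigr => v _; rewrite wu FG. Qed.

Lemma expect_const V (w : V -> R) c : is_pmf w -> expect w (fun=> c) = c.
Proof. by case=> _ w1; rewrite /expect -mulr_suml w1 mul1r. Qed.

Lemma ler_expect V (w F G : V -> R) : is_pmf w ->
  (forall v, w v != 0 -> F v <= G v) -> expect w F <= expect w G.
Proof.
move=> [w0 _] FG; apply: ler_sum => v _.
by have [->|/FG ?] := eqVneq (w v) 0; rewrite ?mul0r// ler_wpM2l.
Qed.

Lemma expect_le V (w F : V -> R) c : is_pmf w ->
  (forall v, w v != 0 -> F v <= c) -> expect w F <= c.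
Proof. by move=> wp Fc; rewrite -(expect_const c wp); apply: ler_expect. Qed.

Lemma expect_ge0 V (w F : V -> R) : is_pmf w ->
  (forall v, 0 <= F v) -> 0 <= expect w F.
Proof. by move=> [w0 _] F0; apply: sumr_ge0 => v _; rewrite mulr_ge0. Qed.

Lemma expectD V (w F G : V -> R) :
  expect w (fun v => F v + G v) = expect w F + expect w G.
Proof. by rewrite /expect -big_split/=; apply: eq_bigr => v _; rewrite mulrDr. Qed.

Lemma expectZl V (w F : V -> R) c :
  expect w (fun v => c * F v) = c * expect w F.
Proof. by rewrite /expect mulr_sumr; apply: eq_bigr => v _; rewrite mulrCA. Qed.

Lemma expectZr V (w F : V -> R) c :
  expect w (fun v => F v * c) = expect w F * c.
Proof. by rewrite /expect mulr_suml; apply: eq_bigr => v _; rewrite mulrA. Qed.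

Lemma expect_sum V (J : Type) (r : seq J) (S : pred J) (w : V -> R)
    (F : J -> V -> R) :
  expect w (fun v => \sum_(j <- r | S j) F j v) =
  \sum_(j <- r | S j) expect w (F j).
Proof.
rewrite /expect exchange_big/=; apply: eq_bigr => v _.
by rewrite mulr_sumr.
Qed.

Lemma expect_exchange V U (w : V -> R) (u : U -> R) (F : V -> U -> R) :
  expect w (fun v => expect u (F v)) = expect u (fun x => expect w (F^~ x)).
Proof.
rewrite /expect; under eq_bigr do rewrite mulr_sumr.
rewrite exchange_big/=; apply: eq_bigr => x _; rewrite mulr_sumr.
by apply: eq_bigr => v _; rewrite mulrCA.
Qed.

Lemma expect_ind V (w F : V -> R) a :
  expect w (fun v => (v == a)%:R * F v) = w a * F a.
Proof.
rewrite /expect (bigD1 a)//= eqxx mul1r big1 ?addr0// => v /negbTE->.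
by rewrite mul0r mulr0.
Qed.

(** The derandomisation step: it serves to fix the codebooks, and later the padding. *)
Lemma expect_lt_ex V (w F : V -> R) c : is_pmf w ->
  expect w F < c -> exists v, F v < c.
Proof.
move=> wp; rewrite ltNge => /negP FNc.
have [/existsP[v Fv]|/existsPn Fc] := boolP [exists v, F v < c]; first by exists v.
case: FNc; rewrite -(expect_const c wp); apply: ler_expect => // v _.
by rewrite leNgt.
Qed.

Lemma pmf_inhabited V (w : V -> R) : is_pmf w -> exists v, w v != 0.
Proof.
move=> [w0 w1]; case: (pickP (fun v => w v != 0)) => [v ?|wz]; first by exists v.
move: w1; rewrite big1 => [/eqP|v _]; first by rewrite eq_sym oner_eq0.
by have /negbFE/eqP := wz v.
Qed.

Lemma pmf_ge0 V (w : V -> R) : is_pmf w -> forall v, 0 <= w v.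
Proof. by case. Qed.

Lemma pmf_sum1 V (w : V -> R) : is_pmf w -> \sum_v w v = 1.
Proof. by case. Qed.

End Expectation.

Section ProductLaw.
Variables (R : realType) (K V : finType).

(** Used at two levels: for words, [K] is the set of positions and [V] an alphabet; for codebooks,
    [K] is the set of keys and [V] the set of words, the law of a word depending on its key. *)
Definition prod_law (mu : K -> V -> R) (f : {ffun K -> V}) : R :=
  \prod_k mu k (f k).

Lemma prod_law_pmf mu : (forall k, is_pmf (mu k)) -> is_pmf (prod_law mu).
Proof.
move=> mup; split=> [f|]; first by apply: prodr_ge0 => k _; apply: pmf_ge0.
rewrite /prod_law -(bigA_distr_bigA mu) big1// => k _.
exact: pmf_sum1.
Qed.

Lemma expect_prod_law mu (G : K -> V -> R) :
  expect (prod_law mu) (fun f => \prod_k G k (f k)) =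
  \prod_k expect (mu k) (G k).
Proof.
rewrite /expect bigA_distr_bigA/=; apply: eq_bigr => f _.
by rewrite -big_split.
Qed.

Lemma prod_law_neq0 mu f k : prod_law mu f != 0 -> mu k (f k) != 0.
Proof. by move/prodf_neq0; apply. Qed.

End ProductLaw.

Section Fibers.
Variables (R : realType) (J K V : finType).

Lemma prod_fiber (psi : J -> K) (g : J -> K -> R) :
  \prod_j g j (psi j) = \prod_k \prod_(j | psi j == k) g j k.
Proof.
rewrite (exchange_big_dep xpredT)//=; apply: eq_bigr => j _.
rewrite (bigD1 (psi j))//= big1 ?mulr1// => k /andP[/eqP<-].
by rewrite eqxx.
Qed.

Lemma prod_fiber_inj (psi : J -> K) (g : J -> R) j : injective psi ->
  \prod_(i | psi i == psi j) g i = g j.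
Proof.
move=> psiI; rewrite (bigD1 j)//= big1 ?mulr1// => i /andP[/eqP/psiI->].
by rewrite eqxx.
Qed.

Lemma ffun_ind (f g : {ffun J -> V}) :
  \prod_i (f i == g i)%:R = (f == g)%:R :> R.
Proof.
have [->|fg] := eqVneq f g; first by rewrite big1// => i _; rewrite eqxx.
have /existsP[i /negbTE fgi] : [exists i, f i != g i].
  rewrite -negb_forall; apply: contra fg => /forallP fg.
  by apply/eqP/ffunP => i; apply/eqP.
by rewrite (bigD1 i)//= fgi mul0r.
Qed.

Lemma expect_marginal (psi : J -> K) (mu : K -> V -> R)
    (F : {ffun J -> V} -> R) :
  injective psi -> (forall k, is_pmf (mu k)) ->
  expect (prod_law mu) (fun f => F [ffun j => f (psi j)]) =
  expect (prod_law (mu \o psi)) F.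
Proof.
move=> psiI mup.
(* [F] is expanded in point indicators. Each is a product over the keys, so [expect_prod_law]
   applies, and keys outside the image of [psi] contribute the total mass 1. *)
have FE (f : {ffun K -> V}) : F [ffun j => f (psi j)] =
    \sum_g F g * \prod_k \prod_(j | psi j == k) (f k == g j)%:R.
  transitivity (\sum_g F g * ([ffun j => f (psi j)] == g)%:R).
    rewrite (bigD1 [ffun j => f (psi j)])//= eqxx mulr1 big1 ?addr0// => g.
    by rewrite eq_sym => /negbTE->; rewrite mulr0.
  apply: eq_bigr => g _.
  rewrite -(prod_fiber psi (fun j k => (f k == g j)%:R)) -ffun_ind.
  by congr (_ * _); apply: eq_bigr => j _; rewrite ffunE.
rewrite (eq_expect _ FE) expect_sum; apply: eq_bigr => g _.
rewrite expectZl.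
rewrite (expect_prod_law mu (fun k v => \prod_(j | psi j == k) (v == g j)%:R)).
rewrite mulrC; congr (_ * _); rewrite /prod_law /=.
rewrite (prod_fiber psi (fun j k => mu k (g j))); apply: eq_bigr => k _.
case: (pickP (fun j => psi j == k)) => [j /eqP<-|kN].
  rewrite prod_fiber_inj// /expect (bigD1 (g j))//= prod_fiber_inj// eqxx mulr1.
  rewrite big1 ?addr0// => v /negbTE vg.
  by rewrite prod_fiber_inj// vg mulr0.
rewrite [RHS]big_pred0//; apply: etrans (expect_const 1 (mup k)).
by apply: eq_expect => v; rewrite big_pred0.
Qed.

End Fibers.

Section Codebooks.
Variables (R : realType) (K V : finType) (mu : K -> V -> R).
Hypothesis mup : forall k, is_pmf (mu k).

Lemma expect_codeword k (F : V -> R) :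
  expect (prod_law mu) (fun c => F (c k)) = expect (mu k) F.
Proof.
have := @expect_marginal _ unit K V (fun=> k) mu (fun g => F (g tt)).
move=> /(_ _ mup) H.
transitivity (expect (prod_law mu) (fun f => F ([ffun j : unit => f k] tt))).
  by apply: eq_expect => c; rewrite ffunE.
rewrite H => [|[] []//]; pose h v : {ffun unit -> V} := [ffun=> v].
have hK : cancel h (@^~ tt) by move=> v; rewrite ffunE.
rewrite /expect (reindex h)/=; last first.
  by exists (@^~ tt) => g _ //; apply/ffunP => -[]; rewrite ffunE.
by apply: eq_bigr => v _; rewrite hK /prod_law (big_pred1 tt) ?hK// => -[].
Qed.

(** The first factor stays an average over the whole codebook: in [wrong_candidates_le1] it is the
    law of the output, common to all candidates. *)
Lemma expect_codewordM k k' (F G : V -> R) : k != k' ->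
  expect (prod_law mu) (fun c => F (c k) * G (c k')) =
  expect (prod_law mu) (fun c => F (c k)) * expect (mu k') G.
Proof.
move=> kk'; rewrite expect_codeword.
pose H i v := if i == k then F v else if i == k' then G v else 1.
have k'k : k' == k = false by rewrite eq_sym; apply/negbTE.
transitivity (expect (prod_law mu) (fun c => \prod_i H i (c i))).
  apply: eq_expect => c; rewrite (bigD1 k)//= (bigD1 k')/=; last by rewrite k'k.
  rewrite /H !eqxx k'k big1 ?mulr1// => i /andP[/negbTE-> /negbTE->//].
rewrite expect_prod_law (bigD1 k)//= (bigD1 k')/=; last by rewrite k'k.
rewrite /H !eqxx k'k big1 ?mulr1// => i /andP[/negbTE-> /negbTE->].
exact: expect_const.
Qed.

End Codebooks.

Lemma expect_codewordM2 (R : realType) (K V L U : finType) (mu : K -> V -> R)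
    (nu : L -> U -> R) k k' l l' (F G : V -> U -> R) :
  (forall k, is_pmf (mu k)) -> (forall l, is_pmf (nu l)) -> k != k' -> l != l' ->
  expect (prod_law mu) (fun c => expect (prod_law nu) (fun d =>
    F (c k) (d l) * G (c k') (d l'))) =
  expect (prod_law mu) (fun c => expect (prod_law nu) (fun d => F (c k) (d l))) *
  expect (mu k') (fun x => expect (nu l') (G x)).
Proof.
move=> mup nup kk ll.
transitivity (expect (prod_law mu) (fun c =>
    expect (prod_law nu) (fun d => F (c k) (d l)) *
    expect (nu l') (G (c k')))).
  by apply: eq_expect => c; exact: expect_codewordM.
exact: (expect_codewordM mup (fun x => expect (prod_law nu) (fun d => F x (d l)))
  (fun x => expect (nu l') (G x)) kk).
Qed.

Lemma expect_codewordM3 (R : realType) (K V L U M W : finType) (mu : K -> V -> R)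
    (nu : L -> U -> R) (xi : M -> W -> R) k k' l l' m m'
    (F G : V -> U -> W -> R) :
  (forall k, is_pmf (mu k)) -> (forall l, is_pmf (nu l)) ->
  (forall m, is_pmf (xi m)) -> k != k' -> l != l' -> m != m' ->
  expect (prod_law mu) (fun c => expect (prod_law nu) (fun d =>
    expect (prod_law xi) (fun e =>
      F (c k) (d l) (e m) * G (c k') (d l') (e m')))) =
  expect (prod_law mu) (fun c => expect (prod_law nu) (fun d =>
    expect (prod_law xi) (fun e => F (c k) (d l) (e m)))) *
  expect (mu k') (fun x => expect (nu l') (fun y => expect (xi m') (G x y))).
Proof.
move=> mup nup xip kk ll mm.
transitivity (expect (prod_law mu) (fun c => expect (prod_law nu) (fun d =>
    expect (prod_law xi) (fun e => F (c k) (d l) (e m)) *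
    expect (xi m') (G (c k') (d l'))))).
  by apply: eq_expect => c; apply: eq_expect => d; exact: expect_codewordM.
exact: (expect_codewordM2
  (fun x y => expect (prod_law xi) (fun e => F x y (e m)))
  (fun x y => expect (xi m') (G x y)) mup nup kk ll).
Qed.

Lemma sum_pair (R : realType) (A B : finType) (F : A * B -> R) :
  \sum_o F o = \sum_a \sum_b F (a, b).
Proof. by rewrite pair_bigA; apply: eq_bigr => -[]. Qed.

Section PairLaw.
Variables (R : realType) (C D : finType) (w : C -> R) (u : D -> R).

Definition pair_law (cd : C * D) : R := w cd.1 * u cd.2.

Lemma expect_pair_law (F : C * D -> R) :
  expect pair_law F = expect w (fun c => expect u (fun d => F (c, d))).
Proof.
rewrite /expect sum_pair; apply: eq_bigr => c _; rewrite mulr_sumr; apply: eq_bigr => d _.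
by rewrite mulrA.
Qed.

Lemma pair_law_pmf : is_pmf w -> is_pmf u -> is_pmf pair_law.
Proof.
move=> wp up; split=> [cd|]; first by rewrite mulr_ge0// pmf_ge0.
have := expect_pair_law (fun=> 1); rewrite /expect.
under eq_bigr do rewrite mulr1.
move=> ->; apply: etrans (expect_const 1 wp).
by apply: eq_bigr => c _; congr (_ * _); exact: expect_const.
Qed.

End PairLaw.

(** * Threshold decoding and its union bound *)

Section UnionBound.
Variable R : realType.

Lemma pick_error_le (A : finType) (pass : pred A) (a0 a : A) :
  (odflt a0 [pick x | pass x] != a)%:R <=
  (~~ pass a)%:R + \sum_(x | x != a) (pass x)%:R :> R.
Proof.
have S0 : 0 <= \sum_(x | x != a) (pass x)%:R :> R by apply: sumr_ge0.
have [pa|] := boolP (pass a); last first.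
  by move=> _; case: (_ != a) => /=; lra.
case: pickP => [x px /=|/(_ a)]; last by rewrite pa.
have [_|xa] := eqVneq x a => /=; first by lra.
rewrite (bigD1 x)//= px; set S := (X in _ + (_ + X)).
have : 0 <= S by apply: sumr_ge0.
by rewrite /=; lra.
Qed.

(** Markov's inequality before averaging; the mean over codebooks and outputs is taken later. *)
Lemma ind_threshold (x theta : R) : 0 < theta -> 0 <= x ->
  (theta <= x)%R%:R <= theta^-1 * x.
Proof.
move=> t0 x0; have [tx|_] := leP theta x; last first.
  by rewrite mulr_ge0// invr_ge0 ltW.
by rewrite mulrC ler_pdivlMr// mul1r.
Qed.

Variables (A1 A2 T : finType) (h1 : A1 -> T) (h2 : A2 -> T).
Variables (g1 g2 g3 g4 : A1 -> A2 -> R) (th1 th2 th3 th4 : R).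
Hypothesis (g1_ge0 : forall x1 x2, 0 <= g1 x1 x2)
  (g2_ge0 : forall x1 x2, 0 <= g2 x1 x2) (g3_ge0 : forall x1 x2, 0 <= g3 x1 x2)
  (g4_ge0 : forall x1 x2, 0 <= g4 x1 x2).
Hypothesis (th1_gt0 : 0 < th1) (th2_gt0 : 0 < th2) (th3_gt0 : 0 < th3)
  (th4_gt0 : 0 < th4).

Definition passes_tests (x : A1 * A2) : bool :=
  [&& h1 x.1 == h2 x.2, th1 <= g1 x.1 x.2, th2 <= g2 x.1 x.2,
      th3 <= g3 x.1 x.2 & th4 <= g4 x.1 x.2].

(** Candidates whose halves disagree on the common part never pass. The others fall into four
    classes: first half wrong, second half wrong, both wrong, all with the true common part, or
    common part wrong. A wrong candidate is charged only to the test of its class. *)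
Lemma threshold_decoder_error_le (a0 : A1 * A2) (a1 : A1) (a2 : A2) :
  h1 a1 = h2 a2 ->
  (odflt a0 [pick x | passes_tests x] != (a1, a2))%:R <=
  ((g1 a1 a2 < th1)%R%:R + (g2 a1 a2 < th2)%R%:R + (g3 a1 a2 < th3)%R%:R
    + (g4 a1 a2 < th4)%R%:R) +
  (th1^-1 * \sum_(x1 | (x1 != a1) && (h1 x1 == h1 a1)) g1 x1 a2 +
   th2^-1 * \sum_(x2 | (x2 != a2) && (h2 x2 == h1 a1)) g2 a1 x2 +
   th3^-1 * \sum_(x | [&& x.1 != a1, x.2 != a2, h1 x.1 == h1 a1 &
                          h2 x.2 == h1 a1]) g3 x.1 x.2 +
   th4^-1 * \sum_(x | (h1 x.1 != h1 a1) && (h2 x.2 == h1 x.1)) g4 x.1 x.2).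
Proof.
move=> h12; apply: le_trans (pick_error_le _ _ _) _; apply: lerD.
  rewrite /passes_tests /= h12 eqxx/= !negb_and -!ltNge.
  by rewrite -!natrD ler_nat; do 4![case: (_ < _)].
(* The row and column sums become sums over pairs, so that the bound can be checked candidate by
   candidate. *)
have row : \sum_(x1 | (x1 != a1) && (h1 x1 == h1 a1)) g1 x1 a2 =
    \sum_(x | [&& x.2 == a2, x.1 != a1 & h1 x.1 == h1 a1]) g1 x.1 x.2.
  rewrite (reindex_onto (fun x1 => (x1, a2)) fst)/=.
    by apply: eq_bigl => x1; rewrite !eqxx andbT.
  by move=> [x1 x2] /= /andP[/eqP->].
have col : \sum_(x2 | (x2 != a2) && (h2 x2 == h1 a1)) g2 a1 x2 =
    \sum_(x | [&& x.1 == a1, x.2 != a2 & h2 x.2 == h1 a1]) g2 x.1 x.2.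
  rewrite (reindex_onto (fun x2 => (a1, x2)) snd)/=.
    by apply: eq_bigl => x2; rewrite !eqxx andbT.
  by move=> [x1 x2] /= /andP[/eqP->].
have cond (P : pred (A1 * A2)) (F : A1 * A2 -> R) c :
    c * \sum_(x | P x) F x = \sum_x (if P x then c * F x else 0).
  by rewrite mulr_sumr big_mkcond.
rewrite row col !cond big_mkcond -!big_split/=.
apply: ler_sum => -[x1 x2] _; rewrite /passes_tests xpair_eqE /=.
have b1 := ind_threshold th1_gt0 (g1_ge0 x1 x2).
have b2 := ind_threshold th2_gt0 (g2_ge0 x1 x2).
have b3 := ind_threshold th3_gt0 (g3_ge0 x1 x2).
have b4 := ind_threshold th4_gt0 (g4_ge0 x1 x2).
have n1 : 0 <= th1^-1 * g1 x1 x2 by apply: le_trans b1.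
have n2 : 0 <= th2^-1 * g2 x1 x2 by apply: le_trans b2.
have n3 : 0 <= th3^-1 * g3 x1 x2 by apply: le_trans b3.
have n4 : 0 <= th4^-1 * g4 x1 x2 by apply: le_trans b4.
have [e|] := eqVneq (h1 x1) (h2 x2); last first.
  by move=> _ /=; rewrite if_same !addr_ge0//; case: ifP.
rewrite -e ?eqxx ?andbT /=.
have [x1a|x1a] := eqVneq x1 a1; have [x2a|x2a] := eqVneq x2 a2 => //=.
- by rewrite !add0r; case: ifP.
all: set pass := [&& _, _, _ & _].
all: have ind_le (b : bool) : (pass -> b) -> pass%:R <= b%:R :> R
  by case: pass b => [] [] // /(_ isT).
all: have p1 : pass%:R <= th1^-1 * g1 x1 x2
  by apply: le_trans b1; apply: ind_le => /and4P[].
all: have p2 : pass%:R <= th2^-1 * g2 x1 x2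
  by apply: le_trans b2; apply: ind_le => /and4P[].
all: have p3 : pass%:R <= th3^-1 * g3 x1 x2
  by apply: le_trans b3; apply: ind_le => /and4P[].
all: have p4 : pass%:R <= th4^-1 * g4 x1 x2
  by apply: le_trans b4; apply: ind_le => /and4P[].
all: by case: (h1 x1 == h1 a1); rewrite /= ?addr0 ?add0r.
Qed.

End UnionBound.

(** * One-shot random coding *)

Lemma ler_sum_subset (R : realType) (J : finType) (S : pred J) (F : J -> R) :
  (forall j, 0 <= F j) -> \sum_(j | S j) F j <= \sum_j F j.
Proof.
by move=> F0; rewrite [leRHS] (bigID S)/= lerDl; apply: sumr_ge0 => j _.
Qed.

Lemma ind_or_le (R : realType) (a b : bool) : (a || b)%:R <= a%:R + b%:R :> R.
Proof. by rewrite -natrD ler_nat; case: a b => [] []. Qed.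

Section RandomCoding.
Variables (R : realType) (C Y J : finType) (w : C -> R) (kern : C -> Y -> R).
Variables (S : pred J) (g : J -> C -> Y -> R) (m : J -> Y -> R).
Hypotheses (wp : is_pmf w) (kernp : forall c, is_pmf (kern c)).

(* Each wrong codeword is independent of the channel output [y]; [m j y] is the
   mean of its score, so the factorization leaves the true output law alone. *)
Lemma wrong_candidates_le1 :
  (forall j y, S j -> expect w (fun c => kern c y * g j c y) =
     expect w (kern^~ y) * m j y) ->
  (forall y, \sum_(j | S j) m j y <= 1) ->
  expect w (fun c => expect (kern c) (fun y => \sum_(j | S j) g j c y)) <= 1.
Proof.
move=> gE m1.
have -> : expect w (fun c => expect (kern c) (fun y => \sum_(j | S j) g j c y))
    = \sum_y expect w (kern^~ y) * \sum_(j | S j) m j y.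
  rewrite -[LHS]/(expect w (fun c => \sum_y kern c y * \sum_(j | S j) g j c y)) expect_sum.
  apply: eq_bigr => y _; rewrite mulr_sumr.
  under eq_expect do rewrite mulr_sumr.
  by rewrite expect_sum; apply: eq_bigr => j Sj; exact: gE.
apply: le_trans (_ : \sum_y expect w (kern^~ y) <= _).
  apply: ler_sum => y _; rewrite ler_piMr// expect_ge0// => c.
  exact: pmf_ge0.
rewrite -expect_sum; apply: expect_le => // c _.
by rewrite pmf_sum1.
Qed.

End RandomCoding.

Section OneShot.
Variable R : realType.
Variables (Z A1 A2 V3 V T Q X1 X2 X3 Y3 Y O : finType).
Variables (p : Z -> R) (f1 : Z -> A1) (f2 : Z -> A2) (f3 : Z -> V3) (f0 : Z -> V).
Variables (h1 : A1 -> T) (h2 : A2 -> T).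
Variables (muQ : Q -> R) (mu1 : A1 -> Q -> X1 -> R) (mu2 : A2 -> Q -> X2 -> R)
  (mu3 : A1 -> A2 -> Q -> X3 -> R) (K : X1 -> X2 -> X3 -> O -> R) (o3 : O -> Y3)
  (o0 : O -> Y).
Hypotheses (pp : is_pmf p) (muQp : is_pmf muQ)
  (mu1p : forall a q, is_pmf (mu1 a q)) (mu2p : forall a q, is_pmf (mu2 a q))
  (mu3p : forall a1 a2 q, is_pmf (mu3 a1 a2 q))
  (Kp : forall x1 x2 x3, is_pmf (K x1 x2 x3)).
Hypothesis common : forall z, p z != 0 -> h1 (f1 z) = h2 (f2 z).

(* [rho1 s1 s2 w3 a1 a2 q x1 x2 x3 y3] scores the candidate [(s1, s2)] for the
   current source block, [(a1, a2)] being the previous one. *)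
Definition relay_score :=
  A1 -> A2 -> V3 -> A1 -> A2 -> Q -> X1 -> X2 -> X3 -> Y3 -> R.
Definition dest_score :=
  A1 -> A2 -> V -> T -> Q -> X1 -> X2 -> X3 -> Y -> R.

(** The law of the words actually sent and received. Only the previous block [z] enters: the new
    block selects a codeword without affecting its law. *)
Definition true_expect (z : Z) (F : Q -> X1 -> X2 -> X3 -> O -> R) : R :=
  expect muQ (fun q =>
  expect (mu1 (f1 z) q) (fun x1 =>
  expect (mu2 (f2 z) q) (fun x2 =>
  expect (mu3 (f1 z) (f2 z) q) (fun x3 =>
  expect (K x1 x2 x3) (fun y => F q x1 x2 x3 y))))).

Definition relay_miss (rho : relay_score) (theta : R) : R :=
  expect p (fun z => expect p (fun z' => true_expect z (fun q x1 x2 x3 y =>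
    (rho (f1 z') (f2 z') (f3 z') (f1 z) (f2 z) q x1 x2 x3 (o3 y) < theta)%R%:R))).

Definition dest_miss (rho : dest_score) (theta : R) : R :=
  expect p (fun z => true_expect z (fun q x1 x2 x3 y =>
    (rho (f1 z) (f2 z) (f0 z) (h1 (f1 z)) q x1 x2 x3 (o0 y) < theta)%R%:R)).

Variables (rho1 rho2 rho3 : relay_score) (rho4 rho5 rho6 rho7 : dest_score).
Variables th1 th2 th3 th4 th5 th6 th7 : R.

Hypothesis rho_ge0 :
  (forall s1 s2 w a1 a2 q x1 x2 x3 y,
    [/\ 0 <= rho1 s1 s2 w a1 a2 q x1 x2 x3 y,
        0 <= rho2 s1 s2 w a1 a2 q x1 x2 x3 y &
        0 <= rho3 s1 s2 w a1 a2 q x1 x2 x3 y]) /\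
  (forall a1 a2 w t q x1 x2 x3 y,
    [/\ 0 <= rho4 a1 a2 w t q x1 x2 x3 y, 0 <= rho5 a1 a2 w t q x1 x2 x3 y,
        0 <= rho6 a1 a2 w t q x1 x2 x3 y & 0 <= rho7 a1 a2 w t q x1 x2 x3 y]).
Hypothesis th_gt0 :
  [/\ 0 < th1, 0 < th2 & 0 < th3] /\ [/\ 0 < th4, 0 < th5, 0 < th6 & 0 < th7].

Hypothesis rho1_le1 : forall s2 w a1 a2 q x2 x3 y,
  \sum_s1 expect (mu1 a1 q) (fun x1 => rho1 s1 s2 w a1 a2 q x1 x2 x3 y) <= 1.
Hypothesis rho2_le1 : forall s1 w a1 a2 q x1 x3 y,
  \sum_s2 expect (mu2 a2 q) (fun x2 => rho2 s1 s2 w a1 a2 q x1 x2 x3 y) <= 1.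
Hypothesis rho3_le1 : forall w a1 a2 q x3 y,
  \sum_s1 \sum_s2 expect (mu1 a1 q) (fun x1 => expect (mu2 a2 q) (fun x2 =>
    rho3 s1 s2 w a1 a2 q x1 x2 x3 y)) <= 1.
Hypothesis rho4_le1 : forall a2 w t q x2 y,
  \sum_a1 expect (mu1 a1 q) (fun x1 => expect (mu3 a1 a2 q) (fun x3 =>
    rho4 a1 a2 w t q x1 x2 x3 y)) <= 1.
Hypothesis rho5_le1 : forall a1 w t q x1 y,
  \sum_a2 expect (mu2 a2 q) (fun x2 => expect (mu3 a1 a2 q) (fun x3 =>
    rho5 a1 a2 w t q x1 x2 x3 y)) <= 1.
Hypothesis rho6_le1 : forall w t q y,
  \sum_a1 \sum_a2 expect (mu1 a1 q) (fun x1 => expect (mu2 a2 q) (fun x2 =>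
    expect (mu3 a1 a2 q) (fun x3 => rho6 a1 a2 w t q x1 x2 x3 y))) <= 1.
Hypothesis rho7_le1 : forall w y,
  \sum_a1 \sum_a2 expect muQ (fun q => expect (mu1 a1 q) (fun x1 =>
    expect (mu2 a2 q) (fun x2 => expect (mu3 a1 a2 q) (fun x3 =>
      rho7 a1 a2 w (h1 a1) q x1 x2 x3 y)))) <= 1.

Let rho1_ge0 s1 s2 w a1 a2 q x1 x2 x3 y :
  0 <= rho1 s1 s2 w a1 a2 q x1 x2 x3 y.
Proof. by case: (rho_ge0.1 s1 s2 w a1 a2 q x1 x2 x3 y). Qed.

Let rho2_ge0 s1 s2 w a1 a2 q x1 x2 x3 y :
  0 <= rho2 s1 s2 w a1 a2 q x1 x2 x3 y.
Proof. by case: (rho_ge0.1 s1 s2 w a1 a2 q x1 x2 x3 y). Qed.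

Let rho3_ge0 s1 s2 w a1 a2 q x1 x2 x3 y :
  0 <= rho3 s1 s2 w a1 a2 q x1 x2 x3 y.
Proof. by case: (rho_ge0.1 s1 s2 w a1 a2 q x1 x2 x3 y). Qed.

Let rho4_ge0 a1 a2 w t q x1 x2 x3 y : 0 <= rho4 a1 a2 w t q x1 x2 x3 y.
Proof. by case: (rho_ge0.2 a1 a2 w t q x1 x2 x3 y). Qed.

Let rho5_ge0 a1 a2 w t q x1 x2 x3 y : 0 <= rho5 a1 a2 w t q x1 x2 x3 y.
Proof. by case: (rho_ge0.2 a1 a2 w t q x1 x2 x3 y). Qed.

Let rho6_ge0 a1 a2 w t q x1 x2 x3 y : 0 <= rho6 a1 a2 w t q x1 x2 x3 y.
Proof. by case: (rho_ge0.2 a1 a2 w t q x1 x2 x3 y). Qed.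

Let rho7_ge0 a1 a2 w t q x1 x2 x3 y : 0 <= rho7 a1 a2 w t q x1 x2 x3 y.
Proof. by case: (rho_ge0.2 a1 a2 w t q x1 x2 x3 y). Qed.

(** The keys of [C1] and [C2] are (new block, previous block, q word), but the laws [l1] and [l2]
    ignore the new block. Including the q word in the key lets the law depend on it while the
    codebooks remain independent of each other. *)
Let CQ : finType := {ffun T -> Q}.
Let C1 : finType := {ffun A1 * A1 * Q -> X1}.
Let C2 : finType := {ffun A2 * A2 * Q -> X2}.
Let C3 : finType := {ffun A1 * A2 * Q -> X3}.
Let lQ : CQ -> R := prod_law (fun _ : T => muQ).
Let l1 : C1 -> R := prod_law (fun k => mu1 k.1.2 k.2).
Let l2 : C2 -> R := prod_law (fun k => mu2 k.1.2 k.2).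
Let l3 : C3 -> R := prod_law (fun k => mu3 k.1.1 k.1.2 k.2).
Let lQp : is_pmf lQ. Proof. exact: prod_law_pmf. Qed.
Let l1p : is_pmf l1. Proof. exact: prod_law_pmf. Qed.
Let l2p : is_pmf l2. Proof. exact: prod_law_pmf. Qed.
Let l3p : is_pmf l3. Proof. exact: prod_law_pmf. Qed.

Let code_expect (F : CQ -> C1 -> C2 -> C3 -> R) : R :=
  expect lQ (fun cq => expect l1 (fun c1 => expect l2 (fun c2 =>
    expect l3 (fun c3 => F cq c1 c2 c3)))).

Let true_code_expect z z' (F : Q -> X1 -> X2 -> X3 -> R) :
  code_expect (fun cq c1 c2 c3 => let q := cq (h1 (f1 z)) in
    F q (c1 (f1 z', f1 z, q)) (c2 (f2 z', f2 z, q)) (c3 (f1 z, f2 z, q))) =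
  expect muQ (fun q => expect (mu1 (f1 z) q) (fun x1 =>
    expect (mu2 (f2 z) q) (fun x2 => expect (mu3 (f1 z) (f2 z) q) (F q x1 x2)))).
Proof.
rewrite -(expect_codeword (fun=> muQp) (h1 (f1 z))) /code_expect.
apply: eq_expect => cq; set q := cq _.
rewrite -(expect_codeword (fun k => mu1p k.1.2 k.2) (f1 z', f1 z, q)).
apply: eq_expect => c1.
rewrite -(expect_codeword (fun k => mu2p k.1.2 k.2) (f2 z', f2 z, q)).
apply: eq_expect => c2.
by rewrite -(expect_codeword (fun k => mu3p k.1.1 k.1.2 k.2) (f1 z, f2 z, q)).
Qed.

Let code_expect_le1 F :
  (forall cq, expect l1 (fun c1 => expect l2 (fun c2 =>
    expect l3 (fun c3 => F cq c1 c2 c3))) <= 1) -> code_expect F <= 1.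
Proof. by move=> F1; apply: expect_le => // cq _; exact: F1. Qed.

Let expect_triple (F : C1 * (C2 * C3) -> R) :
  expect (pair_law l1 (pair_law l2 l3)) F =
  expect l1 (fun c1 => expect l2 (fun c2 => expect l3 (fun c3 =>
    F (c1, (c2, c3))))).
Proof.
by rewrite expect_pair_law; apply: eq_expect => c1; rewrite expect_pair_law.
Qed.

(** With common parts in [unit] the fourth error class is empty, and a constant score 1 with
    threshold 1 always passes: three genuine tests remain. The q word is known since the relay knows
    the previous block [a]. *)
Let relay_dec_of (cq : CQ) (c1 : C1) (c2 : C2) (c3 : C3) (y : Y3) (w : V3) (a : A1 * A2) :=
  let q := cq (h1 a.1) in
  let g (rho : relay_score) s1 s2 := rho s1 s2 w a.1 a.2 q (c1 (s1, a.1, q))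
    (c2 (s2, a.2, q)) (c3 (a.1, a.2, q)) y in
  odflt a [pick s | passes_tests (fun=> tt) (fun=> tt) (g rho1) (g rho2) (g rho3)
    (fun _ _ => 1) th1 th2 th3 1 s].

(** Here [s] is the next block, already decoded, and the q word varies with the candidate. *)
Let dest_dec_of (cq : CQ) (c1 : C1) (c2 : C2) (c3 : C3) (y : Y) (w : V)
    (s : A1 * A2) :=
  let g (rho : dest_score) a1 a2 := let q := cq (h1 a1) in
    rho a1 a2 w (h1 a1) q (c1 (s.1, a1, q)) (c2 (s.2, a2, q)) (c3 (a1, a2, q)) y in
  odflt s [pick a | passes_tests h1 h2 (g rho4) (g rho5) (g rho6) (g rho7)
    th4 th5 th6 th7 a].

Section FixedSources.
Variables z z' : Z.

Let q_ (cq : CQ) := cq (h1 (f1 z)).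
Let out cq (c1 : C1) (c2 : C2) (c3 : C3) :=
  K (c1 (f1 z', f1 z, q_ cq)) (c2 (f2 z', f2 z, q_ cq)) (c3 (f1 z, f2 z, q_ cq)).

Let relay_term (rho : relay_score) cq (c1 : C1) (c2 : C2) (c3 : C3)
    (y : Y3) s1 s2 :=
  rho s1 s2 (f3 z') (f1 z) (f2 z) (q_ cq) (c1 (s1, f1 z, q_ cq))
    (c2 (s2, f2 z, q_ cq)) (c3 (f1 z, f2 z, q_ cq)) y.

Let dest_term (rho : dest_score) cq (c1 : C1) (c2 : C2) (c3 : C3)
    (y : Y) a1 a2 :=
  rho a1 a2 (f0 z) (h1 a1) (cq (h1 a1)) (c1 (f1 z', a1, cq (h1 a1)))
    (c2 (f2 z', a2, cq (h1 a1))) (c3 (a1, a2, cq (h1 a1))) y.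

Let outp cq c1 c2 c3 : is_pmf (out cq c1 c2 c3).
Proof. exact: Kp. Qed.

(** This and the next six bounds share one scheme: the codebooks in which the candidate and the
    truth use the same key are frozen, and only the others are averaged. Here [cq], [c2] and [c3]
    are frozen. *)
Let wrong1 (S : pred A1) : (forall s1, S s1 -> s1 != f1 z') ->
  code_expect (fun cq c1 c2 c3 => expect (out cq c1 c2 c3) (fun y =>
    \sum_(s1 | S s1) relay_term rho1 cq c1 c2 c3 (o3 y) s1 (f2 z'))) <= 1.
Proof.
move=> Sneq; apply: code_expect_le1 => cq.
rewrite expect_exchange; apply: expect_le => // c2 _.
rewrite expect_exchange; apply: expect_le => // c3 _.
pose x2 := c2 (f2 z', f2 z, q_ cq); pose x3 := c3 (f1 z, f2 z, q_ cq).
apply: (wrong_candidates_le1 (m := fun s1 y => expect (mu1 (f1 z) (q_ cq))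
  (fun x1 => rho1 s1 (f2 z') (f3 z') (f1 z) (f2 z) (q_ cq) x1 x2 x3 (o3 y))))
  => // [s1 y /Sneq s1N|y].
- have kN : (f1 z', f1 z, q_ cq) != (s1, f1 z, q_ cq).
    by rewrite !xpair_eqE eq_sym !negb_and s1N.
  exact: (expect_codewordM (fun k => mu1p k.1.2 k.2) (fun x => K x x2 x3 y)
    (fun x => rho1 s1 (f2 z') (f3 z') (f1 z) (f2 z) (q_ cq) x x2 x3 (o3 y)) kN).
- apply: le_trans (rho1_le1 (f2 z') (f3 z') (f1 z) (f2 z) (q_ cq) x2 x3 (o3 y)).
  by apply: ler_sum_subset => s1; apply: expect_ge0 => //= x1.
Qed.

Let wrong2 (S : pred A2) : (forall s2, S s2 -> s2 != f2 z') ->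
  code_expect (fun cq c1 c2 c3 => expect (out cq c1 c2 c3) (fun y =>
    \sum_(s2 | S s2) relay_term rho2 cq c1 c2 c3 (o3 y) (f1 z') s2)) <= 1.
Proof.
move=> Sneq; apply: code_expect_le1 => cq.
apply: expect_le => // c1 _.
rewrite expect_exchange; apply: expect_le => // c3 _.
pose x1 := c1 (f1 z', f1 z, q_ cq); pose x3 := c3 (f1 z, f2 z, q_ cq).
apply: (wrong_candidates_le1 (m := fun s2 y => expect (mu2 (f2 z) (q_ cq))
  (fun x2 => rho2 (f1 z') s2 (f3 z') (f1 z) (f2 z) (q_ cq) x1 x2 x3 (o3 y))))
  => // [s2 y /Sneq s2N|y].
- have kN : (f2 z', f2 z, q_ cq) != (s2, f2 z, q_ cq).
    by rewrite !xpair_eqE eq_sym !negb_and s2N.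
  exact: (expect_codewordM (fun k => mu2p k.1.2 k.2) (fun x => K x1 x x3 y)
    (fun x => rho2 (f1 z') s2 (f3 z') (f1 z) (f2 z) (q_ cq) x1 x x3 (o3 y)) kN).
- apply: le_trans (rho2_le1 (f1 z') (f3 z') (f1 z) (f2 z) (q_ cq) x1 x3 (o3 y)).
  by apply: ler_sum_subset => s2; apply: expect_ge0 => //= x2.
Qed.

Let wrong3 (S : pred (A1 * A2)) :
  (forall s, S s -> s.1 != f1 z' /\ s.2 != f2 z') ->
  code_expect (fun cq c1 c2 c3 => expect (out cq c1 c2 c3) (fun y =>
    \sum_(s | S s) relay_term rho3 cq c1 c2 c3 (o3 y) s.1 s.2)) <= 1.
Proof.
move=> Sneq; apply: code_expect_le1 => cq.
under eq_expect do rewrite expect_exchange.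
rewrite expect_exchange; apply: expect_le => // c3 _.
pose x3 := c3 (f1 z, f2 z, q_ cq); pose q := q_ cq.
rewrite -(expect_pair_law _ _ (fun c12 => expect (out cq c12.1 c12.2 c3) (fun y =>
  \sum_(s | S s) relay_term rho3 cq c12.1 c12.2 c3 (o3 y) s.1 s.2))).
apply: (wrong_candidates_le1 (m := fun s y =>
  expect (mu1 (f1 z) q) (fun x1 => expect (mu2 (f2 z) q) (fun x2 =>
    rho3 s.1 s.2 (f3 z') (f1 z) (f2 z) q x1 x2 x3 (o3 y)))))
  => // [|[s1 s2] y /Sneq[/= s1N s2N]|y].
- exact: pair_law_pmf.
- have k1N : (f1 z', f1 z, q) != (s1, f1 z, q).
    by rewrite !xpair_eqE eq_sym !negb_and s1N.
  have k2N : (f2 z', f2 z, q) != (s2, f2 z, q).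
    by rewrite !xpair_eqE eq_sym !negb_and s2N.
  rewrite !expect_pair_law /=.
  exact: (expect_codewordM2 (fun x1 x2 => K x1 x2 x3 y)
    (fun x1 x2 => rho3 s1 s2 (f3 z') (f1 z) (f2 z) (q_ cq) x1 x2 x3 (o3 y))
    (fun k => mu1p k.1.2 k.2) (fun k => mu2p k.1.2 k.2) k1N k2N).
- apply: le_trans (rho3_le1 (f3 z') (f1 z) (f2 z) (q_ cq) x3 (o3 y)).
  rewrite pair_bigA; apply: ler_sum_subset => s; apply: expect_ge0 => //= x1.
  by apply: expect_ge0.
Qed.

(** A wrong old block changes the keys of both [c1] and [c3], since the relay word also depends on
    it; the equal common parts keep q shared. *)
Let wrong4 (S : pred A1) :
  (forall a1, S a1 -> a1 != f1 z /\ h1 a1 = h1 (f1 z)) ->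
  code_expect (fun cq c1 c2 c3 => expect (out cq c1 c2 c3) (fun y =>
    \sum_(a1 | S a1) dest_term rho4 cq c1 c2 c3 (o0 y) a1 (f2 z))) <= 1.
Proof.
move=> Sneq; apply: code_expect_le1 => cq.
rewrite expect_exchange; apply: expect_le => // c2 _.
pose x2 := c2 (f2 z', f2 z, q_ cq); pose q := q_ cq; pose t := h1 (f1 z).
rewrite -(expect_pair_law _ _ (fun c13 => expect (out cq c13.1 c2 c13.2) (fun y =>
  \sum_(a1 | S a1) dest_term rho4 cq c13.1 c2 c13.2 (o0 y) a1 (f2 z)))).
apply: (wrong_candidates_le1 (m := fun a1 y =>
  expect (mu1 a1 q) (fun x1 => expect (mu3 a1 (f2 z) q) (fun x3 =>
    rho4 a1 (f2 z) (f0 z) t q x1 x2 x3 (o0 y)))))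
  => // [|a1 y /Sneq[a1N a1t]|y].
- exact: pair_law_pmf.
- have k1N : (f1 z', f1 z, q) != (f1 z', a1, q).
    by rewrite !xpair_eqE eq_sym !negb_and a1N orbT.
  have k3N : (f1 z, f2 z, q) != (a1, f2 z, q).
    by rewrite !xpair_eqE eq_sym !negb_and a1N.
  rewrite !expect_pair_law /dest_term a1t /=.
  exact: (expect_codewordM2 (fun x1 x3 => K x1 x2 x3 y)
    (fun x1 x3 => rho4 a1 (f2 z) (f0 z) t q x1 x2 x3 (o0 y))
    (fun k => mu1p k.1.2 k.2) (fun k => mu3p k.1.1 k.1.2 k.2) k1N k3N).
- apply: le_trans (rho4_le1 (f2 z) (f0 z) t q x2 (o0 y)).
  apply: ler_sum_subset => a1; apply: expect_ge0 => //= x1.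
  by apply: expect_ge0.
Qed.

Let wrong5 (S : pred A2) : p z != 0 ->
  (forall a2, S a2 -> a2 != f2 z /\ h2 a2 = h1 (f1 z)) ->
  code_expect (fun cq c1 c2 c3 => expect (out cq c1 c2 c3) (fun y =>
    \sum_(a2 | S a2) dest_term rho5 cq c1 c2 c3 (o0 y) (f1 z) a2)) <= 1.
Proof.
move=> pz Sneq; apply: code_expect_le1 => cq.
apply: expect_le => // c1 _.
pose x1 := c1 (f1 z', f1 z, q_ cq); pose q := q_ cq; pose t := h1 (f1 z).
rewrite -(expect_pair_law _ _ (fun c23 => expect (out cq c1 c23.1 c23.2) (fun y =>
  \sum_(a2 | S a2) dest_term rho5 cq c1 c23.1 c23.2 (o0 y) (f1 z) a2))).
apply: (wrong_candidates_le1 (m := fun a2 y =>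
  expect (mu2 a2 q) (fun x2 => expect (mu3 (f1 z) a2 q) (fun x3 =>
    rho5 (f1 z) a2 (f0 z) t q x1 x2 x3 (o0 y)))))
  => // [|a2 y /Sneq[a2N a2t]|y].
- exact: pair_law_pmf.
- have k2N : (f2 z', f2 z, q) != (f2 z', a2, q).
    by rewrite !xpair_eqE eq_sym !negb_and a2N orbT.
  have k3N : (f1 z, f2 z, q) != (f1 z, a2, q).
    by rewrite !xpair_eqE eq_sym !negb_and a2N orbT.
  rewrite !expect_pair_law /dest_term /=.
  exact: (expect_codewordM2 (fun x2 x3 => K x1 x2 x3 y)
    (fun x2 x3 => rho5 (f1 z) a2 (f0 z) t q x1 x2 x3 (o0 y))
    (fun k => mu2p k.1.2 k.2) (fun k => mu3p k.1.1 k.1.2 k.2) k2N k3N).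
- apply: le_trans (rho5_le1 (f1 z) (f0 z) t q x1 (o0 y)).
  apply: ler_sum_subset => a2; apply: expect_ge0 => //= x2.
  by apply: expect_ge0.
Qed.

Let wrong6 (S : pred (A1 * A2)) :
  (forall a, S a -> [/\ a.1 != f1 z, a.2 != f2 z & h1 a.1 = h1 (f1 z)]) ->
  code_expect (fun cq c1 c2 c3 => expect (out cq c1 c2 c3) (fun y =>
    \sum_(a | S a) dest_term rho6 cq c1 c2 c3 (o0 y) a.1 a.2)) <= 1.
Proof.
move=> Sneq; apply: code_expect_le1 => cq.
pose q := q_ cq; pose t := h1 (f1 z).
pose G (c : C1 * (C2 * C3)) := expect (out cq c.1 c.2.1 c.2.2) (fun y =>
  \sum_(a | S a) dest_term rho6 cq c.1 c.2.1 c.2.2 (o0 y) a.1 a.2).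
rewrite -(expect_triple G).
apply: (wrong_candidates_le1 (m := fun a y =>
  expect (mu1 a.1 q) (fun x1 => expect (mu2 a.2 q) (fun x2 =>
  expect (mu3 a.1 a.2 q) (fun x3 =>
    rho6 a.1 a.2 (f0 z) t q x1 x2 x3 (o0 y))))))
  => // [|[a1 a2] y /Sneq[/= a1N a2N a1t]|y].
- by do 2?apply: pair_law_pmf.
- have k1N : (f1 z', f1 z, q) != (f1 z', a1, q).
    by rewrite !xpair_eqE eq_sym !negb_and a1N orbT.
  have k2N : (f2 z', f2 z, q) != (f2 z', a2, q).
    by rewrite !xpair_eqE eq_sym !negb_and a2N orbT.
  have k3N : (f1 z, f2 z, q) != (a1, a2, q).
    by rewrite !xpair_eqE eq_sym !negb_and a1N.
  rewrite !expect_triple /dest_term a1t /=.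
  exact: (expect_codewordM3 (fun x1 x2 x3 => K x1 x2 x3 y)
    (fun x1 x2 x3 => rho6 a1 a2 (f0 z) t q x1 x2 x3 (o0 y))
    (fun k => mu1p k.1.2 k.2) (fun k => mu2p k.1.2 k.2)
    (fun k => mu3p k.1.1 k.1.2 k.2) k1N k2N k3N).
- apply: le_trans (rho6_le1 (f0 z) t q (o0 y)).
  rewrite pair_bigA; apply: ler_sum_subset => a; apply: expect_ge0 => //= x1.
  by do 2!apply: expect_ge0 => //= ?.
Qed.

(** With another common part nothing is shared, so q is redrawn as well. The other keys differ
    already in their source coordinates, hence independence survives a coincidence of the two q
    words. *)
Let wrong7 (S : pred (A1 * A2)) : p z != 0 ->
  (forall a, S a -> h1 a.1 != h1 (f1 z) /\ h2 a.2 = h1 a.1) ->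
  code_expect (fun cq c1 c2 c3 => expect (out cq c1 c2 c3) (fun y =>
    \sum_(a | S a) dest_term rho7 cq c1 c2 c3 (o0 y) a.1 a.2)) <= 1.
Proof.
move=> pz Sneq.
pose G (c : CQ * (C1 * (C2 * C3))) :=
  expect (out c.1 c.2.1 c.2.2.1 c.2.2.2) (fun y =>
  \sum_(a | S a) dest_term rho7 c.1 c.2.1 c.2.2.1 c.2.2.2 (o0 y) a.1 a.2).
have -> : code_expect (fun cq c1 c2 c3 => G (cq, (c1, (c2, c3)))) =
    expect (pair_law lQ (pair_law l1 (pair_law l2 l3))) G.
  by rewrite expect_pair_law; apply: eq_expect => cq; rewrite expect_triple.
apply: (wrong_candidates_le1 (m := fun a y => expect muQ (fun q =>
  expect (mu1 a.1 q) (fun x1 => expect (mu2 a.2 q) (fun x2 =>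
  expect (mu3 a.1 a.2 q) (fun x3 =>
    rho7 a.1 a.2 (f0 z) (h1 a.1) q x1 x2 x3 (o0 y)))))))
  => // [|[a1 a2] y /Sneq[/= a1N a2t]|y].
- by do 3?apply: pair_law_pmf.
- have a1N' : f1 z != a1 by apply: contraNneq a1N => ->.
  have a2N' : f2 z != a2.
    by apply: contraNneq a1N => e; rewrite -a2t -e -common.
  rewrite !expect_pair_law /=.
  pose F q := expect l1 (fun c1 => expect l2 (fun c2 => expect l3 (fun c3 =>
    K (c1 (f1 z', f1 z, q)) (c2 (f2 z', f2 z, q)) (c3 (f1 z, f2 z, q)) y))).
  pose H q := expect (mu1 a1 q) (fun x1 => expect (mu2 a2 q) (fun x2 =>
    expect (mu3 a1 a2 q) (fun x3 => rho7 a1 a2 (f0 z) (h1 a1) q x1 x2 x3 (o0 y)))).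
  transitivity (expect lQ (fun cq => F (cq (h1 (f1 z))) * H (cq (h1 a1)))).
    apply: eq_expect => cq; rewrite expect_triple.
    have k1N : (f1 z', f1 z, cq (h1 (f1 z))) != (f1 z', a1, cq (h1 a1)).
      by rewrite !xpair_eqE !negb_and a1N' orbT.
    have k2N : (f2 z', f2 z, cq (h1 (f1 z))) != (f2 z', a2, cq (h1 a1)).
      by rewrite !xpair_eqE !negb_and a2N' orbT.
    have k3N : (f1 z, f2 z, cq (h1 (f1 z))) != (a1, a2, cq (h1 a1)).
      by rewrite !xpair_eqE !negb_and a1N'.
    exact: (expect_codewordM3 (fun x1 x2 x3 => K x1 x2 x3 y)
      (fun x1 x2 x3 => rho7 a1 a2 (f0 z) (h1 a1) (cq (h1 a1)) x1 x2 x3 (o0 y))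
      (fun k => mu1p k.1.2 k.2) (fun k => mu2p k.1.2 k.2)
      (fun k => mu3p k.1.1 k.1.2 k.2) k1N k2N k3N).
  have tN : h1 (f1 z) != h1 a1 by rewrite eq_sym.
  rewrite (expect_codewordM (fun=> muQp) F H tN); congr (_ * _).
  by apply: eq_expect => cq; rewrite expect_triple.
- apply: le_trans (rho7_le1 (f0 z) (o0 y)).
  rewrite pair_bigA; apply: ler_sum_subset => a; apply: expect_ge0 => //= q.
  by do 3!apply: expect_ge0 => //= ?.
Qed.

Let avg (F : CQ -> C1 -> C2 -> C3 -> O -> R) : R :=
  code_expect (fun cq c1 c2 c3 => expect (out cq c1 c2 c3) (F cq c1 c2 c3)).

Let avgD F G : avg (fun cq c1 c2 c3 y => F cq c1 c2 c3 y + G cq c1 c2 c3 y) =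
  avg F + avg G.
Proof.
rewrite -expectD; apply: eq_expect => cq; rewrite -expectD; apply: eq_expect => c1.
rewrite -expectD; apply: eq_expect => c2; rewrite -expectD; apply: eq_expect => c3.
exact: expectD.
Qed.

Let avgZ c F : avg (fun cq c1 c2 c3 y => c * F cq c1 c2 c3 y) = c * avg F.
Proof.
rewrite -expectZl; apply: eq_expect => cq; rewrite -expectZl; apply: eq_expect => c1.
rewrite -expectZl; apply: eq_expect => c2; rewrite -expectZl; apply: eq_expect => c3.
exact: expectZl.
Qed.

Let ler_avg F G : (forall cq c1 c2 c3 y, F cq c1 c2 c3 y <= G cq c1 c2 c3 y) ->
  avg F <= avg G.
Proof. by move=> FG; do 5!apply: ler_expect => // ? _. Qed.

Let avg_true F : true_expect z F =
  avg (fun cq c1 c2 c3 => F (q_ cq) (c1 (f1 z', f1 z, q_ cq))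
    (c2 (f2 z', f2 z, q_ cq)) (c3 (f1 z, f2 z, q_ cq))).
Proof.
symmetry; exact: (true_code_expect z z' (fun q x1 x2 x3 =>
  expect (K x1 x2 x3) (F q x1 x2 x3))).
Qed.

Let avg0 : avg (fun _ _ _ _ _ => 0) = 0.
Proof.
rewrite -[RHS] (mul0r (avg (fun _ _ _ _ _ => 0))) -avgZ.
by congr avg; rewrite mul0r.
Qed.

Let avg_relay_err_le : avg (fun cq c1 c2 c3 y =>
    (relay_dec_of cq c1 c2 c3 (o3 y) (f3 z') (f1 z, f2 z) != (f1 z', f2 z'))%:R) <=
  true_expect z (fun q x1 x2 x3 y =>
    (rho1 (f1 z') (f2 z') (f3 z') (f1 z) (f2 z) q x1 x2 x3 (o3 y) < th1)%R%:R) +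
  true_expect z (fun q x1 x2 x3 y =>
    (rho2 (f1 z') (f2 z') (f3 z') (f1 z) (f2 z) q x1 x2 x3 (o3 y) < th2)%R%:R) +
  true_expect z (fun q x1 x2 x3 y =>
    (rho3 (f1 z') (f2 z') (f3 z') (f1 z) (f2 z) q x1 x2 x3 (o3 y) < th3)%R%:R) +
  (th1^-1 + th2^-1 + th3^-1).
Proof.
case: th_gt0 => -[t1 t2 t3] _.
apply: le_trans.
  apply: ler_avg => cq c1 c2 c3 y.
  by apply: threshold_decoder_error_le; rewrite ?ltr01.
have inv_le (th x : R) : 0 < th -> x <= 1 -> th^-1 * x <= th^-1.
  by move=> th0 x1; rewrite ler_piMr// invr_ge0 ltW.
rewrite !avgD !avgZ; apply: lerD; last first.
  rewrite -[leRHS]addr0; apply: lerD; first apply: lerD; first apply: lerD.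
  - by apply: inv_le => //; apply: wrong1 => s1 /andP[].
  - by apply: inv_le => //; apply: wrong2 => s2 /andP[].
  - by apply: inv_le => //; apply: wrong3 => s /and3P[].
  - by rewrite big_pred0 ?avg0 ?mulr0// => s; rewrite eqxx.
rewrite ltxx avg0 addr0; apply: lerD; first apply: lerD.
all: by rewrite le_eqVlt; apply/orP; left; apply/eqP/esym; apply: avg_true.
Qed.

Let avg_dest_err_le : p z != 0 -> avg (fun cq c1 c2 c3 y =>
    (dest_dec_of cq c1 c2 c3 (o0 y) (f0 z) (f1 z', f2 z') != (f1 z, f2 z))%:R) <=
  true_expect z (fun q x1 x2 x3 y =>
    (rho4 (f1 z) (f2 z) (f0 z) (h1 (f1 z)) q x1 x2 x3 (o0 y) < th4)%R%:R) +
  true_expect z (fun q x1 x2 x3 y =>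
    (rho5 (f1 z) (f2 z) (f0 z) (h1 (f1 z)) q x1 x2 x3 (o0 y) < th5)%R%:R) +
  true_expect z (fun q x1 x2 x3 y =>
    (rho6 (f1 z) (f2 z) (f0 z) (h1 (f1 z)) q x1 x2 x3 (o0 y) < th6)%R%:R) +
  true_expect z (fun q x1 x2 x3 y =>
    (rho7 (f1 z) (f2 z) (f0 z) (h1 (f1 z)) q x1 x2 x3 (o0 y) < th7)%R%:R) +
  (th4^-1 + th5^-1 + th6^-1 + th7^-1).
Proof.
move=> pz; case: th_gt0 => _ [t4 t5 t6 t7].
apply: le_trans.
  apply: ler_avg => cq c1 c2 c3 y.
  by apply: (threshold_decoder_error_le (h1 := h1) (h2 := h2)) => //; exact: common.
have inv_le (th x : R) : 0 < th -> x <= 1 -> th^-1 * x <= th^-1.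
  by move=> th0 x1; rewrite ler_piMr// invr_ge0 ltW.
rewrite !avgD !avgZ; apply: lerD; last first.
  apply: lerD; first apply: lerD; first apply: lerD.
  - by apply: inv_le => //; apply: wrong4 => a1 /andP[? /eqP].
  - by apply: inv_le => //; apply: wrong5 => // a2 /andP[? /eqP].
  - by apply: inv_le => //; apply: wrong6 => a /and4P[? ? /eqP].
  - by apply: inv_le => //; apply: wrong7 => // a /andP[? /eqP].
apply: lerD; first apply: lerD; first apply: lerD.
all: by rewrite le_eqVlt; apply/orP; left; apply/eqP/esym; apply: avg_true.
Qed.

Lemma avg_error_le : p z != 0 ->
  code_expect (fun cq c1 c2 c3 => expect (K (c1 (f1 z', f1 z, cq (h1 (f1 z))))
      (c2 (f2 z', f2 z, cq (h2 (f2 z)))) (c3 (f1 z, f2 z, cq (h1 (f1 z)))))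
    (fun y =>
    ((relay_dec_of cq c1 c2 c3 (o3 y) (f3 z') (f1 z, f2 z) != (f1 z', f2 z')) ||
     (dest_dec_of cq c1 c2 c3 (o0 y) (f0 z) (f1 z', f2 z') != (f1 z, f2 z)))%:R)) <=
  true_expect z (fun q x1 x2 x3 y =>
    (rho1 (f1 z') (f2 z') (f3 z') (f1 z) (f2 z) q x1 x2 x3 (o3 y) < th1)%R%:R) +
  true_expect z (fun q x1 x2 x3 y =>
    (rho2 (f1 z') (f2 z') (f3 z') (f1 z) (f2 z) q x1 x2 x3 (o3 y) < th2)%R%:R) +
  true_expect z (fun q x1 x2 x3 y =>
    (rho3 (f1 z') (f2 z') (f3 z') (f1 z) (f2 z) q x1 x2 x3 (o3 y) < th3)%R%:R) +
  true_expect z (fun q x1 x2 x3 y =>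
    (rho4 (f1 z) (f2 z) (f0 z) (h1 (f1 z)) q x1 x2 x3 (o0 y) < th4)%R%:R) +
  true_expect z (fun q x1 x2 x3 y =>
    (rho5 (f1 z) (f2 z) (f0 z) (h1 (f1 z)) q x1 x2 x3 (o0 y) < th5)%R%:R) +
  true_expect z (fun q x1 x2 x3 y =>
    (rho6 (f1 z) (f2 z) (f0 z) (h1 (f1 z)) q x1 x2 x3 (o0 y) < th6)%R%:R) +
  true_expect z (fun q x1 x2 x3 y =>
    (rho7 (f1 z) (f2 z) (f0 z) (h1 (f1 z)) q x1 x2 x3 (o0 y) < th7)%R%:R) +
  (th1^-1 + th2^-1 + th3^-1 + th4^-1 + th5^-1 + th6^-1 + th7^-1).
Proof.
(* Transmitter 2 computes the common part from its own source; on the support it is that of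
   transmitter 1. *)
move=> pz; rewrite -(common pz); apply: le_trans.
  apply: (@ler_avg _ (fun cq c1 c2 c3 y => _ + _)) => cq c1 c2 c3 y.
  by apply: ind_or_le.
rewrite avgD; have := avg_relay_err_le; have := avg_dest_err_le pz.
lra.
Qed.

End FixedSources.

(** The errors of both decoders stand under one average, so that a single choice of codebooks is
    good for both. *)
Theorem one_shot_code eps :
  relay_miss rho1 th1 + relay_miss rho2 th2 + relay_miss rho3 th3 +
  dest_miss rho4 th4 + dest_miss rho5 th5 + dest_miss rho6 th6 +
  dest_miss rho7 th7 +
  (th1^-1 + th2^-1 + th3^-1 + th4^-1 + th5^-1 + th6^-1 + th7^-1) < eps ->
  exists (e1 : A1 -> A1 -> X1) (e2 : A2 -> A2 -> X2) (e3 : A1 -> A2 -> X3)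
         (r : Y3 -> V3 -> A1 * A2 -> A1 * A2) (d : Y -> V -> A1 * A2 -> A1 * A2),
  expect p (fun z => expect p (fun z' =>
    expect (K (e1 (f1 z') (f1 z)) (e2 (f2 z') (f2 z)) (e3 (f1 z) (f2 z))) (fun y =>
    ((r (o3 y) (f3 z') (f1 z, f2 z) != (f1 z', f2 z')) ||
     (d (o0 y) (f0 z) (f1 z', f2 z') != (f1 z, f2 z)))%:R))) < eps.
Proof.
move=> miss.
have code_exchange F : code_expect (fun cq c1 c2 c3 =>
    expect p (fun z => F z cq c1 c2 c3)) = expect p (fun z => code_expect (F z)).
  rewrite /code_expect [RHS]expect_exchange; apply: eq_expect => cq.
  rewrite [RHS]expect_exchange; apply: eq_expect => c1.
  rewrite [RHS]expect_exchange; apply: eq_expect => c2.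
  by rewrite [RHS]expect_exchange.
have : code_expect (fun cq c1 c2 c3 => expect p (fun z => expect p (fun z' =>
    expect (K (c1 (f1 z', f1 z, cq (h1 (f1 z)))) (c2 (f2 z', f2 z, cq (h2 (f2 z))))
      (c3 (f1 z, f2 z, cq (h1 (f1 z))))) (fun y =>
    ((relay_dec_of cq c1 c2 c3 (o3 y) (f3 z') (f1 z, f2 z) != (f1 z', f2 z')) ||
     (dest_dec_of cq c1 c2 c3 (o0 y) (f0 z) (f1 z', f2 z') != (f1 z, f2 z)))%:R)))) < eps.
  apply: le_lt_trans miss; rewrite code_exchange.
  rewrite /relay_miss /dest_miss -!expectD.
  set c := (X in _ <= _ + X); rewrite -(expect_const c pp) -expectD.
  apply: ler_expect => // z pz; rewrite code_exchange.
  apply: le_trans (ler_expect pp (fun z' _ => avg_error_le z' pz)) _.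
  by rewrite !expectD !expect_const.
case/(expect_lt_ex lQp) => cq /(expect_lt_ex l1p)[c1] /(expect_lt_ex l2p)[c2].
case/(expect_lt_ex l3p) => c3 lt_eps.
(* Once [cq] is fixed, every q word is a function of the old block, and each transmitter finds its
   key from its own source. *)
exists (fun s a => c1 (s, a, cq (h1 a))), (fun s a => c2 (s, a, cq (h2 a))).
exists (fun a1 a2 => c3 (a1, a2, cq (h1 a1))).
by exists (relay_dec_of cq c1 c2 c3), (dest_dec_of cq c1 c2 c3).
Qed.
End OneShot.

(** * Conditional laws and information densities *)

Section InformationDensity.
Variables (R : realType) (Omega : finType) (P : Omega -> R).
Hypothesis Pp : is_pmf P.
Implicit Types A B C : finType.

(** As [x / 0 = 0], this vanishes when [b] has probability zero; hence the inequality in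
    [cprob_sum_le1]. *)
Definition cprob A B (X : Omega -> A) (Y : Omega -> B) (a : A) (b : B) : R :=
  law P [% X, Y] (a, b) / law P Y b.

(* p(x|y,z) / p(x|z); it equals p(y|x,z) / p(y|z) on the support *)
Definition info_ratio A B C (X : Omega -> A) (Y : Omega -> B) (Z : Omega -> C)
    (x : A) (y : B) (z : C) : R :=
  law P [% X, [% Y, Z]] (x, (y, z)) * law P Z z /
  (law P [% Y, Z] (y, z) * law P [% X, Z] (x, z)).

Lemma law_ge0 A (X : Omega -> A) a : 0 <= law P X a.
Proof. by apply: sumr_ge0 => o _; exact: pmf_ge0. Qed.

Lemma law_expect_ind A (X : Omega -> A) a :
  law P X a = expect P (fun o => (X o == a)%:R).
Proof. by rewrite /law big_mkcond; apply: eq_bigr => o _; rewrite mulr_natr mulrb. Qed.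

Lemma expect_law A (X : Omega -> A) (F : A -> R) :
  expect (law P X) F = expect P (F \o X).
Proof.
rewrite /expect /law; under eq_bigr do rewrite mulr_suml.
rewrite (exchange_big_dep xpredT)//=; apply: eq_bigr => o _.
by rewrite (big_pred1 (X o))// => a; rewrite /= eq_sym.
Qed.

Lemma law_gt0 A (X : Omega -> A) o : P o != 0 -> 0 < law P X (X o).
Proof.
move=> Po; rewrite /law (bigD1 o)//= ltr_pwDl//.
  by rewrite lt_def Po pmf_ge0.
by apply: sumr_ge0 => o' _; exact: pmf_ge0.
Qed.

Lemma law_pair_sum A B (X : Omega -> A) (Y : Omega -> B) b :
  \sum_a law P [% X, Y] (a, b) = law P Y b.
Proof.
rewrite /law (exchange_big_dep [pred o | Y o == b])/=.
  apply: eq_bigr => o /eqP Yo; rewrite (big_pred1 (X o))// => a.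
  by rewrite /= xpair_eqE Yo eqxx andbT eq_sym.
by move=> a o _; rewrite xpair_eqE => /andP[].
Qed.

Lemma cprob_ge0 A B (X : Omega -> A) (Y : Omega -> B) a b : 0 <= cprob X Y a b.
Proof. by rewrite divr_ge0// law_ge0. Qed.

Lemma cprob_gt0 A B (X : Omega -> A) (Y : Omega -> B) o : P o != 0 ->
  0 < cprob X Y (X o) (Y o).
Proof.
by move=> Po; rewrite divr_gt0//; [exact: (law_gt0 [% X, Y])|exact: law_gt0].
Qed.

Lemma cprob_sum_le1 A B (X : Omega -> A) (Y : Omega -> B) b :
  \sum_a cprob X Y a b <= 1.
Proof.
rewrite -mulr_suml law_pair_sum.
by have [->|/divff->//] := eqVneq (law P Y b) 0; rewrite mul0r.
Qed.

Lemma info_ratio_ge0 A B C (X : Omega -> A) (Y : Omega -> B) (Z : Omega -> C)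
  x y z : 0 <= info_ratio X Y Z x y z.
Proof. by rewrite divr_ge0// mulr_ge0// law_ge0. Qed.

Lemma info_ratio_gt0 A B C (X : Omega -> A) (Y : Omega -> B) (Z : Omega -> C) o :
  P o != 0 -> 0 < info_ratio X Y Z (X o) (Y o) (Z o).
Proof.
move=> Po; rewrite divr_gt0// mulr_gt0//.
- exact: (law_gt0 [% X, [% Y, Z]]).
- exact: law_gt0.
- exact: (law_gt0 [% Y, Z]).
- exact: (law_gt0 [% X, Z]).
Qed.

Lemma cond_entropyE A B (X : Omega -> A) (Y : Omega -> B) :
  `H[P](X | Y) = expect P (fun o => - ln (cprob X Y (X o) (Y o))).
Proof.
have := expect_law [% X, Y] (fun ab => - ln (cprob X Y ab.1 ab.2)).
rewrite /expect /= => <-; rewrite /cond_entropy pair_bigA /= -sumrN.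
by apply: eq_bigr => -[a b] _; rewrite mulrN.
Qed.

Lemma cond_mutual_infoE A B C (X : Omega -> A) (Y : Omega -> B) (Z : Omega -> C) :
  `I[P](X ; Y | Z) = expect P (fun o => ln (info_ratio X Y Z (X o) (Y o) (Z o))).
Proof.
rewrite /cond_mutual_info !cond_entropyE /expect -sumrB.
apply: eq_bigr => o _; rewrite -mulrBr.
have [->|Po] := eqVneq (P o) 0; first by rewrite !mul0r.
have xz := law_gt0 [% X, Z] Po; have yz := law_gt0 [% Y, Z] Po.
have xyz := law_gt0 [% X, [% Y, Z]] Po; have z := law_gt0 Z Po.
congr (_ * _); rewrite /cprob /info_ratio.
rewrite !ln_div ?posrE ?mulr_gt0// !lnM ?posrE// /pairRV /=.
ring.
Qed.

(** When [k] is the conditional law of X given z, multiplying it by the ratio leaves p(x|y,z). The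
    hypothesis is written without division so that it also makes sense for z of probability zero. *)
Lemma info_ratio_sum_le1 A B C (X : Omega -> A) (Y : Omega -> B) (Z : Omega -> C)
    (k : A -> R) y z :
  (forall x, law P [% X, Z] (x, z) = k x * law P Z z) -> 
  \sum_x k x * info_ratio X Y Z x y z <= 1.
Proof.
move=> kE; apply: le_trans (cprob_sum_le1 X [% Y, Z] (y, z)).
apply: ler_sum => x _; rewrite /info_ratio /cprob kE.
have [->|z0] := eqVneq (law P Z z) 0.
  by rewrite mulr0 mul0r mulr0 divr_ge0// law_ge0.
have [->|k0] := eqVneq (k x) 0; first by rewrite mul0r divr_ge0// law_ge0.
have [->|yz0] := eqVneq (law P [% Y, Z] (y, z)) 0.
  by rewrite mul0r invr0 !mulr0.
by rewrite le_eqVlt; apply/orP; left; apply/eqP; field; rewrite z0 k0 yz0.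
Qed.

End InformationDensity.

Section ExpectInd.
Variables (R : realType) (Omega A B : finType) (p : Omega -> R).
Variables (X : Omega -> A) (Y : Omega -> B).
Hypothesis pp : is_pmf p.

Lemma cprobM a b : cprob p X Y a b * law p Y b = law p [% X, Y] (a, b).
Proof.
have [Yb0|?] := eqVneq (law p Y b) 0; last by rewrite /cprob divfK.
rewrite Yb0 mulr0; apply/esym/eqP; rewrite eq_le law_ge0// andbT -Yb0.
rewrite -(law_pair_sum p X Y b) (bigD1 a)//= lerDl; apply: sumr_ge0 => a' _.
exact: law_ge0.
Qed.

Lemma expect_ind_cprob b (G : A -> R) :
  expect p (fun z => (Y z == b)%:R * G (X z)) =
  (\sum_a cprob p X Y a b * G a) * law p Y b.
Proof.
rewrite mulr_suml; under eq_bigr do rewrite mulrAC cprobM.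
transitivity (expect (law p [% X, Y]) (fun ab => (ab.2 == b)%:R * G ab.1)).
  by rewrite expect_law.
transitivity (\sum_a \sum_b' law p [% X, Y] (a, b') * ((b' == b)%:R * G a)).
  by rewrite pair_bigA; apply: eq_bigr => -[].
apply: eq_bigr => a _; rewrite (bigD1 b)//= eqxx mul1r big1 ?addr0// => b'.
by move=> /negbTE->; rewrite mul0r mulr0.
Qed.

(** For the destination: [j] is a candidate source letter, [c] its posterior given the side
    information, and [w j] the input law it induces. The ratio is normalised against the mixture of
    these laws. *)
Lemma mixture_sum_le1 (C D J : finType) (U : Omega -> C) (V : Omega -> D)
    (Z : Omega -> B) (c : J -> R) (w : J -> C -> R) v z :
  (forall x, law p [% U, Z] (x, z) = (\sum_j c j * w j x) * law p Z z) ->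
  \sum_j c j * expect (w j) (fun x => info_ratio p U V Z x v z) <= 1.
Proof.
move=> cE; apply: le_trans (info_ratio_sum_le1 pp V v cE).
under [leRHS]eq_bigr do rewrite mulr_suml.
rewrite exchange_big/=; apply: ler_sum => j _; rewrite mulr_sumr.
by apply: ler_sum => x _; rewrite mulrA.
Qed.

End ExpectInd.

(** * Normalisation of the seven letter scores under the single-letter law *)

Section SingleLetterLaws.
Variables (R : realType) (S1 S2 W3 W Q X1 X2 X3 Y3 Y T : finType).
Variables (pS : S1 * S2 * W3 * W -> R) (pQ : Q -> R) (pX1 : S1 -> Q -> X1 -> R)
  (pX2 : S2 -> Q -> X2 -> R) (pX3 : S1 -> S2 -> Q -> X3 -> R)
  (ch : X1 -> X2 -> X3 -> Y3 * Y -> R) (h1 : S1 -> T).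
Hypotheses (pSp : is_pmf pS) (pQp : is_pmf pQ)
  (pX1p : forall s q, is_pmf (pX1 s q)) (pX2p : forall s q, is_pmf (pX2 s q))
  (pX3p : forall s1 s2 q, is_pmf (pX3 s1 s2 q)) (chp : is_channel ch).
Let P := joint_pmf pS pQ pX1 pX2 pX3 ch.
Let L : finType := letters S1 S2 W3 W Q X1 X2 X3 Y3 Y.

Lemma expect_joint (F : L -> R) : expect P F =
  expect pS (fun z => expect pQ (fun q =>
  expect (pX1 (src_S1 z) q) (fun x1 => expect (pX2 (src_S2 z) q) (fun x2 =>
  expect (pX3 (src_S1 z) (src_S2 z) q) (fun x3 =>
  expect (ch x1 x2 x3) (fun y => F (z, q, x1, x2, x3, y))))))).
Proof.
rewrite /expect.
transitivity (\sum_z \sum_q \sum_x1 \sum_x2 \sum_x3 \sum_y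
   P (z, q, x1, x2, x3, y) * F (z, q, x1, x2, x3, y)).
  by rewrite !pair_bigA; apply: eq_bigr => -[[[[[? ?] ?] ?] ?] ?] _.
apply: eq_bigr => z _; rewrite mulr_sumr; apply: eq_bigr => q _.
rewrite !mulr_sumr; apply: eq_bigr => x1 _.
rewrite !mulr_sumr; apply: eq_bigr => x2 _.
rewrite !mulr_sumr; apply: eq_bigr => x3 _.
rewrite !mulr_sumr; apply: eq_bigr => y _.
by rewrite !mulrA.
Qed.

Lemma joint_pmf_pmf : is_pmf P.
Proof.
split=> [[[[[[z q] x1] x2] x3] y]|].
  by rewrite /P /= !mulr_ge0 ?pmf_ge0//; apply: (chp _ _ _).1.
have := expect_joint (fun=> 1); rewrite /expect.
under eq_bigr do rewrite mulr1.
move=> ->; rewrite -[LHS]/(expect pS _).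
apply: etrans (expect_const 1 pSp); apply: eq_expect => z.
apply: etrans (expect_const 1 pQp); apply: eq_expect => q.
apply: etrans (expect_const 1 (pX1p _ _)); apply: eq_expect => x1.
apply: etrans (expect_const 1 (pX2p _ _)); apply: eq_expect => x2.
apply: etrans (expect_const 1 (pX3p _ _ _)); apply: eq_expect => x3.
exact: (expect_const 1 (chp _ _ _)).
Qed.

(** The three input averages split because, given the source letter and q, the inputs are
    independent; the outputs do not occur in [U] and sum to one. *)
Lemma law_joint (A : finType) (U : L -> A) a az bq b1 b2 b3 :
  (forall z q x1 x2 x3 y, (U (z, q, x1, x2, x3, y) == a)%:R =
     az z * bq q * b1 x1 * b2 x2 * b3 x3) ->
  law P U a = expect pS (fun z => az z * expect pQ (fun q => bq q *
    (expect (pX1 (src_S1 z) q) b1 * expect (pX2 (src_S2 z) q) b2 *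
     expect (pX3 (src_S1 z) (src_S2 z) q) b3))).
Proof.
move=> UE; rewrite law_expect_ind expect_joint; apply: eq_expect => z.
rewrite -expectZl; apply: eq_expect => q.
set e1 := expect _ b1; set e2 := expect _ b2; set e3 := expect _ b3.
transitivity (expect (pX1 (src_S1 z) q) (fun x1 => az z * bq q * b1 x1 * (e2 * e3))).
  apply: eq_expect => x1.
  transitivity (expect (pX2 (src_S2 z) q)
    (fun x2 => az z * bq q * b1 x1 * b2 x2 * e3)).
    apply: eq_expect => x2; rewrite -expectZl; apply: eq_expect => x3.
    under eq_expect do rewrite UE.
    exact: expect_const.
  by rewrite expectZr expectZl -!mulrA.
by rewrite expectZr expectZl -!mulrA.
Qed.

Let rS1 : L -> S1 := rvS1.
Let rS2 : L -> S2 := rvS2.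
Let rW3 : L -> W3 := rvW3.
Let rW : L -> W := rvW.
Let rQ : L -> Q := rvQ.
Let rX1 : L -> X1 := rvX1.
Let rX2 : L -> X2 := rvX2.
Let rX3 : L -> X3 := rvX3.
Let rY3 : L -> Y3 := rvY3.
Let rY : L -> Y := rvY.

Lemma law_joint_src (A : finType) (U : L -> A) (u : S1 * S2 * W3 * W -> A) a :
  (forall z q x1 x2 x3 y, U (z, q, x1, x2, x3, y) = u z) ->
  law P U a = law pS u a.
Proof.
move=> UE; rewrite (@law_joint _ U a (fun z => (u z == a)%:R) (fun=> 1) (fun=> 1)
  (fun=> 1) (fun=> 1)) => [|z q x1 x2 x3 y]; last by rewrite UE !mulr1.
rewrite law_expect_ind; apply: eq_expect => z.
rewrite -[RHS] mulr1; congr (_ * _); apply: etrans (expect_const 1 pQp).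
by apply: eq_expect => q; rewrite !expect_const// !mulr1.
Qed.

Let expect_eq1 (V : finType) (w : V -> R) v : expect w (fun x => (x == v)%:R) = w v.
Proof.
by rewrite -[RHS] mulr1 -(expect_ind w (fun=> 1) v); apply: eq_expect => x; rewrite mulr1.
Qed.

(** Given (S1, Q), X1 is independent of (X2, X3), so [pX1 s1 q] is its conditional law given
    everything the ratio is conditioned on. *)
Lemma relay_ratio1_le1 s1 q x2 x3 y : expect (pX1 s1 q) (fun x1 =>
  info_ratio P rX1 rY3 [% rS1, rX2, rX3, rQ] x1 y (s1, x2, x3, q)) <= 1.
Proof.
apply: (info_ratio_sum_le1 joint_pmf_pmf) => x1.
rewrite (@law_joint _ _ _ (fun z => (src_S1 z == s1)%:R) (fun q' => (q' == q)%:R)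
  (fun x => (x == x1)%:R) (fun x => (x == x2)%:R) (fun x => (x == x3)%:R)); last first.
  by move=> *; rewrite !xpair_eqE -!mulnb !natrM /=; ring.
rewrite (@law_joint _ _ _ (fun z => (src_S1 z == s1)%:R) (fun q' => (q' == q)%:R)
  (fun x => 1) (fun x => (x == x2)%:R) (fun x => (x == x3)%:R)); last first.
  by move=> *; rewrite !xpair_eqE -!mulnb !natrM /=; ring.
rewrite -expectZl; apply: eq_expect => z; rewrite !expect_ind !expect_eq1.
rewrite (expect_const 1 (pX1p _ _)).
by have [->|_] := eqVneq (src_S1 z) s1; rewrite ?mul0r ?mulr0//=; ring.
Qed.

Lemma relay_ratio2_le1 s2 q x1 x3 y : expect (pX2 s2 q) (fun x2 =>
  info_ratio P rX2 rY3 [% rS2, rX1, rX3, rQ] x2 y (s2, x1, x3, q)) <= 1.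
Proof.
apply: (info_ratio_sum_le1 joint_pmf_pmf) => x2.
rewrite (@law_joint _ _ _ (fun z => (src_S2 z == s2)%:R) (fun q' => (q' == q)%:R)
  (fun x => (x == x1)%:R) (fun x => (x == x2)%:R) (fun x => (x == x3)%:R)); last first.
  by move=> *; rewrite !xpair_eqE -!mulnb !natrM /=; ring.
rewrite (@law_joint _ _ _ (fun z => (src_S2 z == s2)%:R) (fun q' => (q' == q)%:R)
  (fun x => (x == x1)%:R) (fun x => 1) (fun x => (x == x3)%:R)); last first.
  by move=> *; rewrite !xpair_eqE -!mulnb !natrM /=; ring.
rewrite -expectZl; apply: eq_expect => z; rewrite !expect_ind !expect_eq1.
rewrite (expect_const 1 (pX2p _ _)).
by have [->|_] := eqVneq (src_S2 z) s2; rewrite ?mul0r ?mulr0//=; ring.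
Qed.

Lemma relay_ratio3_le1 s1 s2 q x3 y : expect (pX1 s1 q) (fun x1 =>
  expect (pX2 s2 q) (fun x2 => info_ratio P [% rX1, rX2] rY3
    [% rS1, rS2, rX3, rQ] (x1, x2) y (s1, s2, x3, q))) <= 1.
Proof.
rewrite -(expect_pair_law _ _ (fun x => info_ratio P [% rX1, rX2] rY3
    [% rS1, rS2, rX3, rQ] x y (s1, s2, x3, q))).
apply: (info_ratio_sum_le1 joint_pmf_pmf) => -[x1 x2].
pose a (z : S1 * S2 * W3 * W) : R := (src_S1 z == s1)%:R * (src_S2 z == s2)%:R.
rewrite (@law_joint _ _ _ a (fun q' => (q' == q)%:R)
  (fun x => (x == x1)%:R) (fun x => (x == x2)%:R) (fun x => (x == x3)%:R)); last first.
  by move=> *; rewrite !xpair_eqE -!mulnb !natrM /=; rewrite /a; ring.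
rewrite (@law_joint _ _ _ a (fun q' => (q' == q)%:R)
  (fun x => 1) (fun x => 1) (fun x => (x == x3)%:R)); last first.
  by move=> *; rewrite !xpair_eqE -!mulnb !natrM /=; rewrite /a; ring.
rewrite -expectZl; apply: eq_expect => z; rewrite !expect_ind !expect_eq1.
rewrite (expect_const 1 (pX1p _ _)) (expect_const 1 (pX2p _ _)) /a /pair_law.
have [->|_] := eqVneq (src_S1 z) s1; last by rewrite !mul0r mulr0.
by have [->|_] := eqVneq (src_S2 z) s2; rewrite ?mul0r ?mulr0 ?mul0r//=; ring.
Qed.

(** Given S2 and W, S1 is independent of (X2, Q). The law of (X1, X3) given (s2, x2, w, q) is
    therefore the mixture over s1 with weights p(s1|s2,w). *)
Lemma dest_ratio4_le1 s2 w q x2 y :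
  \sum_s1 cprob pS src_S1 [% src_S2, src_W] s1 (s2, w) *
  expect (pX1 s1 q) (fun x1 => expect (pX3 s1 s2 q) (fun x3 =>
    info_ratio P [% rX1, rX3] rY [% rS2, rX2, rW, rQ] (x1, x3) y
      (s2, x2, w, q))) <= 1.
Proof.
pose ir x := info_ratio P [% rX1, rX3] rY [% rS2, rX2, rW, rQ] x y (s2, x2, w, q).
under eq_bigr do rewrite -(expect_pair_law _ _ ir).
apply: (mixture_sum_le1 joint_pmf_pmf) => -[x1 x3].
pose a (z : S1 * S2 * W3 * W) : R := (([% src_S2, src_W] z) == (s2, w))%:R.
rewrite (@law_joint _ _ _ a (fun q' => (q' == q)%:R)
  (fun x => (x == x1)%:R) (fun x => (x == x2)%:R) (fun x => (x == x3)%:R)); last first.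
  by move=> *; rewrite /a !xpair_eqE -!mulnb !natrM /=; ring.
rewrite (@law_joint _ _ _ a (fun q' => (q' == q)%:R)
  (fun x => 1) (fun x => (x == x2)%:R) (fun x => 1)); last first.
  by move=> *; rewrite /a !xpair_eqE -!mulnb !natrM /=; ring.
(* [c] collects the factors that depend on the conditioning values alone; the indicator [a] allows
   [src_S2 z] to be replaced by [s2] in them. *)
pose c := pQ q * pX2 s2 q x2.
transitivity (expect pS (fun z => a z * (c * (pX1 (src_S1 z) q x1 *
    pX3 (src_S1 z) s2 q x3)))).
  apply: eq_expect => z; rewrite !expect_ind !expect_eq1 /c /a.
  by have [[-> _]|_] := eqVneq (_ z) (s2, w); rewrite ?mul0r//; ring.
rewrite (expect_ind_cprob src_S1 [% src_S2, src_W] pSp _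
  (fun s1 => c * (pX1 s1 q x1 * pX3 s1 s2 q x3))).
transitivity ((\sum_s1 cprob pS src_S1 [% src_S2, src_W] s1 (s2, w) *
    pair_law (pX1 s1 q) (pX3 s1 s2 q) (x1, x3)) *
    (c * law pS [% src_S2, src_W] (s2, w))).
  rewrite mulrA; congr (_ * _); rewrite mulr_suml; apply: eq_bigr => s1 _.
  by rewrite /pair_law /=; ring.
congr (_ * _); rewrite law_expect_ind -expectZl; apply: eq_expect => z.
rewrite !expect_ind !expect_eq1 (expect_const 1 (pX1p _ _)).
rewrite (expect_const 1 (pX3p _ _ _)) /a /c.
by have [[-> _]|_] := eqVneq (_ z) (s2, w); rewrite ?mul0r ?mulr0//; ring.
Qed.

Lemma dest_ratio5_le1 s1 w q x1 y :
  \sum_s2 cprob pS src_S2 [% src_S1, src_W] s2 (s1, w) *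
  expect (pX2 s2 q) (fun x2 => expect (pX3 s1 s2 q) (fun x3 =>
    info_ratio P [% rX2, rX3] rY [% rS1, rX1, rW, rQ] (x2, x3) y
      (s1, x1, w, q))) <= 1.
Proof.
pose ir x := info_ratio P [% rX2, rX3] rY [% rS1, rX1, rW, rQ] x y (s1, x1, w, q).
under eq_bigr do rewrite -(expect_pair_law _ _ ir).
apply: (mixture_sum_le1 joint_pmf_pmf) => -[x2 x3].
pose a (z : S1 * S2 * W3 * W) : R := (([% src_S1, src_W] z) == (s1, w))%:R.
rewrite (@law_joint _ _ _ a (fun q' => (q' == q)%:R)
  (fun x => (x == x1)%:R) (fun x => (x == x2)%:R) (fun x => (x == x3)%:R)); last first.
  by move=> *; rewrite /a !xpair_eqE -!mulnb !natrM /=; ring.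
rewrite (@law_joint _ _ _ a (fun q' => (q' == q)%:R)
  (fun x => (x == x1)%:R) (fun x => 1) (fun x => 1)); last first.
  by move=> *; rewrite /a !xpair_eqE -!mulnb !natrM /=; ring.
pose c := pQ q * pX1 s1 q x1.
transitivity (expect pS (fun z => a z * (c * (pX2 (src_S2 z) q x2 *
    pX3 s1 (src_S2 z) q x3)))).
  apply: eq_expect => z; rewrite !expect_ind !expect_eq1 /c /a.
  by have [[-> _]|_] := eqVneq (_ z) (s1, w); rewrite ?mul0r//; ring.
rewrite (expect_ind_cprob src_S2 [% src_S1, src_W] pSp _
  (fun s2 => c * (pX2 s2 q x2 * pX3 s1 s2 q x3))).
transitivity ((\sum_s2 cprob pS src_S2 [% src_S1, src_W] s2 (s1, w) *
    pair_law (pX2 s2 q) (pX3 s1 s2 q) (x2, x3)) *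
    (c * law pS [% src_S1, src_W] (s1, w))).
  rewrite mulrA; congr (_ * _); rewrite mulr_suml; apply: eq_bigr => s2 _.
  by rewrite /pair_law /=; ring.
congr (_ * _); rewrite law_expect_ind -expectZl; apply: eq_expect => z.
rewrite !expect_ind !expect_eq1 (expect_const 1 (pX2p _ _)).
rewrite (expect_const 1 (pX3p _ _ _)) /a /c.
by have [[-> _]|_] := eqVneq (_ z) (s1, w); rewrite ?mul0r ?mulr0//; ring.
Qed.

Let pX123 (s1 : S1) (s2 : S2) (q : Q) : X1 * X2 * X3 -> R :=
  pair_law (pair_law (pX1 s1 q) (pX2 s2 q)) (pX3 s1 s2 q).

Let expect_pX123 s1 s2 q (F : X1 * X2 * X3 -> R) : expect (pX123 s1 s2 q) F =
  expect (pX1 s1 q) (fun x1 => expect (pX2 s2 q) (fun x2 =>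
    expect (pX3 s1 s2 q) (fun x3 => F (x1, x2, x3)))).
Proof. by rewrite /pX123 2!expect_pair_law. Qed.

Lemma dest_ratio6_le1 w t q y :
  \sum_s1 \sum_s2 cprob pS [% src_S1, src_S2] [% src_W, h1 \o src_S1]
    (s1, s2) (w, t) *
  expect (pX1 s1 q) (fun x1 => expect (pX2 s2 q) (fun x2 =>
    expect (pX3 s1 s2 q) (fun x3 => info_ratio P [% rX1, rX2, rX3] rY
      [% rW, h1 \o rS1, rQ] (x1, x2, x3) y (w, t, q)))) <= 1.
Proof.
pose ir x := info_ratio P [% rX1, rX2, rX3] rY [% rW, h1 \o rS1, rQ] x y (w, t, q).
pose T' : S1 * S2 * W3 * W -> T := h1 \o src_S1.
rewrite pair_bigA /=.
under eq_bigr do rewrite -(expect_pX123 _ _ _ ir) -surjective_pairing.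
apply: (mixture_sum_le1 joint_pmf_pmf) => -[[x1 x2] x3].
pose a (z : S1 * S2 * W3 * W) : R := (([% src_W, T'] z) == (w, t))%:R.
rewrite (@law_joint _ _ _ a (fun q' => (q' == q)%:R)
  (fun x => (x == x1)%:R) (fun x => (x == x2)%:R) (fun x => (x == x3)%:R)); last first.
  by move=> *; rewrite /a /T' !xpair_eqE -!mulnb !natrM /=; ring.
rewrite (@law_joint _ _ _ a (fun q' => (q' == q)%:R)
  (fun x => 1) (fun x => 1) (fun x => 1)); last first.
  by move=> *; rewrite /a /T' !xpair_eqE -!mulnb !natrM /=; ring.
transitivity (expect pS (fun z => a z * (pQ q * (pX1 (src_S1 z) q x1 *
    pX2 (src_S2 z) q x2 * pX3 (src_S1 z) (src_S2 z) q x3)))).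
  by apply: eq_expect => z; rewrite !expect_ind !expect_eq1.
rewrite (expect_ind_cprob [% src_S1, src_S2] [% src_W, T'] pSp _
  (fun s => pQ q * (pX1 s.1 q x1 * pX2 s.2 q x2 * pX3 s.1 s.2 q x3))).
transitivity ((\sum_s cprob pS [% src_S1, src_S2] [% src_W, T'] s (w, t) *
    pX123 s.1 s.2 q (x1, x2, x3)) * (pQ q * law pS [% src_W, T'] (w, t))).
  rewrite mulrA; congr (_ * _); rewrite mulr_suml; apply: eq_bigr => s _.
  by rewrite /pX123 /pair_law /=; ring.
congr (_ * _); rewrite law_expect_ind -expectZl; apply: eq_expect => z.
rewrite !expect_ind (expect_const 1 (pX1p _ _)) (expect_const 1 (pX2p _ _)).
by rewrite (expect_const 1 (pX3p _ _ _)) /a; ring.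
Qed.

(** As q is not conditioned on, the components of the mixture are the input laws [k] averaged over
    [pQ]. *)
Lemma dest_ratio7_le1 w y :
  \sum_s1 \sum_s2 cprob pS [% src_S1, src_S2] src_W (s1, s2) w *
  expect pQ (fun q => expect (pX1 s1 q) (fun x1 => expect (pX2 s2 q) (fun x2 =>
    expect (pX3 s1 s2 q) (fun x3 => info_ratio P [% rX1, rX2, rX3] rY rW
      (x1, x2, x3) y w)))) <= 1.
Proof.
pose ir x := info_ratio P [% rX1, rX2, rX3] rY rW x y w.
pose k (s : S1 * S2) x := expect pQ (fun q => pX123 s.1 s.2 q x).
rewrite pair_bigA /=.
have kE s : expect pQ (fun q => expect (pX1 s.1 q) (fun x1 =>
    expect (pX2 s.2 q) (fun x2 => expect (pX3 s.1 s.2 q) (fun x3 =>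
    ir (x1, x2, x3))))) = expect (k s) ir.
  under eq_expect do rewrite -(expect_pX123 _ _ _ ir).
  rewrite [RHS]/expect /k; under [RHS]eq_bigr do rewrite -expectZr.
  by rewrite -expect_sum.
under eq_bigr do rewrite kE -surjective_pairing.
apply: (mixture_sum_le1 joint_pmf_pmf) => -[[x1 x2] x3].
pose a (z : S1 * S2 * W3 * W) : R := (src_W z == w)%:R.
rewrite (@law_joint _ _ _ a (fun _ => 1)
  (fun x => (x == x1)%:R) (fun x => (x == x2)%:R) (fun x => (x == x3)%:R)); last first.
  by move=> *; rewrite /a !xpair_eqE -!mulnb !natrM /=; ring.
rewrite (law_joint_src (u := src_W))//.
transitivity (expect pS (fun z => a z * k ([% src_S1, src_S2] z) (x1, x2, x3))).
  apply: eq_expect => z; congr (_ * _); apply: eq_expect => q.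
  by rewrite !expect_eq1 mul1r.
exact: (expect_ind_cprob [% src_S1, src_S2] src_W pSp _ (k^~ (x1, x2, x3))).
Qed.

End SingleLetterLaws.

(** * Chernoff bound *)

Section LargeDeviations.
Variable R : realType.

Lemma expn_eventually_small (r eps : R) : 0 <= r -> r < 1 -> 0 < eps ->
  exists N, forall n, (N <= n)%N -> r ^+ n <= eps.
Proof.
move=> r0 r1 e0; have [->|rN0] := eqVneq r 0.
  by exists 1%N => -[//|n] _; rewrite expr0n/= ltW.
have rgt0 : 0 < r by rewrite lt_def rN0.
pose d := r^-1 - 1; have d0 : 0 < d by rewrite subr_gt0 invf_gt1.
(* Bernoulli's inequality for the powers of 1 + d, the inverse of r, cleared of denominators. *)
have bernoulli n : r ^+ n * (1 + d *+ n) <= 1.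
  elim: n => [|n IHn]; first by rewrite expr0 mulr0n addr0 mulr1.
  apply: le_trans IHn; rewrite exprSr -mulrA ler_wpM2l ?exprn_ge0//.
  have -> : r * (1 + d *+ n.+1) = r * (1 + d) + r * (d *+ n) by rewrite mulrS; ring.
  have -> : r * (1 + d) = 1 by rewrite /d addrC subrK divff.
  by rewrite lerD2l ler_piMl ?mulrn_wge0// ltW.
exists (Num.bound (d * eps)^-1) => n Nn.
have dn : eps^-1 <= 1 + d *+ n.
  rewrite -[leLHS]add0r lerD// -mulr_natr -ler_pdivrMl// -invfM.
  apply: ltW; apply: lt_le_trans (archi_boundP _) _; last by rewrite ler_nat.
  by rewrite invr_ge0 mulr_ge0 ?ltW.
have pos : 0 < 1 + d *+ n by apply: lt_le_trans dn; rewrite invr_gt0.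
rewrite -(ler_pM2r pos); apply: le_trans (bernoulli n) _.
by rewrite -ler_pdivrMl// mulr1.
Qed.

(* Chernoff's bound with [1 / (1 + rho g)] in the role of [exp (- rho g)]. *)
Lemma chernoff (A : finType) (P f : A -> R) c : is_pmf P -> c < expect P f ->
  exists G : A -> R, [/\ forall a, 0 <= G a, expect P G < 1 &
    forall (I : finType) (a : I -> A),
      \sum_i f (a i) <= c * #|I|%:R -> 1 <= \prod_i G (a i)].
Proof.
move=> Pp cf; pose g a := f a - c; pose mu := expect P g.
have mu0 : 0 < mu.
  by rewrite /mu /g expectD expect_const// subr_gt0.
pose M := 1 + \sum_a `|g a|.
have gM a : `|g a| <= M.
  rewrite /M (bigD1 a)//= addrCA lerDl; apply: addr_ge0; first exact: ler01.
  by apply: sumr_ge0 => b _; exact: normr_ge0.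
have M1 : 1 <= M by rewrite lerDl; apply: sumr_ge0 => b _; exact: normr_ge0.
have M0 : 0 < M by apply: lt_le_trans M1.
have muM : mu <= M.
  by apply: expect_le => // a _; apply: le_trans (gM a); apply: ler_norm.
(* Small enough that [rho * M] is at most 1/4 and that the quadratic error [2 * rho ^+ 2 * M ^+ 2]
   is half of the linear gain [rho * mu]. *)
pose rho := mu / (4 * M ^+ 2).
have rho0 : 0 < rho by rewrite divr_gt0// mulr_gt0// exprn_gt0.
have rhoM : rho * M <= 4^-1.
  rewrite /rho; have -> : mu / (4 * M ^+ 2) * M = 4^-1 * (mu / M).
    by field; rewrite gt_eqF.
  by rewrite ler_piMr ?invr_ge0 ?ler0n// ler_pdivrMr// mul1r.
have rhog a : `|rho * g a| <= 4^-1.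
  rewrite normrM gtr0_norm//; apply: le_trans rhoM.
  by rewrite ler_wpM2l// ltW.
have den a : 0 < 1 + rho * g a.
  by have := rhog a; rewrite ler_norml => /andP[+ _]; lra.
exists (fun a => (1 + rho * g a)^-1); split=> [a||I a].
- by rewrite invr_ge0 ltW.
- have Gle a : (1 + rho * g a)^-1 <= 1 - rho * g a + 2 * rho ^+ 2 * M ^+ 2.
    have gM2 : (rho * g a) ^+ 2 <= rho ^+ 2 * M ^+ 2.
      rewrite -exprMn -[X in X <= _]real_normK ?num_real//.
      apply: lerXn2r; rewrite ?nnegrE ?normr_ge0//.
        by rewrite mulr_ge0// ltW.
      by rewrite normrM gtr0_norm// ler_wpM2l// ltW.
    rewrite -[leLHS]mul1r ler_pdivrMr//; set u := rho * g a in gM2 *.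
    have := rhog a; rewrite -/u ler_norml => /andP[u1 u2].
    (* The product equals 1 + u^2 (1 + 2u), which is at least 1 because |u| is at most 1/4. *)
    apply: le_trans (_ : (1 - u + 2 * u ^+ 2) * (1 + u) <= _).
      have : 0 <= u ^+ 2 * (1 + 2 * u) by rewrite mulr_ge0 ?sqr_ge0//; lra.
      by lra.
    apply: ler_wpM2r; first exact/ltW/den.
    by rewrite -mulrA lerD2l ler_wpM2l.
  apply: le_lt_trans (ler_expect Pp (fun a _ => Gle a)) _.
  rewrite !expectD !expect_const//.
  have -> : expect P (fun a => - (rho * g a)) = - (rho * mu).
    by rewrite -mulNr -expectZl; apply: eq_expect => a; rewrite mulNr.
  have -> : 2 * rho ^+ 2 * M ^+ 2 = 2^-1 * (rho * mu).
    by rewrite /rho; field; rewrite gt_eqF.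
  have : 0 < rho * mu by rewrite mulr_gt0.
  by lra.
- move=> fc; rewrite prodfV invf_ge1 ?prodr_gt0//.
  apply: le_trans (_ : \prod_i expR (rho * g (a i)) <= 1).
    by apply: ler_prod => i _; rewrite ltW//= expR_ge1Dx.
  rewrite -expR_sum -mulr_sumr -expR0 ler_expR pmulr_rle0//.
  by rewrite sumrB sumr_const -mulr_natr subr_le0.
Qed.

Lemma prod_ln (I : finType) (x : I -> R) : (forall i, 0 < x i) ->
  \prod_i x i = expR (\sum_i ln (x i)).
Proof.
by move=> x0; rewrite expR_sum; apply: eq_bigr => i _; rewrite lnK ?posrE.
Qed.

(** [G] is fixed before the length of the word. Under an i.i.d. law the mean of the product is a
    power of a number below one, so the tail decays geometrically. *)
Lemma product_deviation (A : finType) (P al : A -> R) c : is_pmf P ->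
  (forall a, P a != 0 -> 0 < al a) -> c < expect P (fun a => ln (al a)) ->
  exists G : A -> R, [/\ forall a, 0 <= G a, expect P G < 1 &
    forall (I : finType) (a : I -> A), (forall i, P (a i) != 0) ->
      (\prod_i al (a i) < expR (c * #|I|%:R))%R%:R <= \prod_i G (a i)].
Proof.
move=> Pp al0 /(chernoff Pp)[G [G0 G1 GI]]; exists G; split=> // I a aP.
case: ltP => [lt_exp|_]; last by apply: prodr_ge0.
apply: GI; apply: ltW; rewrite -ltr_expR -prod_ln// => i.
exact: al0.
Qed.

End LargeDeviations.

(** * Letterwise laws on blocks *)

Section BlockSums.
Variables (R : realType) (I I' V U : finType) (iota : I -> I').
Hypothesis iota_inj : injective iota.
Variables (f : I' -> V -> U -> R) (g : I -> V -> U -> R).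
Hypotheses (f0 : forall i v u, 0 <= f i v u) (g0 : forall i v u, 0 <= g i v u).
Hypotheses (f1 : forall i, \sum_v \sum_u f i v u <= 1)
  (fg1 : forall i, \sum_v \sum_u f (iota i) v u * g i v u <= 1).

(** The sum factorises over the source positions [I']. A position in the image of [iota] carries one
    source and one channel factor and is bounded by [fg1]; any other carries a source factor only
    and is bounded by [f1]. *)
Lemma block_sum_le1 : \sum_(a : {ffun I' -> V}) \sum_(b : {ffun I' -> U})
  (\prod_i f i (a i) (b i)) * \prod_i g i (a (iota i)) (b (iota i)) <= 1.
Proof.
pose F i v u := f i v u * \prod_(j | iota j == i) g j v u.
have -> : \sum_(a : {ffun I' -> V}) \sum_(b : {ffun I' -> U})
    (\prod_i f i (a i) (b i)) * \prod_i g i (a (iota i)) (b (iota i)) =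
    \prod_i \sum_v \sum_u F i v u.
  rewrite bigA_distr_bigA; apply: eq_bigr => a _.
  rewrite bigA_distr_bigA; apply: eq_bigr => b _.
  by rewrite (prod_fiber iota (fun j i => g j (a i) (b i))) -big_split.
apply: (le_trans (y := \prod_(i : I') 1)); last by rewrite big1.
apply: ler_prod => i _; apply/andP; split.
  do 2 apply: sumr_ge0 => ? _; rewrite mulr_ge0//.
  by apply: prodr_ge0.
case: (pickP (fun j => iota j == i)) => [j /eqP<-|iN].
  rewrite /F; under eq_bigr => v _ do under eq_bigr => u _ do
    rewrite (prod_fiber_inj (fun j => g j v u) _ iota_inj).
  exact: fg1.
rewrite /F; under eq_bigr => v _ do under eq_bigr => u _ do
  rewrite big_pred0 ?mulr1//.
exact: f1.
Qed.

End BlockSums.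

Lemma block_sum1_le1 (R : realType) (I I' V : finType) (iota : I -> I')
    (f : I' -> V -> R) (g : I -> V -> R) : injective iota ->
  (forall i v, 0 <= f i v) -> (forall i v, 0 <= g i v) ->
  (forall i, \sum_v f i v <= 1) ->
  (forall i, \sum_v f (iota i) v * g i v <= 1) ->
  \sum_(a : {ffun I' -> V}) (\prod_i f i (a i)) * \prod_i g i (a (iota i)) <= 1.
Proof.
move=> iI f0 g0 f1 fg1.
have unit_sum (F : unit -> R) : \sum_u F u = F tt.
  by rewrite (big_pred1 tt)// => -[].
have := @block_sum_le1 R I I' V unit iota iI (fun i v _ => f i v)
  (fun i v _ => g i v) (fun i v _ => f0 i v) (fun i v _ => g0 i v).
have E1 i : \sum_v \sum_(u : unit) f i v <= 1.
  by under eq_bigr do rewrite unit_sum.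
have E2 i : \sum_v \sum_(u : unit) f (iota i) v * g i v <= 1.
  by under eq_bigr do rewrite unit_sum.
move=> /(_ E1 E2); under eq_bigr => a _.
  rewrite (big_pred1 [ffun=> tt]); first over.
  by move=> b /=; apply/esym/eqP/ffunP => j; case: (b j); rewrite ffunE.
by [].
Qed.

(* [eta] is chosen before [eps]: it fixes the number of blocks, on which the error
   allowed in each block then depends. *)
Definition block_regime (R : realType)
    (Phi : forall I I' : finType, (I -> I') -> R -> Prop) : Prop :=
  exists2 eta : R, 0 < eta & forall eps : R, 0 < eps -> exists L0 : nat,
    forall (I I' : finType) (iota : I -> I'), injective iota ->
      (L0 <= #|I|)%N -> #|I'|%:R <= (1 + eta) * #|I|%:R -> Phi I I' iota eps.

Lemma block_regime_and (R : realType)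
    (Phi Psi : forall I I' : finType, (I -> I') -> R -> Prop) :
  block_regime Phi -> block_regime Psi ->
  block_regime (fun I I' iota eps => Phi I I' iota eps /\ Psi I I' iota eps).
Proof.
move=> [eta eta0 H] [eta' eta'0 H']; exists (Num.min eta eta').
  by rewrite lt_min eta0.
move=> eps eps0; have [L HL] := H _ eps0; have [L' HL'] := H' _ eps0.
exists (maxn L L') => I I' iota iI; rewrite geq_max => /andP[LI L'I] I'le.
have widen e : Num.min eta eta' <= e -> #|I'|%:R <= (1 + e) * #|I|%:R.
  by move=> le_e; apply: le_trans I'le _; rewrite ler_wpM2r// lerD2l.
by split; [apply: HL|apply: HL'] => //; apply: widen; rewrite ge_min lexx ?orbT.
Qed.

(** * Tails of the source and channel scores of the true words *)

Section BlockTails.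
Variables (R : realType) (S1 S2 W3 W Q X1 X2 X3 Y3 Y : finType).
Variables (pS : S1 * S2 * W3 * W -> R) (pQ : Q -> R) (pX1 : S1 -> Q -> X1 -> R)
  (pX2 : S2 -> Q -> X2 -> R) (pX3 : S1 -> S2 -> Q -> X3 -> R)
  (ch : X1 -> X2 -> X3 -> Y3 * Y -> R).
Hypotheses (pSp : is_pmf pS) (pQp : is_pmf pQ)
  (pX1p : forall s q, is_pmf (pX1 s q)) (pX2p : forall s q, is_pmf (pX2 s q))
  (pX3p : forall s1 s2 q, is_pmf (pX3 s1 s2 q)) (chp : is_channel ch).
Let Z : finType := (S1 * S2 * W3 * W)%type.
Let P := joint_pmf pS pQ pX1 pX2 pX3 ch.

Definition map_word (A B : finType) (I : finType) (h : A -> B)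
  (a : {ffun I -> A}) : {ffun I -> B} := [ffun i => h (a i)].

Section Words.
Variables (I I' : finType) (iota : I -> I').
Hypothesis iota_inj : injective iota.

Definition src_word_law : {ffun I' -> Z} -> R := prod_law (fun=> pS).
Definition q_word_law : {ffun I -> Q} -> R := prod_law (fun=> pQ).
Definition x1_word_law (a : {ffun I' -> S1}) (q : {ffun I -> Q}) :
  {ffun I -> X1} -> R := prod_law (fun i => pX1 (a (iota i)) (q i)).
Definition x2_word_law (a : {ffun I' -> S2}) (q : {ffun I -> Q}) :
  {ffun I -> X2} -> R := prod_law (fun i => pX2 (a (iota i)) (q i)).
Definition x3_word_law (a1 : {ffun I' -> S1}) (a2 : {ffun I' -> S2})
    (q : {ffun I -> Q}) : {ffun I -> X3} -> R :=
  prod_law (fun i => pX3 (a1 (iota i)) (a2 (iota i)) (q i)).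
Definition word_channel (x1 : {ffun I -> X1}) (x2 : {ffun I -> X2})
    (x3 : {ffun I -> X3}) : {ffun I -> Y3 * Y} -> R :=
  prod_law (fun i => ch (x1 i) (x2 i) (x3 i)).

Definition word_expect := true_expect (map_word (I := I') (@src_S1 S1 S2 W3 W))
  (map_word (@src_S2 S1 S2 W3 W)) q_word_law x1_word_law x2_word_law
  x3_word_law word_channel.

Definition src_tail (al : Z -> R) (u : R) : R :=
  expect src_word_law (fun z => (\prod_i al (z i) < u)%R%:R).

Definition channel_tail (be : letters S1 S2 W3 W Q X1 X2 X3 Y3 Y -> R) (v : R) : R :=
  expect src_word_law (fun z => word_expect z (fun q x1 x2 x3 y =>
    (\prod_i be (z (iota i), q i, x1 i, x2 i, x3 i, y i) < v)%R%:R)).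

Lemma src_word_law_pmf : is_pmf src_word_law.
Proof. exact: prod_law_pmf. Qed.

Lemma q_word_law_pmf : is_pmf q_word_law.
Proof. exact: prod_law_pmf. Qed.

Lemma x1_word_law_pmf a q : is_pmf (x1_word_law a q).
Proof. by apply: prod_law_pmf. Qed.

Lemma x2_word_law_pmf a q : is_pmf (x2_word_law a q).
Proof. by apply: prod_law_pmf. Qed.

Lemma x3_word_law_pmf a1 a2 q : is_pmf (x3_word_law a1 a2 q).
Proof. by apply: prod_law_pmf. Qed.

Lemma word_channel_pmf x1 x2 x3 : is_pmf (word_channel x1 x2 x3).
Proof. by apply: prod_law_pmf => i; exact: chp. Qed.

Lemma word_expectDl c F z :
  word_expect z (fun q x1 x2 x3 y => c + F q x1 x2 x3 y) = c + word_expect z F.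
Proof.
rewrite -{2}(expect_const c q_word_law_pmf) -expectD; apply: eq_expect => q.
rewrite -{2}(expect_const c (x1_word_law_pmf (map_word src_S1 z) q)) -expectD; apply: eq_expect => x1.
rewrite -{2}(expect_const c (x2_word_law_pmf (map_word src_S2 z) q)) -expectD; apply: eq_expect => x2.
rewrite -{2}(expect_const c (x3_word_law_pmf (map_word src_S1 z)
  (map_word src_S2 z) q)) -expectD.
apply: eq_expect => x3; rewrite -{2}(expect_const c (word_channel_pmf x1 x2 x3)).
by rewrite -expectD.
Qed.

Lemma src_tail_le al G u :
  (forall z : I' -> Z, (forall i, pS (z i) != 0) ->
     (\prod_i al (z i) < u)%R%:R <= \prod_i G (z i)) ->
  src_tail al u <= expect pS G ^+ #|I'|.
Proof.
move=> alG; apply: le_trans (_ : expect src_word_law (fun z => \prod_i G (z i)) <= _).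
  apply: ler_expect; first exact: src_word_law_pmf.
  by move=> z zN0; apply: alG => i; apply: (prod_law_neq0 i zN0).
by rewrite (expect_prod_law _ (fun=> G)) prodr_const.
Qed.

(** At the channel positions the tuples of all letters are i.i.d. with law [P]. The proof peels the
    nested averages from q inwards to y, and [expect_marginal] then drops the source positions
    without channel letter. *)
Lemma expect_word_prod (G : letters S1 S2 W3 W Q X1 X2 X3 Y3 Y -> R) :
  expect src_word_law (fun z => word_expect z (fun q x1 x2 x3 y =>
    \prod_i G (z (iota i), q i, x1 i, x2 i, x3 i, y i))) = expect P G ^+ #|I|.
Proof.
pose m z := expect pQ (fun q => expect (pX1 (src_S1 z) q) (fun x1 =>
  expect (pX2 (src_S2 z) q) (fun x2 => expect (pX3 (src_S1 z) (src_S2 z) q)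
  (fun x3 => expect (ch x1 x2 x3) (fun y => G (z, q, x1, x2, x3, y)))))).
transitivity (expect src_word_law (fun z => \prod_i m (z (iota i)))).
  apply: eq_expect => z; rewrite /word_expect /true_expect.
  transitivity (expect q_word_law (fun q => \prod_i
    expect (pX1 (src_S1 (z (iota i))) (q i)) (fun x1 =>
    expect (pX2 (src_S2 (z (iota i))) (q i)) (fun x2 =>
    expect (pX3 (src_S1 (z (iota i))) (src_S2 (z (iota i))) (q i)) (fun x3 =>
    expect (ch x1 x2 x3) (fun y => G (z (iota i), q i, x1, x2, x3, y))))))).
  2: exact: (expect_prod_law _ (fun i q => expect (pX1 (src_S1 (z (iota i))) q)
    (fun x1 => expect (pX2 (src_S2 (z (iota i))) q) (fun x2 =>
     expect (pX3 (src_S1 (z (iota i))) (src_S2 (z (iota i))) q) (fun x3 =>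
     expect (ch x1 x2 x3) (fun y => G (z (iota i), q, x1, x2, x3, y))))))).
  apply: eq_expect => q.
  transitivity (expect (prod_law (fun i => pX1 (src_S1 (z (iota i))) (q i))) (fun x1 =>
    \prod_i expect (pX2 (src_S2 (z (iota i))) (q i)) (fun x2 =>
    expect (pX3 (src_S1 (z (iota i))) (src_S2 (z (iota i))) (q i)) (fun x3 =>
    expect (ch (x1 i) x2 x3) (fun y => G (z (iota i), q i, x1 i, x2, x3, y)))))).
  2: exact: (expect_prod_law _ (fun i x1 =>
     expect (pX2 (src_S2 (z (iota i))) (q i)) (fun x2 =>
     expect (pX3 (src_S1 (z (iota i))) (src_S2 (z (iota i))) (q i)) (fun x3 =>
     expect (ch x1 x2 x3) (fun y => G (z (iota i), q i, x1, x2, x3, y)))))).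
  apply: eq_expect2 => [x1|x1]; first by apply: eq_bigr => i _; rewrite ffunE.
  transitivity (expect (prod_law (fun i => pX2 (src_S2 (z (iota i))) (q i))) (fun x2 =>
    \prod_i 
    expect (pX3 (src_S1 (z (iota i))) (src_S2 (z (iota i))) (q i)) (fun x3 =>
    expect (ch (x1 i) (x2 i) x3) (fun y => G (z (iota i), q i, x1 i, x2 i, x3, y))))).
  2: exact: (expect_prod_law _ (fun i x2 =>
     expect (pX3 (src_S1 (z (iota i))) (src_S2 (z (iota i))) (q i)) (fun x3 =>
     expect (ch (x1 i) x2 x3) (fun y => G (z (iota i), q i, x1 i, x2, x3, y))))).
  apply: eq_expect2 => [x2|x2]; first by apply: eq_bigr => i _; rewrite ffunE.
  transitivity (expect (prod_law
    (fun i => pX3 (src_S1 (z (iota i))) (src_S2 (z (iota i))) (q i))) (fun x3 =>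
    \prod_i expect (ch (x1 i) (x2 i) (x3 i))
      (fun y => G (z (iota i), q i, x1 i, x2 i, x3 i, y)))).
  2: exact: (expect_prod_law _ (fun i x3 => expect (ch (x1 i) (x2 i) x3)
      (fun y => G (z (iota i), q i, x1 i, x2 i, x3, y)))).
  apply: eq_expect2 => [x3|x3]; first by apply: eq_bigr => i _; rewrite !ffunE.
  exact: (expect_prod_law _ (fun i y => G (z (iota i), q i, x1 i, x2 i, x3 i, y))).
transitivity (expect src_word_law (fun z => (fun g : {ffun I -> Z} =>
    \prod_i m (g i)) [ffun i => z (iota i)])).
  by apply: eq_expect => z; apply: eq_bigr => i _; rewrite ffunE.
rewrite (expect_marginal (fun g : {ffun I -> Z} => \prod_i m (g i)))//.
by rewrite (expect_prod_law _ (fun=> m)) /= prodr_const expect_joint.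
Qed.

Lemma channel_tail_le be G v :
  (forall o : I -> letters S1 S2 W3 W Q X1 X2 X3 Y3 Y, (forall i, P (o i) != 0) ->
     (\prod_i be (o i) < v)%R%:R <= \prod_i G (o i)) ->
  channel_tail be v <= expect P G ^+ #|I|.
Proof.
move=> beG; rewrite -expect_word_prod.
apply: ler_expect src_word_law_pmf _ => z zN0.
apply: ler_expect q_word_law_pmf _ => q qN0.
apply: ler_expect (x1_word_law_pmf _ _) _ => x1 x1N0.
apply: ler_expect (x2_word_law_pmf _ _) _ => x2 x2N0.
apply: ler_expect (x3_word_law_pmf _ _ _) _ => x3 x3N0.
apply: ler_expect (word_channel_pmf _ _ _) _ => y yN0.
apply: (beG (fun i => (z (iota i), q i, x1 i, x2 i, x3 i, y i))) => i.
have := prod_law_neq0 i x1N0; have := prod_law_neq0 i x2N0.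
have := prod_law_neq0 i x3N0; rewrite !ffunE => x3i x2i x1i.
have zi := prod_law_neq0 (iota i) zN0; have qi := prod_law_neq0 i qN0.
have yi := prod_law_neq0 i yN0.
by rewrite /P /= !mulf_neq0.
Qed.

End Words.
Lemma score_tails (al : Z -> R)
    (be : letters S1 S2 W3 W Q X1 X2 X3 Y3 Y -> R) :
  (forall z, pS z != 0 -> 0 < al z) -> (forall o, P o != 0 -> 0 < be o) ->
  expect pS (fun z => - ln (al z)) < expect P (fun o => ln (be o)) ->
  block_regime (fun I I' (iota : I -> I') eps => exists u v,
    [/\ 0 < u, 0 < v, src_tail I' al u <= eps, channel_tail iota be v <= eps &
        (u * v)^-1 <= eps]).
Proof.
move=> al0 be0; set H := expect pS _; set J := expect P _ => HJ.
(* The gap is spent in quarters: on the source deviation, on the channel deviation, on the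
   difference of lengths, and on the decay of the inverse threshold. *)
pose d := (J - H) / 4; have d0 : 0 < d by rewrite divr_gt0// subr_gt0.
have HE : expect pS (fun z => ln (al z)) = - H.
  rewrite /H -[RHS]mulN1r -expectZl; apply: eq_expect => z.
  by rewrite mulN1r opprK.
have Pp : is_pmf P by exact: joint_pmf_pmf.
have [|Gs [Gs0 Gs1 GsI]] := product_deviation (al := al) (c := - (H + d)) pSp al0.
  by rewrite HE; lra.
have [|Gc [Gc0 Gc1 GcI]] := product_deviation (al := be) (c := J - d) Pp be0.
  by rewrite -/J; lra.
(* The excess n' - n of source letters costs at most [|H + d| * eta * n], hence at most [d * n]; the
   1 keeps the denominator positive. *)
pose eta := d / (`|H + d| + 1).
have e0 : 0 < `|H + d| + 1 by rewrite ltr_wpDl.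
have eta0 : 0 < eta by rewrite divr_gt0.
exists eta => // eps eps0.
have [N1 N1P] := expn_eventually_small (expect_ge0 pSp Gs0) Gs1 eps0.
have [N2 N2P] := expn_eventually_small (expect_ge0 Pp Gc0) Gc1 eps0.
have rd1 : expR (- d) < 1 by rewrite -expR0 ltr_expR oppr_lt0.
have [N3 N3P] := expn_eventually_small (expR_ge0 (- d)) rd1 eps0.
exists (maxn N1 (maxn N2 N3)) => I I' iota iI; rewrite !geq_max.
case/and3P => NI1 NI2 NI3 I'I.
have II' : (#|I| <= #|I'|)%N by exact: leq_card iI.
(* The exponents use the two lengths separately, the source score running over [I'] and the channel
   score over [I]. *)
exists (expR (- (H + d) * #|I'|%:R)), (expR ((J - d) * #|I|%:R)).
split; rewrite ?expR_gt0//.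
- apply: le_trans (N1P #|I'| (leq_trans NI1 II')).
  by apply: src_tail_le => z zN0; exact: GsI.
- apply: le_trans (N2P #|I| NI2).
  by apply: channel_tail_le => // o oN0; exact: GcI.
- apply: le_trans (N3P #|I| NI3); rewrite -expRD -expRN -expRM_natl ler_expR.
  have : `|H + d| * eta <= d.
    rewrite /eta mulrCA ler_piMr ?(ltW d0)// ler_pdivrMr// mul1r.
    by rewrite lerDl.
  set n := #|I|%:R in I'I *; set n' := #|I'|%:R in I'I *.
  have nn' : n <= n' by rewrite ler_nat.
  have n0 : 0 <= n by rewrite ler0n.
  have Hn : (H + d) * (n' - n) <= `|H + d| * (eta * n).
    apply: le_trans (ler_norm _) _; rewrite normrM ler_wpM2l//.
    by rewrite ger0_norm ?subr_ge0//; lra.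
  move=> etad; have : `|H + d| * eta * n <= d * n by rewrite ler_wpM2r.
  have JHd : J = H + 4 * d by rewrite /d; field.
  by rewrite JHd -mulr_natl -/n; nra.
Qed.

End BlockTails.

Arguments src_word_law {R S1 S2 W3 W} pS {I'}.
Arguments q_word_law {R Q} pQ {I}.
Arguments word_channel {R X1 X2 X3 Y3 Y} ch {I}.

(** * Codes for one channel block from the single-letter inequalities *)

Section BlockCode.
Variables (R : realType) (S1 S2 W3 W Q X1 X2 X3 Y3 Y T : finType).
Variables (pS : S1 * S2 * W3 * W -> R) (pQ : Q -> R) (pX1 : S1 -> Q -> X1 -> R)
  (pX2 : S2 -> Q -> X2 -> R) (pX3 : S1 -> S2 -> Q -> X3 -> R)
  (ch : X1 -> X2 -> X3 -> Y3 * Y -> R) (h1 : S1 -> T) (h2 : S2 -> T).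
Hypotheses (pSp : is_pmf pS) (pQp : is_pmf pQ)
  (pX1p : forall s q, is_pmf (pX1 s q)) (pX2p : forall s q, is_pmf (pX2 s q))
  (pX3p : forall s1 s2 q, is_pmf (pX3 s1 s2 q)) (chp : is_channel ch).
Hypothesis common : common_function pS src_S1 src_S2 h1 h2.
Let P := joint_pmf pS pQ pX1 pX2 pX3 ch.
Let Z : finType := (S1 * S2 * W3 * W)%type.
Let L : finType := letters S1 S2 W3 W Q X1 X2 X3 Y3 Y.
Let rS1 : L -> S1 := rvS1.
Let rS2 : L -> S2 := rvS2.
Let rW3 : L -> W3 := rvW3.
Let rW : L -> W := rvW.
Let rQ : L -> Q := rvQ.
Let rX1 : L -> X1 := rvX1.
Let rX2 : L -> X2 := rvX2.
Let rX3 : L -> X3 := rvX3.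
Let rY3 : L -> Y3 := rvY3.
Let rY : L -> Y := rvY.

(** The relay knows [z] and looks for [z'], the destination knows [z'] and looks for [z]. Each
    decoder is judged with correct prior knowledge; error propagation is treated with the whole
    code. *)
Definition block_code_spec (I I' : finType) (iota : I -> I') (eps : R) : Prop :=
  exists (e1 : {ffun I' -> S1} -> {ffun I' -> S1} -> {ffun I -> X1})
         (e2 : {ffun I' -> S2} -> {ffun I' -> S2} -> {ffun I -> X2})
         (e3 : {ffun I' -> S1} -> {ffun I' -> S2} -> {ffun I -> X3})
         (r : {ffun I -> Y3} -> {ffun I' -> W3} ->
              {ffun I' -> S1} * {ffun I' -> S2} -> {ffun I' -> S1} * {ffun I' -> S2})
         (d : {ffun I -> Y} -> {ffun I' -> W} ->
              {ffun I' -> S1} * {ffun I' -> S2} -> {ffun I' -> S1} * {ffun I' -> S2}),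
  expect (src_word_law pS) (fun z => expect (src_word_law pS) (fun z' =>
    let s1 := map_word src_S1 z in let s2 := map_word src_S2 z in
    let s1' := map_word src_S1 z' in let s2' := map_word src_S2 z' in
    expect (word_channel ch (e1 s1' s1) (e2 s2' s2) (e3 s1 s2)) (fun y =>
      ((r (map_word fst y) (map_word src_W3 z') (s1, s2) != (s1', s2')) ||
       (d (map_word snd y) (map_word src_W z) (s1', s2') != (s1, s2)))%:R))) < eps.

Section Scores.
Variables (I I' : finType) (iota : I -> I').
Hypothesis iota_inj : injective iota.

Definition relay_word_score (al : S1 -> S2 -> W3 -> R)
    (be : S1 -> S2 -> Q -> X1 -> X2 -> X3 -> Y3 -> R) :
  relay_score R {ffun I' -> S1} {ffun I' -> S2} {ffun I' -> W3} {ffun I -> Q}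
    {ffun I -> X1} {ffun I -> X2} {ffun I -> X3} {ffun I -> Y3} :=
  fun s1 s2 w a1 a2 q x1 x2 x3 y =>
    (\prod_i al (s1 i) (s2 i) (w i)) *
    \prod_i be (a1 (iota i)) (a2 (iota i)) (q i) (x1 i) (x2 i) (x3 i) (y i).

Definition dest_word_score (al : S1 -> S2 -> W -> T -> R)
    (be : S1 -> S2 -> W -> T -> Q -> X1 -> X2 -> X3 -> Y -> R) :
  dest_score R {ffun I' -> S1} {ffun I' -> S2} {ffun I' -> W} {ffun I' -> T}
    {ffun I -> Q} {ffun I -> X1} {ffun I -> X2} {ffun I -> X3} {ffun I -> Y} :=
  fun a1 a2 w t q x1 x2 x3 y =>
    (\prod_i al (a1 i) (a2 i) (w i) (t i)) *
    \prod_i be (a1 (iota i)) (a2 (iota i)) (w (iota i)) (t (iota i)) (q i)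
      (x1 i) (x2 i) (x3 i) (y i).

Let ind_lt_mul (x y u v : R) : 0 <= x -> 0 <= y -> 0 < u -> 0 < v ->
  (x * y < u * v)%R%:R <= (x < u)%R%:R + (y < v)%R%:R :> R.
Proof.
move=> x0 y0 u0 v0; rewrite -natrD ler_nat.
have [ux|xu] := leP u x; last by case: (_ < _).
have [vy|yv] := leP v y; last by case: (_ < _).
by rewrite ltNge ler_pM// ltW.
Qed.

Let sw := @src_word_law R S1 S2 W3 W pS I'.
Let relay_miss_ := relay_miss sw (map_word src_S1) (map_word src_S2)
  (map_word src_W3) (q_word_law pQ) (x1_word_law pX1 iota)
  (x2_word_law pX2 iota) (x3_word_law pX3 iota) (word_channel ch) (map_word fst).
Let dest_miss_ := dest_miss sw (map_word src_S1) (map_word src_S2)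
  (map_word src_W) (map_word h1) (q_word_law pQ) (x1_word_law pX1 iota)
  (x2_word_law pX2 iota) (x3_word_law pX3 iota) (word_channel ch) (map_word snd).

(** If a product falls below [u * v], one factor falls below its own threshold. The source factor
    depends on the new block and the channel factor on the previous one, so the two tails are
    averaged over different blocks. *)
Lemma relay_word_miss_le al be u v :
  (forall s1 s2 w, 0 <= al s1 s2 w) ->
  (forall a1 a2 q x1 x2 x3 y, 0 <= be a1 a2 q x1 x2 x3 y) -> 0 < u -> 0 < v ->
  relay_miss_ (relay_word_score al be) (u * v) <=
  src_tail pS I' (fun z => al (src_S1 z) (src_S2 z) (src_W3 z)) u +
  channel_tail pS pQ pX1 pX2 pX3 ch iota (fun o => be (rS1 o) (rS2 o) (rQ o)
    (rX1 o) (rX2 o) (rX3 o) (rY3 o)) v.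
Proof.
move=> al0 be0 u0 v0.
have sp : is_pmf sw by exact: src_word_law_pmf.
pose S (z : {ffun I' -> Z}) : R :=
  (\prod_i al (src_S1 (z i)) (src_S2 (z i)) (src_W3 (z i)) < u)%R%:R.
pose C (z : {ffun I' -> Z}) (q : {ffun I -> Q}) (x1 : {ffun I -> X1}) (x2 : {ffun I -> X2})
    (x3 : {ffun I -> X3}) (y : {ffun I -> Y3 * Y}) : R :=
  (\prod_i be (src_S1 (z (iota i))) (src_S2 (z (iota i))) (q i) (x1 i) (x2 i)
     (x3 i) (y i).1 < v)%R%:R.
have step : relay_miss_ (relay_word_score al be) (u * v) <=
    expect sw (fun z => expect sw (fun z' =>
      word_expect pQ pX1 pX2 pX3 ch iota z (fun q x1 x2 x3 y =>
        S z' + C z q x1 x2 x3 y))).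
  apply: ler_expect => // z _; apply: ler_expect => // z' _.
  apply: ler_expect; first exact: q_word_law_pmf.
  move=> q _; apply: ler_expect; first exact: x1_word_law_pmf.
  move=> x1 _; apply: ler_expect; first exact: x2_word_law_pmf.
  move=> x2 _; apply: ler_expect; first exact: x3_word_law_pmf.
  move=> x3 _; apply: ler_expect; first exact: word_channel_pmf.
  move=> y _; apply: le_trans (ind_lt_mul _ _ u0 v0) _.
  - exact: prodr_ge0.
  - exact: prodr_ge0.
  - rewrite le_eqVlt; apply/orP; left; apply/eqP; congr (_ + _).
    + by congr ((_ < _)%R%:R); apply: eq_bigr => i _; rewrite !ffunE.
    + by congr ((_ < _)%R%:R); apply: eq_bigr => i _; rewrite !ffunE.
apply: le_trans step _.
under eq_expect => z do under eq_expect => z' do rewrite word_expectDl//.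
under eq_expect => z do rewrite expectD expect_const//.
by rewrite expectD expect_const.
Qed.

Lemma dest_word_miss_le al be u v :
  (forall a1 a2 w t, 0 <= al a1 a2 w t) ->
  (forall a1 a2 w t q x1 x2 x3 y, 0 <= be a1 a2 w t q x1 x2 x3 y) ->
  0 < u -> 0 < v ->
  dest_miss_ (dest_word_score al be) (u * v) <=
  src_tail pS I' (fun z => al (src_S1 z) (src_S2 z) (src_W z) (h1 (src_S1 z))) u +
  channel_tail pS pQ pX1 pX2 pX3 ch iota (fun o => be (rS1 o) (rS2 o) (rW o)
    (h1 (rS1 o)) (rQ o) (rX1 o) (rX2 o) (rX3 o) (rY o)) v.
Proof.
move=> al0 be0 u0 v0.
have sp : is_pmf sw by exact: src_word_law_pmf.
pose S (z : {ffun I' -> Z}) : R :=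
  (\prod_i al (src_S1 (z i)) (src_S2 (z i)) (src_W (z i)) (h1 (src_S1 (z i)))
    < u)%R%:R.
pose C (z : {ffun I' -> Z}) (q : {ffun I -> Q}) (x1 : {ffun I -> X1})
    (x2 : {ffun I -> X2}) (x3 : {ffun I -> X3}) (y : {ffun I -> Y3 * Y}) : R :=
  (\prod_i be (src_S1 (z (iota i))) (src_S2 (z (iota i))) (src_W (z (iota i)))
     (h1 (src_S1 (z (iota i)))) (q i) (x1 i) (x2 i) (x3 i) (y i).2 < v)%R%:R.
have step : dest_miss_ (dest_word_score al be) (u * v) <=
    expect sw (fun z => word_expect pQ pX1 pX2 pX3 ch iota z
      (fun q x1 x2 x3 y => S z + C z q x1 x2 x3 y)).
  apply: ler_expect => // z _.
  apply: ler_expect; first exact: q_word_law_pmf.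
  move=> q _; apply: ler_expect; first exact: x1_word_law_pmf.
  move=> x1 _; apply: ler_expect; first exact: x2_word_law_pmf.
  move=> x2 _; apply: ler_expect; first exact: x3_word_law_pmf.
  move=> x3 _; apply: ler_expect; first exact: word_channel_pmf.
  move=> y _; apply: le_trans (ind_lt_mul _ _ u0 v0) _.
  - exact: prodr_ge0.
  - exact: prodr_ge0.
  - rewrite le_eqVlt; apply/orP; left; apply/eqP; congr (_ + _).
    + by congr ((_ < _)%R%:R); apply: eq_bigr => i _; rewrite !ffunE.
    + by congr ((_ < _)%R%:R); apply: eq_bigr => i _; rewrite !ffunE.
apply: le_trans step _.
under eq_expect => z do rewrite word_expectDl//.
by rewrite expectD.
Qed.

Let sum_prod_le1 (V : finType) (f : I' -> V -> R) : (forall i v, 0 <= f i v) ->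
  (forall i, \sum_v f i v <= 1) ->
  \sum_(a : {ffun I' -> V}) \prod_i f i (a i) <= 1.
Proof.
move=> f0 f1; rewrite -bigA_distr_bigA prodr_ile1// => i _.
by rewrite f1 sumr_ge0.
Qed.

Let expect_prod_le1 (V : finType) (mu : I -> V -> R) (f : I -> V -> R) :
  (forall i, is_pmf (mu i)) -> (forall i v, 0 <= f i v) ->
  (forall i, expect (mu i) (f i) <= 1) ->
  expect (prod_law mu) (fun a => \prod_i f i (a i)) <= 1.
Proof.
move=> mup f0 f1; rewrite expect_prod_law prodr_ile1// => i _.
by rewrite f1 expect_ge0.
Qed.

(** The sum over the new block concerns the source factor alone and the average over the codeword
    the channel factor alone, so each is bounded separately. *)
Lemma relay_word_score1_le1 al be :
  (forall s1 s2 w, 0 <= al s1 s2 w) ->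
  (forall a1 a2 q x1 x2 x3 y, 0 <= be a1 a2 q x1 x2 x3 y) ->
  (forall s2 w, \sum_s1 al s1 s2 w <= 1) ->
  (forall a1 a2 q x2 x3 y,
     expect (pX1 a1 q) (fun x1 => be a1 a2 q x1 x2 x3 y) <= 1) ->
  forall s2 w a1 a2 q x2 x3 y, \sum_s1 expect (x1_word_law pX1 iota a1 q)
    (fun x1 => relay_word_score al be s1 s2 w a1 a2 q x1 x2 x3 y) <= 1.
Proof.
move=> al0 be0 al1 be1 s2 w a1 a2 q x2 x3 y.
under eq_bigr do rewrite expectZl; rewrite -mulr_suml mulr_ile1//.
- by apply: sumr_ge0 => s1 _; apply: prodr_ge0.
- apply: expect_ge0 => [|x1]; first exact: x1_word_law_pmf.
  by apply: prodr_ge0.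
- exact: (sum_prod_le1 (f := fun i s1 => al s1 (s2 i) (w i))).
- exact: (expect_prod_le1 (f := fun i x1 => be (a1 (iota i)) (a2 (iota i)) (q i)
    x1 (x2 i) (x3 i) (y i))).
Qed.

Lemma relay_word_score2_le1 al be :
  (forall s1 s2 w, 0 <= al s1 s2 w) ->
  (forall a1 a2 q x1 x2 x3 y, 0 <= be a1 a2 q x1 x2 x3 y) ->
  (forall s1 w, \sum_s2 al s1 s2 w <= 1) ->
  (forall a1 a2 q x1 x3 y,
     expect (pX2 a2 q) (fun x2 => be a1 a2 q x1 x2 x3 y) <= 1) ->
  forall s1 w a1 a2 q x1 x3 y, \sum_s2 expect (x2_word_law pX2 iota a2 q)
    (fun x2 => relay_word_score al be s1 s2 w a1 a2 q x1 x2 x3 y) <= 1.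
Proof.
move=> al0 be0 al1 be1 s1 w a1 a2 q x1 x3 y.
under eq_bigr do rewrite expectZl; rewrite -mulr_suml mulr_ile1//.
- by apply: sumr_ge0 => s2 _; apply: prodr_ge0.
- apply: expect_ge0 => [|x2]; first exact: x2_word_law_pmf.
  by apply: prodr_ge0.
- exact: (sum_prod_le1 (f := fun i s2 => al (s1 i) s2 (w i))).
- exact: (expect_prod_le1 (f := fun i x2 => be (a1 (iota i)) (a2 (iota i)) (q i)
    (x1 i) x2 (x3 i) (y i))).
Qed.

Lemma relay_word_score3_le1 al be :
  (forall s1 s2 w, 0 <= al s1 s2 w) ->
  (forall a1 a2 q x1 x2 x3 y, 0 <= be a1 a2 q x1 x2 x3 y) ->
  (forall w, \sum_s1 \sum_s2 al s1 s2 w <= 1) ->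
  (forall a1 a2 q x3 y, expect (pX1 a1 q) (fun x1 => expect (pX2 a2 q) (fun x2 =>
     be a1 a2 q x1 x2 x3 y)) <= 1) ->
  forall w a1 a2 q x3 y, \sum_s1 \sum_s2 expect (x1_word_law pX1 iota a1 q)
    (fun x1 => expect (x2_word_law pX2 iota a2 q)
    (fun x2 => relay_word_score al be s1 s2 w a1 a2 q x1 x2 x3 y)) <= 1.
Proof.
move=> al0 be0 al1 be1 w a1 a2 q x3 y.
have -> : \sum_s1 \sum_s2 expect (x1_word_law pX1 iota a1 q)
    (fun x1 => expect (x2_word_law pX2 iota a2 q)
    (fun x2 => relay_word_score al be s1 s2 w a1 a2 q x1 x2 x3 y)) =
  (\sum_(s1 : {ffun I' -> S1}) \prod_i \sum_s2 al (s1 i) s2 (w i)) *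
  expect (x1_word_law pX1 iota a1 q) (fun x1 => \prod_i expect
    (pX2 (a2 (iota i)) (q i)) (fun x2 => be (a1 (iota i)) (a2 (iota i)) (q i)
    (x1 i) x2 (x3 i) (y i))).
  rewrite mulr_suml; apply: eq_bigr => s1 _.
  rewrite bigA_distr_bigA mulr_suml; apply: eq_bigr => s2 _.
  rewrite -expectZl; apply: eq_expect => x1; rewrite expectZl; congr (_ * _).
  exact: (expect_prod_law _ (fun i x2 => be (a1 (iota i)) (a2 (iota i)) (q i)
    (x1 i) x2 (x3 i) (y i))).
rewrite mulr_ile1//.
- by apply: sumr_ge0 => s1 _; apply: prodr_ge0 => i _; apply: sumr_ge0.
- apply: expect_ge0 => [|x1]; first exact: x1_word_law_pmf.
  by apply: prodr_ge0 => i _; apply: expect_ge0.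
- apply: (sum_prod_le1 (f := fun i s1 => \sum_s2 al s1 s2 (w i))) => // i s1.
  exact: sumr_ge0.
- apply: (expect_prod_le1 (f := fun i x1 => expect (pX2 (a2 (iota i)) (q i))
    (fun x2 => be (a1 (iota i)) (a2 (iota i)) (q i) x1 x2 (x3 i) (y i)))) => //.
  by move=> i x1; apply: expect_ge0.
Qed.

(** The candidate occurs in both factors, so source and channel must be summed jointly, letter by
    letter, through [block_sum1_le1]. *)
Lemma dest_word_score4_le1 al be :
  (forall a1 a2 w t, 0 <= al a1 a2 w t) ->
  (forall a1 a2 w t q x1 x2 x3 y, 0 <= be a1 a2 w t q x1 x2 x3 y) ->
  (forall a2 w t, \sum_a1 al a1 a2 w t <= 1) ->
  (forall a2 w t q x2 y, \sum_a1 al a1 a2 w t * expect (pX1 a1 q) (fun x1 =>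
     expect (pX3 a1 a2 q) (fun x3 => be a1 a2 w t q x1 x2 x3 y)) <= 1) ->
  forall a2 w t q x2 y, \sum_a1 expect (x1_word_law pX1 iota a1 q) (fun x1 =>
    expect (x3_word_law pX3 iota a1 a2 q) (fun x3 =>
      dest_word_score al be a1 a2 w t q x1 x2 x3 y)) <= 1.
Proof.
move=> al0 be0 al1 be1 a2 w t q x2 y.
pose g i v := expect (pX1 v (q i)) (fun x1 => expect (pX3 v (a2 (iota i)) (q i))
  (fun x3 => be v (a2 (iota i)) (w (iota i)) (t (iota i)) (q i) x1 (x2 i) x3 (y i))).
apply: (le_trans _ (block_sum1_le1
  (f := fun i v => al v (a2 i) (w i) (t i)) (g := g) iota_inj _ _ _ _)) => //.
- apply: ler_sum => a1 _; rewrite le_eqVlt; apply/orP; left; apply/eqP.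
  rewrite /dest_word_score; under eq_expect do rewrite expectZl.
  rewrite expectZl; congr (_ * _).
  rewrite -(expect_prod_law _ (fun i x1 => expect (pX3 (a1 (iota i)) (a2 (iota i)) (q i))
    (fun x3 => be (a1 (iota i)) (a2 (iota i)) (w (iota i)) (t (iota i)) (q i)
    x1 (x2 i) x3 (y i)))).
  apply: eq_expect => x1.
  exact: (expect_prod_law _ (fun i x3 => be (a1 (iota i)) (a2 (iota i))
    (w (iota i)) (t (iota i)) (q i) (x1 i) (x2 i) x3 (y i))).
- by move=> i v; do 2!apply: expect_ge0 => // ?.
- by move=> i; exact: be1.
Qed.

Lemma dest_word_score5_le1 al be :
  (forall a1 a2 w t, 0 <= al a1 a2 w t) ->
  (forall a1 a2 w t q x1 x2 x3 y, 0 <= be a1 a2 w t q x1 x2 x3 y) ->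
  (forall a1 w t, \sum_a2 al a1 a2 w t <= 1) ->
  (forall a1 w t q x1 y, \sum_a2 al a1 a2 w t * expect (pX2 a2 q) (fun x2 =>
     expect (pX3 a1 a2 q) (fun x3 => be a1 a2 w t q x1 x2 x3 y)) <= 1) ->
  forall a1 w t q x1 y, \sum_a2 expect (x2_word_law pX2 iota a2 q) (fun x2 =>
    expect (x3_word_law pX3 iota a1 a2 q) (fun x3 =>
      dest_word_score al be a1 a2 w t q x1 x2 x3 y)) <= 1.
Proof.
move=> al0 be0 al1 be1 a1 w t q x1 y.
pose g i v := expect (pX2 v (q i)) (fun x2 => expect (pX3 (a1 (iota i)) v (q i))
  (fun x3 => be (a1 (iota i)) v (w (iota i)) (t (iota i)) (q i) (x1 i) x2 x3 (y i))).
apply: (le_trans _ (block_sum1_le1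
  (f := fun i v => al (a1 i) v (w i) (t i)) (g := g) iota_inj _ _ _ _)) => //.
- apply: ler_sum => a2 _; rewrite le_eqVlt; apply/orP; left; apply/eqP.
  rewrite /dest_word_score; under eq_expect do rewrite expectZl.
  rewrite expectZl; congr (_ * _).
  rewrite -(expect_prod_law _ (fun i x2 => expect (pX3 (a1 (iota i)) (a2 (iota i)) (q i))
    (fun x3 => be (a1 (iota i)) (a2 (iota i)) (w (iota i)) (t (iota i)) (q i)
    (x1 i) x2 x3 (y i)))).
  apply: eq_expect => x2.
  exact: (expect_prod_law _ (fun i x3 => be (a1 (iota i)) (a2 (iota i))
    (w (iota i)) (t (iota i)) (q i) (x1 i) (x2 i) x3 (y i))).
- by move=> i v; do 2!apply: expect_ge0 => // ?.
- by move=> i; exact: be1.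
Qed.

Lemma dest_word_score6_le1 al be :
  (forall a1 a2 w t, 0 <= al a1 a2 w t) ->
  (forall a1 a2 w t q x1 x2 x3 y, 0 <= be a1 a2 w t q x1 x2 x3 y) ->
  (forall w t, \sum_a1 \sum_a2 al a1 a2 w t <= 1) ->
  (forall w t q y, \sum_a1 \sum_a2 al a1 a2 w t * expect (pX1 a1 q) (fun x1 =>
     expect (pX2 a2 q) (fun x2 => expect (pX3 a1 a2 q) (fun x3 =>
       be a1 a2 w t q x1 x2 x3 y))) <= 1) ->
  forall w t q y, \sum_a1 \sum_a2 expect (x1_word_law pX1 iota a1 q) (fun x1 =>
    expect (x2_word_law pX2 iota a2 q) (fun x2 =>
    expect (x3_word_law pX3 iota a1 a2 q) (fun x3 =>
      dest_word_score al be a1 a2 w t q x1 x2 x3 y))) <= 1.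
Proof.
move=> al0 be0 al1 be1 w t q y.
pose g i v u := expect (pX1 v (q i)) (fun x1 => expect (pX2 u (q i)) (fun x2 =>
  expect (pX3 v u (q i)) (fun x3 =>
    be v u (w (iota i)) (t (iota i)) (q i) x1 x2 x3 (y i)))).
apply: (le_trans _ (block_sum_le1 iota_inj
  (f := fun i v u => al v u (w i) (t i)) (g := g) _ _ _ _)) => //.
- apply: ler_sum => a1 _; apply: ler_sum => a2 _.
  rewrite le_eqVlt; apply/orP; left; apply/eqP; rewrite /dest_word_score.
  under eq_expect => x1 do (under eq_expect do rewrite expectZl; rewrite expectZl).
  rewrite expectZl; congr (_ * _).
  rewrite -(expect_prod_law _ (fun i x1 => expect (pX2 (a2 (iota i)) (q i)) (fun x2 =>
    expect (pX3 (a1 (iota i)) (a2 (iota i)) (q i))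
    (fun x3 => be (a1 (iota i)) (a2 (iota i)) (w (iota i)) (t (iota i)) (q i)
    x1 x2 x3 (y i))))).
  apply: eq_expect => x1.
  rewrite -(expect_prod_law _ (fun i x2 => expect (pX3 (a1 (iota i)) (a2 (iota i)) (q i))
    (fun x3 => be (a1 (iota i)) (a2 (iota i)) (w (iota i)) (t (iota i)) (q i)
    (x1 i) x2 x3 (y i)))).
  apply: eq_expect => x2.
  exact: (expect_prod_law _ (fun i x3 => be (a1 (iota i)) (a2 (iota i))
    (w (iota i)) (t (iota i)) (q i) (x1 i) (x2 i) x3 (y i))).
- by move=> i v u; do 3!apply: expect_ge0 => // ?.
- by move=> i; exact: be1.
Qed.

Lemma dest_word_score7_le1 (al : S1 -> S2 -> W -> R)
    (be : W -> Q -> X1 -> X2 -> X3 -> Y -> R) :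
  (forall a1 a2 w, 0 <= al a1 a2 w) ->
  (forall w q x1 x2 x3 y, 0 <= be w q x1 x2 x3 y) ->
  (forall w, \sum_a1 \sum_a2 al a1 a2 w <= 1) ->
  (forall w y, \sum_a1 \sum_a2 al a1 a2 w * expect pQ (fun q =>
     expect (pX1 a1 q) (fun x1 => expect (pX2 a2 q) (fun x2 =>
     expect (pX3 a1 a2 q) (fun x3 => be w q x1 x2 x3 y)))) <= 1) ->
  forall w y, \sum_a1 \sum_a2 expect (q_word_law pQ) (fun q =>
    expect (x1_word_law pX1 iota a1 q) (fun x1 =>
    expect (x2_word_law pX2 iota a2 q) (fun x2 =>
    expect (x3_word_law pX3 iota a1 a2 q) (fun x3 =>
      dest_word_score (fun a1 a2 w _ => al a1 a2 w)
        (fun _ _ w _ q x1 x2 x3 y => be w q x1 x2 x3 y)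
        a1 a2 w (map_word h1 a1) q x1 x2 x3 y)))) <= 1.
Proof.
move=> al0 be0 al1 be1 w y.
pose g i v u := expect pQ (fun q => expect (pX1 v q) (fun x1 =>
  expect (pX2 u q) (fun x2 => expect (pX3 v u q) (fun x3 =>
    be (w (iota i)) q x1 x2 x3 (y i))))).
apply: (le_trans _ (block_sum_le1 iota_inj
  (f := fun i v u => al v u (w i)) (g := g) _ _ _ _)) => //.
- apply: ler_sum => a1 _; apply: ler_sum => a2 _.
  rewrite le_eqVlt; apply/orP; left; apply/eqP; rewrite /dest_word_score.
  under eq_expect => q do (under eq_expect => x1 do
    (under eq_expect do rewrite expectZl; rewrite expectZl); rewrite expectZl).
  rewrite expectZl; congr (_ * _).
  rewrite -(expect_prod_law _ (fun i q => expect (pX1 (a1 (iota i)) q) (fun x1 =>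
    expect (pX2 (a2 (iota i)) q) (fun x2 =>
    expect (pX3 (a1 (iota i)) (a2 (iota i)) q)
    (fun x3 => be (w (iota i)) q x1 x2 x3 (y i)))))).
  apply: eq_expect => q.
  rewrite -(expect_prod_law _ (fun i x1 => expect (pX2 (a2 (iota i)) (q i)) (fun x2 =>
    expect (pX3 (a1 (iota i)) (a2 (iota i)) (q i))
    (fun x3 => be (w (iota i)) (q i) x1 x2 x3 (y i))))).
  apply: eq_expect => x1.
  rewrite -(expect_prod_law _ (fun i x2 => expect (pX3 (a1 (iota i)) (a2 (iota i)) (q i))
    (fun x3 => be (w (iota i)) (q i) (x1 i) x2 x3 (y i)))).
  apply: eq_expect => x2.
  exact: (expect_prod_law _ (fun i x3 => be (w (iota i)) (q i) (x1 i) (x2 i) x3 (y i))).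
- by move=> i v u; do 4!apply: expect_ge0 => // ?.
- by move=> i; exact: be1.
Qed.

End Scores.
(** In these names [s] and [c] stand for source and channel scores, [r] and [d] for relay and
    destination, and the digit is that of the inequality. *)
Let sr1 s1 s2 w := cprob pS src_S1 [% src_S2, src_W3] s1 (s2, w).
Let sr2 s1 s2 w := cprob pS src_S2 [% src_S1, src_W3] s2 (s1, w).
Let sr3 s1 s2 w := cprob pS [% src_S1, src_S2] src_W3 (s1, s2) w.
Let cr1 (a1 : S1) (a2 : S2) q x1 x2 x3 y :=
  info_ratio P rX1 rY3 [% rS1, rX2, rX3, rQ] x1 y (a1, x2, x3, q).
Let cr2 (a1 : S1) (a2 : S2) q x1 x2 x3 y :=
  info_ratio P rX2 rY3 [% rS2, rX1, rX3, rQ] x2 y (a2, x1, x3, q).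
Let cr3 (a1 : S1) (a2 : S2) q x1 x2 x3 y :=
  info_ratio P [% rX1, rX2] rY3 [% rS1, rS2, rX3, rQ] (x1, x2) y (a1, a2, x3, q).
Let sd4 a1 a2 w (_ : T) := cprob pS src_S1 [% src_S2, src_W] a1 (a2, w).
Let sd5 a1 a2 w (_ : T) := cprob pS src_S2 [% src_S1, src_W] a2 (a1, w).
Let sd6 a1 a2 w t :=
  cprob pS [% src_S1, src_S2] [% src_W, h1 \o src_S1] (a1, a2) (w, t).
Let sd7 a1 a2 w := cprob pS [% src_S1, src_S2] src_W (a1, a2) w.
Let cd4 (a1 : S1) (a2 : S2) w (t : T) q x1 x2 x3 y :=
  info_ratio P [% rX1, rX3] rY [% rS2, rX2, rW, rQ] (x1, x3) y (a2, x2, w, q).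
Let cd5 (a1 : S1) (a2 : S2) w (t : T) q x1 x2 x3 y :=
  info_ratio P [% rX2, rX3] rY [% rS1, rX1, rW, rQ] (x2, x3) y (a1, x1, w, q).
Let cd6 (a1 : S1) (a2 : S2) w (t : T) q x1 x2 x3 y :=
  info_ratio P [% rX1, rX2, rX3] rY [% rW, h1 \o rS1, rQ] (x1, x2, x3) y (w, t, q).
Let cd7 w (q : Q) x1 x2 x3 y :=
  info_ratio P [% rX1, rX2, rX3] rY rW (x1, x2, x3) y w.

Let Pp : is_pmf P.
Proof. exact: joint_pmf_pmf. Qed.

Let cond_entropy_src (A B : finType) (U : L -> A) (V : L -> B) u v :
  (forall z q x1 x2 x3 y, U (z, q, x1, x2, x3, y) = u z) ->
  (forall z q x1 x2 x3 y, V (z, q, x1, x2, x3, y) = v z) ->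
  `H[P](U | V) = expect pS (fun z => - ln (cprob pS u v (u z) (v z))).
Proof.
move=> uE vE; rewrite -cond_entropyE// /cond_entropy; congr (- _).
apply: eq_bigr => a _; apply: eq_bigr => b _.
rewrite (law_joint_src pS pQp pX1p pX2p pX3p chp (u := [% u, v]))//; last first.
  by move=> *; rewrite /pairRV uE vE.
by rewrite (law_joint_src pS pQp pX1p pX2p pX3p chp (u := v)).
Qed.

Hypothesis ineq1 : `H[P](rS1 | [% rS2, rW3]) < `I[P](rX1 ; rY3 | [% rS1, rX2, rX3, rQ]).
Hypothesis ineq2 : `H[P](rS2 | [% rS1, rW3]) < `I[P](rX2 ; rY3 | [% rS2, rX1, rX3, rQ]).
Hypothesis ineq3 : `H[P]([% rS1, rS2] | rW3)
  < `I[P]([% rX1, rX2] ; rY3 | [% rS1, rS2, rX3, rQ]).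
Hypothesis ineq4 : `H[P](rS1 | [% rS2, rW])
  < `I[P]([% rX1, rX3] ; rY | [% rS2, rX2, rW, rQ]).
Hypothesis ineq5 : `H[P](rS2 | [% rS1, rW])
  < `I[P]([% rX2, rX3] ; rY | [% rS1, rX1, rW, rQ]).
Hypothesis ineq6 : `H[P]([% rS1, rS2] | [% rW, h1 \o rS1])
  < `I[P]([% rX1, rX2, rX3] ; rY | [% rW, h1 \o rS1, rQ]).
Hypothesis ineq7 : `H[P]([% rS1, rS2] | rW) < `I[P]([% rX1, rX2, rX3] ; rY | rW).

Let tails_of (A B A' B' C' : finType) (u : Z -> A) (v : Z -> B) (U : L -> A)
    (V : L -> B) (U' : L -> A') (V' : L -> B') (W' : L -> C') :
  (forall z q x1 x2 x3 y, U (z, q, x1, x2, x3, y) = u z) ->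
  (forall z q x1 x2 x3 y, V (z, q, x1, x2, x3, y) = v z) ->
  `H[P](U | V) < `I[P](U' ; V' | W') ->
  block_regime (fun I I' (iota : I -> I') eps => exists a b,
    [/\ 0 < a, 0 < b, src_tail pS I' (fun z => cprob pS u v (u z) (v z)) a <= eps,
        channel_tail pS pQ pX1 pX2 pX3 ch iota
          (fun o => info_ratio P U' V' W' (U' o) (V' o) (W' o)) b <= eps &
        (a * b)^-1 <= eps]).
Proof.
move=> uE vE; rewrite (cond_entropy_src uE vE) cond_mutual_infoE// => lt.
apply: score_tails => // [z|o]; first exact: cprob_gt0.
exact: info_ratio_gt0.
Qed.

Theorem block_code : block_regime block_code_spec.
Proof.
have t1 := tails_of (u := src_S1) (v := [% src_S2, src_W3]) (fun _ _ _ _ _ _ => erefl)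
  (fun _ _ _ _ _ _ => erefl) ineq1.
have t2 := tails_of (u := src_S2) (v := [% src_S1, src_W3]) (fun _ _ _ _ _ _ => erefl)
  (fun _ _ _ _ _ _ => erefl) ineq2.
have t3 := tails_of (u := [% src_S1, src_S2]) (v := src_W3) (fun _ _ _ _ _ _ => erefl)
  (fun _ _ _ _ _ _ => erefl) ineq3.
have t4 := tails_of (u := src_S1) (v := [% src_S2, src_W]) (fun _ _ _ _ _ _ => erefl)
  (fun _ _ _ _ _ _ => erefl) ineq4.
have t5 := tails_of (u := src_S2) (v := [% src_S1, src_W]) (fun _ _ _ _ _ _ => erefl)
  (fun _ _ _ _ _ _ => erefl) ineq5.
have t6 := tails_of (u := [% src_S1, src_S2]) (v := [% src_W, h1 \o src_S1])
  (fun _ _ _ _ _ _ => erefl) (fun _ _ _ _ _ _ => erefl) ineq6.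
have t7 := tails_of (u := [% src_S1, src_S2]) (v := src_W) (fun _ _ _ _ _ _ => erefl)
  (fun _ _ _ _ _ _ => erefl) ineq7.
have [eta eta0 H] := block_regime_and t1 (block_regime_and t2 (block_regime_and t3
  (block_regime_and t4 (block_regime_and t5 (block_regime_and t6 t7))))).
(* Each of the seven inequalities contributes a source tail, a channel tail and an inverse
   threshold: 21 terms, and 22 makes the final bound strict. *)
exists eta => // eps eps0; have e0 : 0 < eps / 22 by rewrite divr_gt0.
have [L0 HL] := H _ e0; exists L0 => I I' iota iI LI I'I.
have {H HL} := HL _ _ _ iI LI I'I.
move=> [[u1 [v1 [u1p v1p s1 c1 i1]]] [[u2 [v2 [u2p v2p s2 c2 i2]]]
  [[u3 [v3 [u3p v3p s3 c3 i3]]] [[u4 [v4 [u4p v4p s4 c4 i4]]]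
  [[u5 [v5 [u5p v5p s5 c5 i5]]] [[u6 [v6 [u6p v6p s6 c6 i6]]]
  [u7 [v7 [u7p v7p s7 c7 i7]]]]]]]]].
have src_pair_le1 (B : finType) (V : Z -> B) b :
    \sum_s1 \sum_s2 cprob pS [% src_S1, src_S2] V (s1, s2) b <= 1.
  rewrite pair_bigA /=; under eq_bigr do rewrite -surjective_pairing.
  exact: cprob_sum_le1.
have cp0 := cprob_ge0 pSp; have ir0 := info_ratio_ge0 Pp.
have m1 : _ <= _ := relay_word_miss_le (al := sr1) (be := cr1) iota
  (fun _ _ _ => cp0 _ _ _ _ _ _) (fun _ _ _ _ _ _ _ => ir0 _ _ _ _ _ _ _ _ _) u1p v1p.
have m2 : _ <= _ := relay_word_miss_le (al := sr2) (be := cr2) iota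
  (fun _ _ _ => cp0 _ _ _ _ _ _) (fun _ _ _ _ _ _ _ => ir0 _ _ _ _ _ _ _ _ _) u2p v2p.
have m3 : _ <= _ := relay_word_miss_le (al := sr3) (be := cr3) iota
  (fun _ _ _ => cp0 _ _ _ _ _ _) (fun _ _ _ _ _ _ _ => ir0 _ _ _ _ _ _ _ _ _) u3p v3p.
have m4 : _ <= _ := dest_word_miss_le (al := sd4) (be := cd4) iota
  (fun _ _ _ _ => cp0 _ _ _ _ _ _) (fun _ _ _ _ _ _ _ _ _ => ir0 _ _ _ _ _ _ _ _ _) u4p v4p.
have m5 : _ <= _ := dest_word_miss_le (al := sd5) (be := cd5) iota
  (fun _ _ _ _ => cp0 _ _ _ _ _ _) (fun _ _ _ _ _ _ _ _ _ => ir0 _ _ _ _ _ _ _ _ _) u5p v5p.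
have m6 : _ <= _ := dest_word_miss_le (al := sd6) (be := cd6) iota
  (fun _ _ _ _ => cp0 _ _ _ _ _ _) (fun _ _ _ _ _ _ _ _ _ => ir0 _ _ _ _ _ _ _ _ _) u6p v6p.
have m7 : _ <= _ := dest_word_miss_le (al := fun a1 a2 w _ => sd7 a1 a2 w)
  (be := fun _ _ w _ q x1 x2 x3 y => cd7 w q x1 x2 x3 y) iota
  (fun _ _ _ _ => cp0 _ _ _ _ _ _) (fun _ _ _ _ _ _ _ _ _ => ir0 _ _ _ _ _ _ _ _ _) u7p v7p.
apply: (one_shot_code
  (h1 := map_word h1) (h2 := map_word h2) (muQ := q_word_law pQ)
  (mu1 := x1_word_law pX1 iota) (mu2 := x2_word_law pX2 iota)
  (mu3 := x3_word_law pX3 iota) _ _ _ _ _ _ _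
  (rho1 := relay_word_score iota sr1 cr1) (rho2 := relay_word_score iota sr2 cr2)
  (rho3 := relay_word_score iota sr3 cr3) (rho4 := dest_word_score iota sd4 cd4)
  (rho5 := dest_word_score iota sd5 cd5) (rho6 := dest_word_score iota sd6 cd6)
  (rho7 := dest_word_score iota (fun a1 a2 w _ => sd7 a1 a2 w)
     (fun _ _ w _ q x1 x2 x3 y => cd7 w q x1 x2 x3 y))
  (th1 := u1 * v1) (th2 := u2 * v2) (th3 := u3 * v3) (th4 := u4 * v4)
  (th5 := u5 * v5) (th6 := u6 * v6) (th7 := u7 * v7) _ _ _ _ _ _ _ _ _).
- exact: src_word_law_pmf.
- exact: q_word_law_pmf.
- by move=> *; apply: x1_word_law_pmf.
- by move=> *; apply: x2_word_law_pmf.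
- by move=> *; apply: x3_word_law_pmf.
- by move=> *; apply: word_channel_pmf.
- move=> z zN0; apply/ffunP => i; rewrite !ffunE.
  by apply: common; apply: (prod_law_neq0 i zN0).
- split=> *; split; rewrite mulr_ge0//; apply: prodr_ge0 => i _;
    by [exact: cp0|exact: ir0].
- by split; split; rewrite mulr_gt0.
- apply: relay_word_score1_le1 => *; [exact: cp0|exact: ir0|exact: cprob_sum_le1|].
  exact: relay_ratio1_le1.
- apply: relay_word_score2_le1 => *; [exact: cp0|exact: ir0|exact: cprob_sum_le1|].
  exact: relay_ratio2_le1.
- apply: relay_word_score3_le1 => *; [exact: cp0|exact: ir0|exact: src_pair_le1|].
  exact: relay_ratio3_le1.
- apply: dest_word_score4_le1 => // *; [exact: cp0|exact: ir0|exact: cprob_sum_le1|].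
  exact: dest_ratio4_le1.
- apply: dest_word_score5_le1 => // *; [exact: cp0|exact: ir0|exact: cprob_sum_le1|].
  exact: dest_ratio5_le1.
- apply: dest_word_score6_le1 => // *; [exact: cp0|exact: ir0|exact: src_pair_le1|].
  exact: dest_ratio6_le1.
- apply: dest_word_score7_le1 => // *; [exact: cp0|exact: ir0|exact: src_pair_le1|].
  exact: dest_ratio7_le1.
- apply: le_lt_trans (_ : 21 * (eps / 22) < eps); last by lra.
  apply: le_trans (lerD (lerD (lerD (lerD (lerD (lerD (lerD m1 m2) m3) m4) m5) m6)
    m7) (lexx _)) _.
  by clear -s1 s2 s3 s4 s5 s6 s7 c1 c2 c3 c4 c5 c6 c7 i1 i2 i3 i4 i5 i6 i7; lra.
Qed.

End BlockCode.

(** * Resampling and causal laws *)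

Lemma expect_codeword2 (R : realType) (K V : finType) (mu : K -> V -> R) k k'
    (F : V -> V -> R) : (forall k, is_pmf (mu k)) -> k != k' ->
  expect (prod_law mu) (fun c => F (c k) (c k')) =
  expect (mu k) (fun v => expect (mu k') (F v)).
Proof.
move=> mup kk'.
transitivity (expect (prod_law mu) (fun c => \sum_v (c k == v)%:R * F v (c k'))).
  apply: eq_expect => c; rewrite (bigD1 (c k))//= eqxx mul1r big1 ?addr0// => v.
  by rewrite eq_sym => /negbTE->; rewrite mul0r.
rewrite expect_sum; apply: eq_bigr => v _.
rewrite (expect_codewordM mup (fun x => (x == v)%:R) (F v) kk').
rewrite (expect_codeword mup k (fun x => (x == v)%:R)); congr (_ * _).
rewrite -[RHS] mulr1 -(expect_ind (mu k) (fun=> 1)); apply: eq_expect => x.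
by rewrite mulr1.
Qed.

Lemma expect_curry (R : realType) (K L V : finType) (p : V -> R)
    (F : {ffun K -> {ffun L -> V}} -> R) :
  expect (prod_law (fun _ : K * L => p))
    (fun f => F [ffun k => [ffun l => f (k, l)]]) =
  expect (prod_law (fun=> prod_law (fun=> p))) F.
Proof.
rewrite /expect [RHS] (reindex (fun f : {ffun K * L -> V} =>
  [ffun k => [ffun l => f (k, l)]]))/=; last first.
  exists (fun g : {ffun K -> {ffun L -> V}} => [ffun kl => g kl.1 kl.2]) => g _.
    by apply/ffunP => -[k l]; rewrite !ffunE.
  by apply/ffunP => k; apply/ffunP => l; rewrite !ffunE.
apply: eq_bigr => f _; congr (_ * _); rewrite /prod_law.
transitivity (\prod_k \prod_l p (f (k, l))); first by rewrite pair_bigA; apply: eq_bigr => -[].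
by apply: eq_bigr => k _; apply: eq_bigr => l _; rewrite !ffunE.
Qed.

Section Resampling.
Variables (R : realType) (J K V : finType) (phi : J -> K) (p : V -> R).
Hypotheses (phi_inj : injective phi) (pp : is_pmf p).

Definition overwrite (z : J -> V) (zeta : K -> V) : {ffun K -> V} :=
  [ffun k => if [pick j | phi j == k] is Some j then z j else zeta k].

Lemma overwrite_phi z zeta j : overwrite z zeta (phi j) = z j.
Proof.
rewrite ffunE; case: pickP => [i /eqP/phi_inj->//|/(_ j)].
by rewrite eqxx.
Qed.

(** Replacing some letters of an i.i.d. array by independent letters of the same law keeps it i.i.d.
    Thus the true source letters together with random padding form independent blocks of one common
    law. *)
Lemma expect_overwrite (F : {ffun K -> V} -> R) :
  expect (prod_law (fun=> p)) (fun zeta => expect (prod_law (fun=> p))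
    (fun z : {ffun J -> V} => F (overwrite z zeta))) =
  expect (prod_law (fun=> p)) F.
Proof.
(* [off] marks the positions that keep their letter of [zeta]. The indicator of a given array splits
   into a factor on these positions and a factor on the letters of [z]. *)
pose off k := [forall j, phi j != k].
have FE (z : {ffun J -> V}) (zeta : {ffun K -> V}) : F (overwrite z zeta) =
    \sum_f F f * ((\prod_k if off k then (zeta k == f k)%:R else 1) *
                  \prod_j (z j == f (phi j))%:R).
  transitivity (\sum_f F f * (overwrite z zeta == f)%:R).
    rewrite (bigD1 (overwrite z zeta))//= eqxx mulr1 big1 ?addr0// => f.
    by rewrite eq_sym => /negbTE->; rewrite mulr0.
  apply: eq_bigr => f _; congr (_ * _).
  rewrite -ffun_ind (prod_fiber phi (fun j k => (z j == f k)%:R)) -big_split/=.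
  apply: eq_bigr => k _; rewrite ffunE; case: pickP => [j /eqP<-|kN].
    rewrite (prod_fiber_inj (fun i => (z i == f (phi j))%:R))// /off.
    by case: forallP => [/(_ j)|_]; rewrite ?eqxx ?mul1r.
  rewrite big_pred0// mulr1 /off; case: forallP => // -[] j.
  by rewrite kN.
under eq_expect => zeta do (under eq_expect do rewrite FE; rewrite expect_sum).
rewrite expect_sum; apply: eq_bigr => f _.
under eq_expect => zeta do (rewrite expectZl expectZl
  (expect_prod_law (fun=> p) (fun j v => (v == f (phi j))%:R))).
rewrite expectZl expectZr mulrC; congr (_ * _).
rewrite (expect_prod_law (fun=> p) (fun k v => if off k then (v == f k)%:R else 1)).
have ind v : expect p (fun x => (x == v)%:R) = p v.
  rewrite -[RHS] mulr1 -(expect_ind p (fun=> 1)).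
  by apply: eq_expect => x; rewrite mulr1.
under [X in _ * X]eq_bigr do rewrite ind.
rewrite (prod_fiber phi (fun j k => p (f k))) -big_split; apply: eq_bigr => k _ /=.
case: (pickP (fun j => phi j == k)) => [j /eqP<-|kN].
  rewrite (prod_fiber_inj (fun=> p (f (phi j))))// /off.
  by case: forallP => [/(_ j)|_]; rewrite ?eqxx// expect_const ?mul1r.
rewrite big_pred0// mulr1 /off; case: forallP => [_|[] j]; last by rewrite kN.
exact: ind.
Qed.

End Resampling.

Section CausalLaw.
Variables (R : realType) (O Y3 : finType) (o3 : O -> Y3).

(** Each kernel depends on the past outputs, so this is no product law. The induction peels off the
    first output, which becomes the head of the history of all later kernels. *)
Lemma sum_causal_law n (K : 'I_n -> seq Y3 -> O -> R) :
  (forall k h, is_pmf (K k h)) ->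
  \sum_(y : n.-tuple O) \prod_(k < n) K k (take k (map o3 y)) (tnth y k) = 1.
Proof.
elim: n K => [|n IHn] K Kp.
  by rewrite (big_pred1 [tuple]) ?big_ord0// => y; rewrite [y]tuple0 /= eqxx.
rewrite (reindex (fun p : O * n.-tuple O => cons_tuple p.1 p.2))/=; last first.
  exists (fun t => (thead t, behead_tuple t)) => [[a t] _|t _].
    by rewrite theadE; congr (_, _); apply: val_inj.
  by rewrite [RHS]tuple_eta.
rewrite -(pair_bigA _ (fun (a : O) (t : n.-tuple O) => \prod_(k < n.+1)
  K k (take k (map o3 (a :: t))) (tnth (cons_tuple a t) k)))/=.
apply: etrans (pmf_sum1 (Kp ord0 [::])); apply: eq_bigr => a _.
transitivity (K ord0 [::] a * \sum_(y : n.-tuple O) \prod_(k < n)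
    K (lift ord0 k) (o3 a :: take k (map o3 y)) (tnth y k)); last first.
  by rewrite (IHn (fun k h => K (lift ord0 k) (o3 a :: h))) ?mulr1.
rewrite mulr_sumr; apply: eq_bigr => t _; rewrite big_ord_recl; congr (_ * _).
apply: eq_bigr => k _; congr (K _ _ _).
by rewrite !(tnth_nth a).
Qed.

End CausalLaw.

(** * Block-Markov code *)

Lemma sum_tuple_ffun (R : realType) (A : finType) m (F : m.-tuple A -> R) :
  \sum_t F t = \sum_(f : {ffun 'I_m -> A}) F (mktuple f).
Proof.
rewrite (reindex (fun f : {ffun 'I_m -> A} => mktuple f))//=.
exists (fun t : m.-tuple A => [ffun i => tnth t i]) => t _.
  by apply/ffunP => i; rewrite ffunE tnth_mktuple.
by apply: eq_from_tnth => i; rewrite tnth_mktuple ffunE.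
Qed.

Section BlockMarkovCode.
Variables (R : realType) (S1 S2 W3 W X1 X2 X3 Y3 Y : finType).
Variables (pS : S1 * S2 * W3 * W -> R) (ch : X1 -> X2 -> X3 -> Y3 * Y -> R).
Hypotheses (pSp : is_pmf pS) (chp : is_channel ch).
Let Z : finType := (S1 * S2 * W3 * W)%type.
Variables (x01 : X1) (x02 : X2) (x03 : X3) (y03 : Y3).
Variables (I I' : finType) (B m n : nat).
Variables (phi : 'I_m -> 'I_B.+2 * I') (tau : 'I_B.+1 * I -> 'I_n).
Hypotheses (phi_inj : injective phi) (tau_inj : injective tau).
Hypothesis phi_inner : forall j, (0 < (phi j).1 < B.+1)%N.
Hypothesis tau_mono : forall (b b' : 'I_B.+1) i i', (b < b')%N -> (tau (b, i) < tau (b', i'))%N.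
Variables
  (e1 : {ffun I' -> S1} -> {ffun I' -> S1} -> {ffun I -> X1})
  (e2 : {ffun I' -> S2} -> {ffun I' -> S2} -> {ffun I -> X2})
  (e3 : {ffun I' -> S1} -> {ffun I' -> S2} -> {ffun I -> X3})
  (r : {ffun I -> Y3} -> {ffun I' -> W3} ->
       {ffun I' -> S1} * {ffun I' -> S2} -> {ffun I' -> S1} * {ffun I' -> S2})
  (d : {ffun I -> Y} -> {ffun I' -> W} ->
       {ffun I' -> S1} * {ffun I' -> S2} -> {ffun I' -> S1} * {ffun I' -> S2}).

(* Channel block [b] carries source blocks [lo b] and [up b]; the source blocks
   number 0 and B+1, like the positions that [phi] misses, are filled with the
   constants [zeta], known to all the nodes. *)
Let lo (b : 'I_B.+1) : 'I_B.+2 := widen_ord (leqnSn _) b.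
Let up (b : 'I_B.+1) : 'I_B.+2 := lift ord0 b.

Let block_word_err (z z' : {ffun I' -> Z}) (y : {ffun I -> Y3 * Y}) : bool :=
  (r (map_word fst y) (map_word src_W3 z') (map_word src_S1 z, map_word src_S2 z)
     != (map_word src_S1 z', map_word src_S2 z')) ||
  (d (map_word snd y) (map_word src_W z) (map_word src_S1 z', map_word src_S2 z')
     != (map_word src_S1 z, map_word src_S2 z)).

Let block_word_fail (z z' : {ffun I' -> Z}) : R :=
  expect (word_channel ch (e1 (map_word src_S1 z') (map_word src_S1 z))
    (e2 (map_word src_S2 z') (map_word src_S2 z))
    (e3 (map_word src_S1 z) (map_word src_S2 z)))
    (fun y => (block_word_err z z' y)%:R).

Let blocks (f : {ffun 'I_B.+2 * I' -> Z}) : {ffun 'I_B.+2 -> {ffun I' -> Z}} :=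
  [ffun b => [ffun i => f (b, i)]].

Section FixedPadding.
Variable zeta : 'I_B.+2 * I' -> Z.

(** The component [f] of the padding is all that is needed, so each node can build the padded words
    of its own observation. *)
Definition word (A : finType) (f : Z -> A) (a : m.-tuple A) (b : 'I_B.+2) :
  {ffun I' -> A} := [ffun i => overwrite phi (tnth a) (f \o zeta) (b, i)].

Definition pad_word (b : 'I_B.+2) : {ffun I' -> Z} := [ffun i => zeta (b, i)].

(** The letter [x0] is sent at the channel uses that belong to no block. *)
Definition input (A C : finType) (x0 : A) (f : Z -> C)
    (e : {ffun I' -> C} -> {ffun I' -> C} -> {ffun I -> A}) (s : m.-tuple C)
    (k : 'I_n) : A :=
  if [pick bi | tau bi == k] is Some bi
  then e (word f s (up bi.1)) (word f s (lo bi.1)) bi.2 else x0.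

(** The estimate of source block b reads channel blocks below b only. By [tau_mono] these are
    complete when channel block b starts, so the default [y03] is not read by the encoder. *)
Fixpoint relay_estimate (h : seq Y3) (w : m.-tuple W3) (b : nat) :
    {ffun I' -> S1} * {ffun I' -> S2} :=
  if b is b'.+1 then
    r [ffun i => nth y03 h (tau (inord b', i))] (word src_W3 w (inord b))
      (relay_estimate h w b')
  else (map_word src_S1 (pad_word ord0), map_word src_S2 (pad_word ord0)).

(* [dest_estimate y w c] is the estimate of source block [B + 1 - c]. *)
Fixpoint dest_estimate (y : n.-tuple Y) (w : m.-tuple W) (c : nat) :
    {ffun I' -> S1} * {ffun I' -> S2} :=
  if c is c'.+1 then
    d [ffun i => tnth y (tau (inord (B - c'), i))] (word src_W w (inord (B - c')))
      (dest_estimate y w c')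
  else (map_word src_S1 (pad_word ord_max), map_word src_S2 (pad_word ord_max)).

Definition read_out (g : nat -> {ffun I' -> S1} * {ffun I' -> S2}) :
    m.-tuple S1 * m.-tuple S2 :=
  ([tuple (g (phi j).1).1 (phi j).2 | j < m],
   [tuple (g (phi j).1).2 (phi j).2 | j < m]).

Definition block_markov_code : mabrc_code S1 S2 W3 W X1 X2 X3 Y3 Y m n :=
  MabrcCode (MarcCode
    (fun s1 => [tuple input x01 src_S1 e1 s1 k | k < n])
    (fun s2 => [tuple input x02 src_S2 e2 s2 k | k < n])
    (fun k h w => if [pick bi | tau bi == k] is Some bi then
       let a := relay_estimate h w bi.1 in e3 a.1 a.2 bi.2 else x03)
    (fun y w => read_out (fun b => dest_estimate y w (B.+1 - b))))
  (fun y w => read_out (relay_estimate y w)).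

Let src_word (tz : m.-tuple Z) (b : 'I_B.+2) : {ffun I' -> Z} := word id tz b.
Let src_pair tz b := (map_word src_S1 (src_word tz b), map_word src_S2 (src_word tz b)).
Let out_word (ty : n.-tuple (Y3 * Y)) (b : 'I_B.+1) : {ffun I -> Y3 * Y} :=
  [ffun i => tnth ty (tau (b, i))].

(** The relay input computed from the true source blocks instead of the estimates; given the
    sources, the outputs are then independent in time. *)
Let genie_input3 tz (k : 'I_n) : X3 :=
  if [pick bi | tau bi == k] is Some bi
  then e3 (src_pair tz (lo bi.1)).1 (src_pair tz (lo bi.1)).2 bi.2 else x03.

Let genie_pmf (o : m.-tuple Z * n.-tuple (Y3 * Y)) : R :=
  (\prod_(j < m) pS (tnth o.1 j)) *
  \prod_(k < n) ch (input x01 src_S1 e1 (map_tuple src_S1 o.1) k)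
    (input x02 src_S2 e2 (map_tuple src_S2 o.1) k) (genie_input3 o.1 k) (tnth o.2 k).

Let block_err (o : m.-tuple Z * n.-tuple (Y3 * Y)) (b : 'I_B.+1) : bool :=
  (r (map_word fst (out_word o.2 b)) (map_word src_W3 (src_word o.1 (up b)))
     (src_pair o.1 (lo b)) != src_pair o.1 (up b)) ||
  (d (map_word snd (out_word o.2 b)) (map_word src_W (src_word o.1 (lo b)))
     (src_pair o.1 (up b)) != src_pair o.1 (lo b)).

Let word_map (A : finType) (f : Z -> A) tz b :
  word f (map_tuple f tz) b = map_word f (src_word tz b).
Proof.
apply/ffunP => i; rewrite !ffunE; case: pickP => //= j _.
by rewrite tnth_map.
Qed.

Let src_word_phi tz j : src_word tz (phi j).1 (phi j).2 = tnth tz j.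
Proof. by rewrite ffunE -surjective_pairing overwrite_phi. Qed.

Let src_word_pad tz (b : 'I_B.+2) : ~~ (0 < b < B.+1)%N -> src_word tz b = pad_word b.
Proof.
move=> bN; apply/ffunP => i; rewrite !ffunE; case: pickP => // j /eqP phij.
by have := phi_inner j; rewrite phij (negbTE bN).
Qed.

(** Correctness propagates forward from the padding block 0. The history need only agree with the
    outputs in the channel blocks before [c], so the lemma serves both the causal encoder and the
    final relay decoder. *)
Let relay_estimate_correct o h c : (forall b, ~~ block_err o b) -> (c <= B.+1)%N ->
  (forall (b : 'I_B.+1) i, (b < c)%N ->
     nth y03 h (tau (b, i)) = (tnth o.2 (tau (b, i))).1) ->
  relay_estimate h (map_tuple src_W3 o.1) c = src_pair o.1 (inord c).
Proof.
move=> noerr; elim: c => [|c IHc] cB hE /=.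
  have -> : inord 0 = ord0 :> 'I_B.+2 by apply: val_inj; rewrite /= inordK.
  by rewrite /src_pair src_word_pad.
rewrite IHc ?(ltnW cB)// => [|b i bc]; last by apply: hE; apply: ltnW.
have loE : lo (inord c) = inord c by apply: val_inj; rewrite /= !inordK// ltnW.
have upE : up (inord c) = inord c.+1.
  by apply: val_inj; rewrite /= /bump /= !inordK.
have := noerr (inord c); rewrite /block_err negb_or => /andP[/negbNE/eqP + _].
rewrite loE upE word_map => <-; congr r; apply/ffunP => i; rewrite !ffunE.
by rewrite hE// inordK.
Qed.

Let dest_estimate_correct o c : (forall b, ~~ block_err o b) -> (c <= B.+1)%N ->
  dest_estimate (map_tuple snd o.2) (map_tuple src_W o.1) c =
  src_pair o.1 (inord (B.+1 - c)).
Proof.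
move=> noerr; elim: c => [|c IHc] cB /=.
  have -> : inord (B.+1 - 0) = ord_max :> 'I_B.+2.
    by apply: val_inj; rewrite /= inordK ?subn0.
  by rewrite /src_pair src_word_pad// ltnn andbF.
rewrite IHc ?(ltnW cB)// subSS.
have loE : lo (inord (B - c)) = inord (B - c).
  by apply: val_inj; rewrite /= !inordK// ltnS ?leq_subr// ltnW// ltnS leq_subr.
have upE : up (inord (B - c)) = inord (B.+1 - c).
  apply: val_inj; rewrite /= /bump /= !inordK ?ltnS ?leq_subr// add1n.
  by rewrite subSn.
have := noerr (inord (B - c)); rewrite /block_err negb_or => /andP[_ /negbNE/eqP].
rewrite loE upE word_map => <-; congr d; apply/ffunP => i; rewrite !ffunE.
by rewrite tnth_map.
Qed.

Let read_out_correct tz (g : nat -> _) :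
  (forall j, g (phi j).1 = src_pair tz (phi j).1) ->
  read_out g = (map_tuple src_S1 tz, map_tuple src_S2 tz).
Proof.
move=> gE; congr (_, _); apply: eq_from_tnth => j;
  by rewrite tnth_mktuple gE /= ffunE src_word_phi tnth_map.
Qed.

Let no_block_err_pmf o : (forall b, ~~ block_err o b) ->
  code_pmf pS ch (base_code block_markov_code) o = genie_pmf o.
Proof.
move=> noerr; congr (_ * _); apply: eq_bigr => k _; rewrite !tnth_mktuple.
congr ch; rewrite /= /genie_input3; case: pickP => [[b i] /eqP kE|//] /=.
rewrite (relay_estimate_correct noerr (ltnW (ltn_ord b))).
  suff -> : inord b = lo b by [].
  by apply: val_inj; rewrite /= inordK// ltnS ltnW.
move=> b' i' b'b; rewrite nth_take -?kE ?tau_mono//.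
by rewrite (nth_map (tnth o.2 (tau (b', i')))) ?size_tuple// -tnth_nth.
Qed.

Let no_block_err_dec o : (forall b, ~~ block_err o b) ->
  ~~ (dec_error (base_code block_markov_code) o ||
      relay_dec_error block_markov_code o).
Proof.
move=> noerr; rewrite negb_or /dec_error /relay_dec_error !negbK /=.
have inordE (j : 'I_m) : inord (phi j).1 = (phi j).1 by apply: inord_val.
apply/andP; split; apply/eqP; apply: read_out_correct => j.
  rewrite dest_estimate_correct ?leq_subr//.
  by rewrite subKn ?inordE// ltnW// ltnS; case/andP: (phi_inner j).
rewrite relay_estimate_correct ?inordE// => [|b i _].
  by case/andP: (phi_inner j) => _ /ltnW.
by rewrite (nth_map (tnth o.2 (tau (b, i)))) ?size_tuple// -tnth_nth.
Qed.

Let genie_law (tz : m.-tuple Z) : {ffun 'I_n -> Y3 * Y} -> R :=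
  prod_law (fun k => ch (input x01 src_S1 e1 (map_tuple src_S1 tz) k)
    (input x02 src_S2 e2 (map_tuple src_S2 tz) k) (genie_input3 tz k)).

Let sum_genie (F : m.-tuple Z * n.-tuple (Y3 * Y) -> R) :
  \sum_o genie_pmf o * F o = expect (prod_law (fun=> pS)) (fun z : {ffun 'I_m -> Z} =>
    expect (genie_law (mktuple z)) (fun y => F (mktuple z, mktuple y))).
Proof.
rewrite sum_pair.
rewrite sum_tuple_ffun; apply: eq_bigr => z _; rewrite sum_tuple_ffun mulr_sumr.
apply: eq_bigr => y _; rewrite mulrA; congr (_ * _ * _).
  by apply: eq_bigr => j _; rewrite tnth_mktuple.
by apply: eq_bigr => k _; rewrite !tnth_mktuple.
Qed.

Let genie_law_pmf tz : is_pmf (genie_law tz).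
Proof. by apply: prod_law_pmf => k; exact: chp. Qed.

Let genie_pmf_sum1 : \sum_o genie_pmf o = 1.
Proof.
have := sum_genie (fun=> 1); under eq_bigr do rewrite mulr1.
move=> ->; under eq_expect do rewrite expect_const//.
by rewrite expect_const//; apply: prod_law_pmf.
Qed.

Let code_pmf_sum1 : \sum_o code_pmf pS ch (base_code block_markov_code) o = 1.
Proof.
rewrite sum_pair.
transitivity (\sum_(tz : m.-tuple Z) \prod_(j < m) pS (tnth tz j)).
  apply: eq_bigr => tz _; rewrite /code_pmf /= -mulr_sumr -[RHS] mulr1; congr (_ * _).
  pose c := base_code block_markov_code.
  exact: (sum_causal_law fst (K := fun k h =>
    ch (tnth (enc1 c (map_tuple src_S1 tz)) k) (tnth (enc2 c (map_tuple src_S2 tz)) k)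
      (relay_enc c k h (map_tuple src_W3 tz))) (fun k h => chp _ _ _)).
rewrite sum_tuple_ffun; under eq_bigr do under eq_bigr do rewrite tnth_mktuple.
by apply: pmf_sum1; apply: (prod_law_pmf (mu := fun=> pS)).
Qed.

Let code_pmf_ge0 o : 0 <= code_pmf pS ch (base_code block_markov_code) o.
Proof.
rewrite mulr_ge0// prodr_ge0// => i _; first exact: pmf_ge0.
exact: (pmf_ge0 (chp _ _ _)).
Qed.

(* As long as no block error occurs, the relay sends what the genie sends. *)
Let Pe_le_genie : Pe_mabrc pS ch block_markov_code <=
  \sum_o genie_pmf o * [exists b, block_err o b]%:R.
Proof.
set E := fun o => [exists b, block_err o b].
have no_err o : ~~ E o -> forall b, ~~ block_err o b by move/existsPn.
apply: le_trans (_ : \sum_(o | E o) code_pmf pS ch (base_code block_markov_code) o <= _).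
  rewrite /Pe_mabrc big_mkcond [leRHS]big_mkcond; apply: ler_sum => o _.
  case: ifPn => [err|_]; last by case: ifP.
  case: ifPn => // /no_err/no_block_err_dec; first by rewrite err.
have -> : \sum_o genie_pmf o * (E o)%:R = \sum_(o | E o) genie_pmf o.
  by rewrite [RHS]big_mkcond; apply: eq_bigr => o _; rewrite mulr_natr mulrb.
(* Two laws of mass one that agree outside [E] give [E] the same mass. *)
have := code_pmf_sum1; rewrite -genie_pmf_sum1 (bigID E) [in RHS] (bigID E)/=.
rewrite [X in _ + X = _] (eq_bigr genie_pmf) => [/addIr->//|o oN].
exact/no_block_err_pmf/no_err.
Qed.

(** A block error depends on the outputs of channel block [b] only; injectivity of [tau] lets these
    be isolated as a marginal of the genie law. *)
Let block_err_law tz b :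
  expect (genie_law tz) (fun y => (block_err (tz, mktuple y) b)%:R) =
  block_word_fail (src_word tz (lo b)) (src_word tz (up b)).
Proof.
pose psi i := tau (b, i); have psiI : injective psi by move=> i i' /tau_inj[].
pose F y : R := (block_word_err (src_word tz (lo b)) (src_word tz (up b)) y)%:R.
transitivity (expect (genie_law tz) (fun y => F [ffun i => y (psi i)])).
  apply: eq_expect => y; rewrite /F /block_word_err /block_err /=.
  suff -> : out_word (mktuple y) b = [ffun i => y (psi i)] by [].
  by apply/ffunP => i; rewrite !ffunE tnth_mktuple.
rewrite (expect_marginal F)//; apply: eq_expect2 => // y.
apply: eq_bigr => i _ /=; rewrite /input /genie_input3.
case: pickP => [[b' i'] /eqP/tau_inj[-> ->] /=|/(_ (b, i))]; last by rewrite eqxx.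
by rewrite !word_map.
Qed.

Lemma Pe_block_markov_code_le : Pe_mabrc pS ch block_markov_code <=
  \sum_b expect (prod_law (fun=> pS)) (fun z : {ffun 'I_m -> Z} =>
    let f := blocks (overwrite phi z zeta) in block_word_fail (f (lo b)) (f (up b))).
Proof.
apply: le_trans Pe_le_genie _.
apply: le_trans (_ : \sum_o genie_pmf o * \sum_b (block_err o b)%:R <= _).
  apply: ler_sum => o _; rewrite ler_wpM2l//.
    by rewrite mulr_ge0// prodr_ge0// => i _; [exact: pmf_ge0|exact: (pmf_ge0 (chp _ _ _))].
  case: existsP => [[b err]|_]; last exact: sumr_ge0.
  by rewrite (bigD1 b)//= err lerDl sumr_ge0.
rewrite sum_genie; under eq_expect do rewrite expect_sum.
rewrite expect_sum; apply: ler_sum => b _.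
rewrite le_eqVlt; apply/orP; left; apply/eqP; apply: eq_expect => z.
rewrite block_err_law /=.
suff blockE c : src_word (mktuple z) c = blocks (overwrite phi z zeta) c by rewrite !blockE.
apply/ffunP => i; rewrite !ffunE; case: pickP => //= j _.
by rewrite tnth_mktuple.
Qed.

End FixedPadding.
(** A union bound over the channel blocks. With random padding each has the same mean failure
    probability, and some fixed padding does no worse than the mean. *)
Theorem exists_block_markov_code eps :
  expect (src_word_law pS) (fun z => expect (src_word_law pS) (block_word_fail z))
    < eps ->
  exists c : mabrc_code S1 S2 W3 W X1 X2 X3 Y3 Y m n,
    Pe_mabrc pS ch c < B.+1%:R * eps.
Proof.
move=> lt_eps.
pose A (f : {ffun 'I_B.+2 * I' -> Z}) :=
  \sum_b block_word_fail (blocks f (lo b)) (blocks f (up b)).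
have : expect (prod_law (fun=> pS)) (fun zeta : {ffun 'I_B.+2 * I' -> Z} =>
    expect (prod_law (fun=> pS)) (fun z : {ffun 'I_m -> Z} =>
      A (overwrite phi z zeta))) < B.+1%:R * eps.
  (* After resampling the array is i.i.d., and channel block b involves two distinct, hence
     independent, source blocks b and b + 1. *)
  rewrite expect_overwrite// expect_sum.
  have blockE b : expect (prod_law (fun=> pS))
      (fun f => block_word_fail (blocks f (lo b)) (blocks f (up b))) =
      expect (src_word_law pS) (fun z => expect (src_word_law pS) (block_word_fail z)).
    rewrite (expect_curry pS (fun f : {ffun 'I_B.+2 -> {ffun I' -> Z}} =>
      block_word_fail (f (lo b)) (f (up b)))).
    apply: expect_codeword2 => [k|]; first exact: src_word_law_pmf.
    by rewrite -val_eqE /= /bump /= add1n neq_ltn ltnSn.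
  under eq_bigr do rewrite blockE.
  by rewrite sumr_const card_ord -[X in X < _]mulr_natl ltr_pM2l ?ltr0n.
case/(expect_lt_ex (prod_law_pmf (fun=> pSp))) => zeta lt_zeta.
exists (block_markov_code zeta); apply: le_lt_trans lt_zeta.
by rewrite expect_sum; exact: Pe_block_markov_code_le.
Qed.

End BlockMarkovCode.

(** * Choice of the block lengths and achievability *)

Section Achievability.
Variables (R : realType) (S1 S2 W3 W X1 X2 X3 Y3 Y : finType).
Variables (pS : S1 * S2 * W3 * W -> R) (ch : X1 -> X2 -> X3 -> Y3 * Y -> R).
Hypotheses (pSp : is_pmf pS) (chp : is_channel ch).

Lemma achievable_mabrc_marc kappa :
  achievable_mabrc pS ch kappa -> achievable_marc pS ch kappa.
Proof.
move=> ach eps /ach[m0 H]; exists m0 => m /H[c lt_eps].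
exists (base_code c); apply: le_lt_trans lt_eps.
rewrite /Pe_marc /Pe_mabrc big_mkcond [leRHS]big_mkcond; apply: ler_sum => o _.
case: ifP => //= _; case: ifP => // _.
rewrite mulr_ge0// prodr_ge0// => i _; first exact: pmf_ge0.
exact: (pmf_ge0 (chp _ _ _)).
Qed.

Lemma block_lengths (eta : R) : 0 < eta ->
  exists B, forall L0, exists m0, forall m, (m0 < m)%N ->
    exists L L', [/\ (L0 <= L)%N, (L <= L')%N, (0 < L')%N, (B.+1 * L <= m)%N &
      (m <= B * L')%N] /\ L'%:R <= (1 + eta) * L%:R.
Proof.
(* B exceeds the inverse of eta, so that (B+1)/B is strictly below 1 + eta; the slack [c] absorbs
   the rounding of the two quotients. *)
move=> eta0; pose B := (Num.bound eta^-1).+1.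
have etaB : 1 < eta * B%:R.
  rewrite -ltr_pdivrMl// mulr1; apply: lt_trans (archi_boundP _) _.
    by rewrite invr_ge0 ltW.
  by rewrite ltr_nat.
pose c := eta * B%:R - 1; have c0 : 0 < c by rewrite subr_gt0.
(* The bounds B L' <= m + B and (B+1) L >= m - B reduce the claim to (B+1)(m+B) <= (1+eta) B (m-B),
   which says exactly that m >= K. *)
pose K : R := (B%:R * (B%:R + 1) + (1 + eta) * B%:R ^+ 2) / c.
have K0 : 0 <= K by rewrite divr_ge0 ?(ltW c0)// addr_ge0 ?mulr_ge0 ?addr_ge0 ?exprn_ge0 ?ler0n// ltW.
exists B => L0; exists (maxn (Num.bound K) (L0 * B.+1)) => m; rewrite gtn_max => /andP[Km L0m].
pose L := (m %/ B.+1)%N; pose L' := (m %/ B).+1.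
exists L, L'; split; first split => //.
- by rewrite leq_divRL// ltnW.
- by apply/leqW/leq_div2l.
- by rewrite mulnC leq_divM.
- by rewrite mulnC ltnW// ltn_ceil.
have Km' : K <= m%:R.
  by apply: ltW; apply: lt_trans (archi_boundP K0) _; rewrite ltr_nat.
have mL : m%:R <= (B%:R + 1) * L%:R + B%:R :> R.
  rewrite natr1 -natrM -natrD ler_nat mulnC.
  by rewrite {1}(divn_eq m B.+1) leq_add2l -ltnS ltn_pmod.
have L'm : B%:R * L'%:R <= m%:R + B%:R :> R.
  by rewrite -natrM -natrD ler_nat mulnS addnC leq_add2r mulnC leq_divM.
have B0 : 0 < B%:R :> R by rewrite ltr0n.
have Km2 : B%:R * (B%:R + 1) + (1 + eta) * B%:R ^+ 2 <= m%:R * c.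
  by rewrite -ler_pdivrMr.
have BB : 0 < B%:R * (B%:R + 1) :> R by rewrite mulr_gt0// ltr_wpDr.
rewrite -(ler_pM2l BB).
apply: le_trans (_ : (B%:R + 1) * (m%:R + B%:R) <= _).
  by rewrite mulrAC mulrC ler_wpM2l// addr_ge0// ltW.
apply: le_trans (_ : (1 + eta) * B%:R * (m%:R - B%:R) <= _).
  move: Km2; rewrite /c; set b : R := B%:R; set M : R := m%:R => Km2.
  by rewrite -subr_ge0; move: Km2; rewrite -subr_ge0; congr (0 <= _); ring.
have -> : B%:R * (B%:R + 1) * ((1 + eta) * L%:R) =
  (1 + eta) * B%:R * ((B%:R + 1) * L%:R) by ring.
apply: ler_wpM2l; last by rewrite lerBlDr.
by rewrite mulr_ge0 ?ler0n// addr_ge0// ltW.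
Qed.

Lemma block_code_achievable (x01 : X1) (x02 : X2) (x03 : X3) (y03 : Y3) :
  block_regime (block_code_spec pS ch) -> achievable_mabrc pS ch 1.
Proof.
move=> [eta eta0 H] eps eps0; have [B lengths] := block_lengths eta0.
have eB0 : 0 < eps / B.+1%:R by rewrite divr_gt0 ?ltr0n.
have [L0 HL0] := H _ eB0; have [m0 Hm0] := lengths L0.
exists m0 => m /Hm0[L [L' [[L0L LL' L'0 Lm mL'] L'L]]].
rewrite mul1r natrK.
have widenI : injective (widen_ord LL') by move=> i j /(congr1 val)/= /val_inj.
have [||e1 [e2 [e3 [r [d lt_eps]]]]] := HL0 _ _ (widen_ord LL') widenI.
- by rewrite card_ord.
- by rewrite !card_ord.
(* The successor shifts the source letters to blocks 1 to B, leaving block 0 to the padding. *)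
pose phi (j : 'I_m) : 'I_B.+2 * 'I_L' :=
  (inord (j %/ L').+1, Ordinal (ltn_pmod j L'0)).
have div_lt (j : 'I_m) : (j %/ L' < B)%N.
  by rewrite ltn_divLR//; apply: leq_trans mL'.
have tau_lt (bi : 'I_B.+1 * 'I_L) : (bi.1 * L + bi.2 < m)%N.
  apply: leq_trans Lm; rewrite -ltnS.
  case: bi => -[b bB] [i iL] /=; rewrite ltnS.
  by apply: leq_trans (_ : b.+1 * L <= _)%N; rewrite ?leq_mul2r ?bB ?orbT// mulSn addnC ltn_add2r.
pose tau bi := Ordinal (tau_lt bi).
have phi_inj : injective phi.
  move=> j j' [] /(congr1 val); rewrite /= !inordK ?ltnS ?(ltnW (div_lt _))// => -[qE] rE.
  by apply: val_inj; rewrite /= (divn_eq j L') (divn_eq j' L') qE rE.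
have tau_mono (b b' : 'I_B.+1) i i' : (b < b')%N -> (tau (b, i) < tau (b', i'))%N.
  move=> bb' /=; apply: leq_trans (_ : b.+1 * L <= _)%N.
    by rewrite mulSn addnC ltn_add2r.
  by apply: leq_trans (leq_addr _ _); rewrite leq_mul2r bb' orbT.
have tau_inj : injective tau.
  move=> [b i] [b' i'] tauE.
  have bE : b = b'.
    apply: val_inj; case: (ltngtP b b') => // /tau_mono lt.
      by have := lt i i'; rewrite tauE ltnn.
    by have := lt i' i; rewrite tauE ltnn.
  move/(congr1 val): tauE; rewrite /= bE => /addnI iE.
  by congr (_, _); exact: val_inj.
have phi_inner j : (0 < (phi j).1 < B.+1)%N.
  by rewrite /= inordK ?ltnS ?div_lt// ltnW.
have [c lt_c] := exists_block_markov_code pSp chp x01 x02 x03 y03 phi_inj tau_inj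
  phi_inner tau_mono lt_eps.
by exists c; rewrite mulrC divfK ?pnatr_eq0 in lt_c.
Qed.

End Achievability.

Theorem theorem8 (R : realType)
    (S1 S2 W3 W X1 X2 X3 Y3 Y T : finType)
    (pS : S1 * S2 * W3 * W -> R) (pS_pmf : is_pmf pS)
    (ch : X1 -> X2 -> X3 -> Y3 * Y -> R) (ch_channel : is_channel ch)
    (h1 : S1 -> T) (h2 : S2 -> T)
    (T_common : GKW_common_part pS src_S1 src_S2 h1 h2) :
  (exists (Q : finType) (pQ : Q -> R)
          (pX1 : S1 -> Q -> X1 -> R) (pX2 : S2 -> Q -> X2 -> R)
          (pX3 : S1 -> S2 -> Q -> X3 -> R),
     [/\ is_pmf pQ,
         forall s1 q, is_pmf (pX1 s1 q),
         forall s2 q, is_pmf (pX2 s2 q) &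
         forall s1 s2 q, is_pmf (pX3 s1 s2 q)] /\
     let P := joint_pmf pS pQ pX1 pX2 pX3 ch in
     let rvT := h1 \o rvS1 in
     `H[P](rvS1 | [% rvS2, rvW3])
       < `I[P](rvX1 ; rvY3 | [% rvS1, rvX2, rvX3, rvQ]) /\
     `H[P](rvS2 | [% rvS1, rvW3])
       < `I[P](rvX2 ; rvY3 | [% rvS2, rvX1, rvX3, rvQ]) /\
     `H[P]([% rvS1, rvS2] | rvW3)
       < `I[P]([% rvX1, rvX2] ; rvY3 | [% rvS1, rvS2, rvX3, rvQ]) /\
     `H[P](rvS1 | [% rvS2, rvW])
       < `I[P]([% rvX1, rvX3] ; rvY | [% rvS2, rvX2, rvW, rvQ]) /\
     `H[P](rvS2 | [% rvS1, rvW])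
       < `I[P]([% rvX2, rvX3] ; rvY | [% rvS1, rvX1, rvW, rvQ]) /\
     `H[P]([% rvS1, rvS2] | [% rvW, rvT])
       < `I[P]([% rvX1, rvX2, rvX3] ; rvY | [% rvW, rvT, rvQ]) /\
     `H[P]([% rvS1, rvS2] | rvW)
       < `I[P]([% rvX1, rvX2, rvX3] ; rvY | rvW)) ->
  achievable_marc pS ch 1 /\ achievable_mabrc pS ch 1.
Proof.
move=> [Q [pQ [pX1 [pX2 [pX3 [[pQp pX1p pX2p pX3p] /= ]]]]]].
move=> [i1 [i2 [i3 [i4 [i5 [i6 i7]]]]]].
suff ach : achievable_mabrc pS ch 1 by split=> //; exact: achievable_mabrc_marc.
(* The code needs default letters; the alphabets are nonempty because they carry probability
   laws. *)
have [z _] := pmf_inhabited pS_pmf; have [q _] := pmf_inhabited pQp.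
have [x1 _] := pmf_inhabited (pX1p (src_S1 z) q).
have [x2 _] := pmf_inhabited (pX2p (src_S2 z) q).
have [x3 _] := pmf_inhabited (pX3p (src_S1 z) (src_S2 z) q).
have [y _] := pmf_inhabited (ch_channel x1 x2 x3).
apply: (block_code_achievable pS_pmf ch_channel x1 x2 x3 y.1).
exact: (block_code pS_pmf pQp pX1p pX2p pX3p ch_channel T_common.1 i1 i2 i3 i4 i5 i6 i7).
Qed.
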